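(* Let $p,q$ be integers with $1\le p\le q$ and $q>1$, let $A=K\widetilde{\mathbb{A}}_{p,q}$, and let $F=(S_{p-1},S_{p-2},\ldots,S_1)$ and $G=(S_{p+q-2},S_{p+q-3},\ldots,S_p)$. The complete list (up to isomorphism of $M$ and $Y$) of stratifying systems over $A$ of the form $(M,F,G,Y)$, where $Y$ is a postprojective $A$-module, is the following; that is, each sequence listed is such a stratifying system, and every such stratifying system is one of those listed: (1) $(S_{p+q-1},F,G,P_0)$. (2) $(M,F,G,P_{p+q-1})$, where $M\cong\tau^{-p+1}P_0$ if $p=q$, and $M\cong\tau^{-p+1}P_{q-1}$ if $p\ne q$. (3) $(M,F,G,\tau^{-t}P_{p+q-1})$, with $t\geq 1$ an integer such that $p\mid t$ and $q\mid t$, where $M\cong\tau^{-t-p+1}P_0$ if $p=q$, and $M\cong\tau^{-t-p+1}P_{q-1}$ if $p\neq q$. (4) $(\tau^{-t+1}P_{p+q-1},F,G,\tau^{-t}P_0)$, with $t\geq 1$ an integer such that $p\mid t$ and $q\mid t$. (5) $(\tau^{-t-(p-r-1)}P_{q+r-1},F,G,\tau^{-t}P_{p-r})$, with integers $t\geq 1$ and $r\in[1,p-1]$ such that $q\mid t$ and $t\equiv r\pmod p$. (6) $(M,F,G,\tau^{-t}P_{p+q-r-1})$, with integers $t\geq 1$ and $r\in[1,q-1]$ such that $p\mid t$ and $t\equiv r\pmod q$, where $M\cong\tau^{-t-q+r+1}P_{p-q+r}$ if $p\ge q-r$, and $M\cong\tau^{-t-p+1}P_{q-r-1}$ if $p<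q-r$.
   Context: $K$ is an algebraically closed field; modules are finitely generated right modules, identified with finite-dimensional representations of the quiver. For integers $m,n\ge 0$, $[m,n]=\{m,m+1,\ldots,n\}$ if $m\le n$ and $[m,n]=\emptyset$ if $m>n$. The quiver $\widetilde{\mathbb{A}}_{p,q}$ has vertices $0,1,\ldots,p+q-1$ and is formed by two parallel paths from the source $p+q-1$ to the sink $0$: the path $p+q-1\to p-1\to p-2\to\cdots\to 1\to 0$ with $p$ arrows (a single arrow $p+q-1\to0$ if $p=1$) and the path $p+q-1\to p+q-2\to\cdots\to p+1\to p\to0$ with $q$ arrows. $S_v$ and $P_v$ denote the simple module at vertex $v$ and its projective cover; conventions are such that the composition factors of $P_v$ are the $S_w$ with $w$ reachable from $v$ (so $P_0=S_0$). $\tau$ is the Auslander-Reiten translation and $\tau^{-1}$ its inverse. An indecomposable module is postprojective if it is isomorphic to $\tau^{-t}P_j$ for some $t\ge0$ and some vertex $j$. The sequence $F$ has length $p-1$ (empty if $p=1$) and $G$ has length $q-1$. A stratifying system of size $t$ is an ordered sequence $(X_1,\ldots,X_t)$ of indecomposable $A$-modules with $\mathrm{Hom}_A(X_j,X_i)=0$ for $j>i$ and $\mathrm{Ext}^1_A(X_j,X_i)=0$ for $j\ge i$. $(M,F,G,Y)$ denotes the sequence consisting of $M$, followed by the terms of $F$ in order, then the terms of $G$ in order, then $Y$. *)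

(* Defs.v *)
From HB Require Import structures.
From mathcomp Require Import all_boot all_order all_algebra.

Set Implicit Arguments.
Unset Strict Implicit.
Unset Printing Implicit Defensive.

Import GRing.Theory.
Local Open Scope ring_scope.

Record quiver := Quiver {
  vertex : finType;
  arrow : finType;
  src : arrow -> vertex;
  tgt : arrow -> vertex
}.

Definition op (Q : quiver) : quiver :=
  @Quiver (vertex Q) (arrow Q) (@tgt Q) (@src Q).

(* Finite-dimensional representations.  The space at [v] consists of row
   vectors of length [dim v] and matrices act on the right; so a
   representation of Q is a finite-dimensional right module over KQ, where
   paths are composed from left to right. *)
Record rep (K : fieldType) (Q : quiver) := Rep {
  dim : vertex Q -> nat;
  act : forall a : arrow Q, 'M[K]_(dim (src a), dim (tgt a))
}.

Section Representations.
Variables (K : fieldType) (Q : quiver).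
Implicit Types (M N E P X Y : rep K Q) (v w : vertex Q).

Definition fam M N := forall v, 'M[K]_(dim M v, dim N v).

Definition is_hom M N (f : fam M N) : Prop :=
  forall a : arrow Q, act M a *m f (tgt a) = f (src a) *m act N a.

Definition epi M N (f : fam M N) : Prop := forall v, row_full (f v).
Definition mono M N (f : fam M N) : Prop := forall v, row_free (f v).

(* The composite "f then g" is [f v *m g v]. *)
Definition exact_at M N P (f : fam M N) (g : fam N P) : Prop :=
  forall v, (f v :=: kermx (g v))%MS.

Definition isom M N : Prop :=
  exists (f : fam M N) (g : fam N M), [/\ is_hom f, is_hom g,
    forall v, f v *m g v = 1%:M & forall v, g v *m f v = 1%:M].

Definition is_zero M : Prop := forall v, dim M v = 0%N.

Definition dsum M N : rep K Q :=
  @Rep K Q (fun v => (dim M v + dim N v)%N)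
    (fun a => block_mx (act M a) 0 0 (act N a)).

Definition indecomposable M : Prop :=
  ~ is_zero M /\
  forall X Y, isom M (dsum X Y) -> is_zero X \/ is_zero Y.

Definition hom_vanishes X Y : Prop :=
  forall f : fam X Y, is_hom f -> forall v, f v = 0.

(* Ext^1(X, Y) = 0, for the Yoneda Ext^1: every short exact sequence
   0 -> Y -> E -> X -> 0 splits. *)
Definition ext1_vanishes X Y : Prop :=
  forall E (f : fam Y E) (g : fam E X),
    is_hom f -> is_hom g -> mono f -> epi g -> exact_at f g ->
  exists s : fam X E, is_hom s /\ forall v, s v *m g v = 1%:M.

Definition simple v : rep K Q :=
  @Rep K Q (fun w => nat_of_bool (w == v)) (fun _ => 0).

(* Paths as sequences of arrows; [walk v w [::]] holds iff v = w, which gives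
   the trivial path at v. *)
Fixpoint walk v w (s : seq (arrow Q)) : bool :=
  if s is a :: s' then (src a == v) && walk (tgt a) w s' else v == w.

(* When Q is acyclic no path has more than #|vertex Q| arrows, so the length
   bound loses nothing; it only makes the type of paths finite. *)
Definition paths v w : {set #|vertex Q|.-bseq (arrow Q)} :=
  [set s : #|vertex Q|.-bseq (arrow Q) | walk v w s].

(* For Q acyclic: the right module P_v = e_v KQ, with basis the paths starting
   at v, which is the projective cover of the simple at v. *)
Definition proj v : rep K Q :=
  @Rep K Q (fun w => #|paths v w|)
    (fun a => \matrix_(i, j)
       (rcons (enum_val i : #|vertex Q|.-bseq _) a ==
        (enum_val j : #|vertex Q|.-bseq _) :> seq _)%:R).

(* Left multiplication by the arrow a : v -> w, as a map P_w -> P_v. *)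
Definition lmul (a : arrow Q) : fam (proj (tgt a)) (proj (src a)) :=
  fun _ => \matrix_(i, j)
    (a :: (enum_val i : #|vertex Q|.-bseq _) ==
     (enum_val j : #|vertex Q|.-bseq _) :> seq _)%:R.

Definition projective P : Prop :=
  forall X Y (g : fam X Y) (f : fam P Y),
    is_hom g -> epi g -> is_hom f ->
  exists f' : fam P X, is_hom f' /\ forall v, f' v *m g v = f v.

Definition subrep M (U : forall v, 'M[K]_(dim M v)) : Prop :=
  forall a : arrow Q, (U (src a) *m act M a <= U (tgt a))%MS.

Definition superfluous M (L : forall v, 'M[K]_(dim M v)) : Prop :=
  forall U : forall v, 'M[K]_(dim M v), subrep U ->
    (forall v, row_full (L v + U v)%MS) -> forall v, row_full (U v).

(* P1 -h-> P0 -e-> M -> 0 is exact, with e : P0 -> M and h : P1 -> Ker e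
   projective covers. *)
Definition min_proj_presentation P1 P0 M (h : fam P1 P0) (e : fam P0 M)
    : Prop :=
  [/\ projective P1, projective P0, is_hom h, is_hom e & epi e] /\
  [/\ exact_at h e,
      superfluous (fun v => kermx (e v)) &
      superfluous (fun v => kermx (h v))].

End Representations.

Definition dual (K : fieldType) (Q : quiver) (M : rep K Q) : rep K (op Q) :=
  @Rep K (op Q) (dim M) (fun a => (act M a)^T).

(* T is a transpose Tr N = Coker (Hom(P0, A) -> Hom(P1, A)), where
   P1 -h-> P0 -> N -> 0 is a minimal projective presentation over
   A = K(op Q).  The space of Hom(P, A) at v is Hom(P, e_v A) = Hom(P, P_v);
   [c v] is the cokernel projection Hom(P1, P_v) -> T_v.  The four clauses on
   [c] say that it is linear, surjective, with kernel the maps that factor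
   through h, and compatible with the action of the arrows. *)
Definition is_transpose (K : fieldType) (Q : quiver)
    (N : rep K (op Q)) (T : rep K Q) : Prop :=
  exists (P1 P0 : rep K (op Q)) (h : fam P1 P0) (e : fam P0 N),
    min_proj_presentation h e /\
  exists c : forall v : vertex (op Q),
      fam P1 (@proj K (op Q) v) -> 'rV[K]_(dim T v),
  [/\ forall v (k : K) (f g : fam P1 (@proj K (op Q) v)),
        is_hom f -> is_hom g ->
        c v (fun x => k *: f x + g x) = k *: c v f + c v g,
      forall v (y : 'rV[K]_(dim T v)), exists2 f, is_hom f & c v f = y,
      forall v (f : fam P1 (@proj K (op Q) v)), is_hom f ->
        (c v f = 0 <->
         exists g : fam P0 (@proj K (op Q) v),
           is_hom g /\ forall x, f x = h x *m g x) &
      forall (a : arrow Q) (f : fam P1 (@proj K (op Q) (src a))), is_hom f ->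
        c (tgt a) (fun x => f x *m @lmul K (op Q) a x) =
        c (src a) f *m act T a].

(* The inverse Auslander-Reiten translate is Tr D. *)
Definition is_tauinv (K : fieldType) (Q : quiver) (M X : rep K Q) : Prop :=
  is_transpose (dual M) X.

(* X is isomorphic to the t-fold inverse translate of M. *)
Fixpoint is_tauinv_iter (K : fieldType) (Q : quiver) (t : nat)
    (M X : rep K Q) : Prop :=
  if t is t'.+1 then exists N, is_tauinv_iter t' M N /\ is_tauinv N X
  else isom X M.

Definition postprojective (K : fieldType) (Q : quiver) (X : rep K Q) : Prop :=
  indecomposable X /\
  exists (t : nat) (j : vertex Q), is_tauinv_iter t (@proj K Q j) X.

Definition stratifying_system (K : fieldType) (Q : quiver) (t : nat)
    (X : t.-tuple (rep K Q)) : Prop :=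
  [/\ forall i : 'I_t, indecomposable (tnth X i),
      forall i j : 'I_t, (i < j)%N -> hom_vanishes (tnth X j) (tnth X i) &
      forall i j : 'I_t, (i <= j)%N -> ext1_vanishes (tnth X j) (tnth X i)].

(* The vertices 0, ..., p+q-1; note (p + q).-1.+1 = p + q when 0 < p + q. *)
Definition vtx (p q i : nat) : 'I_(p + q).-1.+1 := inord i.

(* [inl i], for i < p, is the arrow into i on the path
     p+q-1 -> p-1 -> ... -> 1 -> 0;
   [inr j], for j < q, is the arrow out of p+j on the path
     p+q-1 -> p+q-2 -> ... -> p -> 0. *)
Definition Atilde (p q : nat) : quiver :=
  @Quiver 'I_(p + q).-1.+1 ('I_p + 'I_q)%type
    (fun a => match a with
       | inl i => vtx p q (if (i.+1 < p)%N then i.+1 else (p + q).-1)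
       | inr j => vtx p q (p + j)
       end)
    (fun a => match a with
       | inl i => vtx p q i
       | inr j => vtx p q (if j == 0%N :> nat then 0%N else (p + j).-1)
       end).

Definition S_ (K : fieldType) (p q i : nat) : rep K (Atilde p q) :=
  @simple K (Atilde p q) (vtx p q i).

Definition P_ (K : fieldType) (p q i : nat) : rep K (Atilde p q) :=
  @proj K (Atilde p q) (vtx p q i).

(* (S_{p-1}, S_{p-2}, ..., S_1) *)
Definition seqF (K : fieldType) (p q : nat) : seq (rep K (Atilde p q)) :=
  [seq S_ K p q i | i <- rev (iota 1 (p - 1))].

(* (S_{p+q-2}, S_{p+q-3}, ..., S_p) *)
Definition seqG (K : fieldType) (p q : nat) : seq (rep K (Atilde p q)) :=
  [seq S_ K p q i | i <- rev (iota p (q - 1))].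

(* Main.v *)
From HB Require Import structures.
From mathcomp Require Import all_boot all_order all_algebra.
From mathcomp Require Import boolp zify.
Require Import Defs.

Set Implicit Arguments.
Unset Strict Implicit.
Unset Printing Implicit Defensive.

Import GRing.Theory.

(** Let [source] be the vertex p+q-1, [sink] the vertex 0, and call the other
    vertices interior; F and G list the interior simples in an order for which
    all the conditions among themselves hold.  What remains is that M has no Hom
    and no Ext^1 from the interior simples, that Y has none to them, that M and
    Y are indecomposable without self-extensions, and that Hom(Y, M) and
    Ext^1(Y, M) vanish ([stratifyingP]).

    An interior vertex v has one arrow in and one arrow out.  Hom(S_v, M) and
    Ext^1(S_v, M) are the kernel and the cokernel of the arrow out of v on M, so
    the condition on M says that these arrows act invertibly, and dually for Y
    and the arrows in.  Either condition leaves only the two composites from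
    [source] to [sink], that is, a module over the Kronecker algebra
    ([hom_of_ends]).

    The postprojective modules are string modules.  The inverse translate
    lengthens both ends of a string by one step ([is_tauinv_string], computed
    from an explicit minimal projective presentation of the dual), so tau^-t P_v
    is determined by how far the ends have grown ([is_tauinv_iterP]).  It is
    orthogonal to the interior simples exactly when no end stops inside one of
    the two paths, that is, when the growth of one end is divisible by q and
    that of the other by p.  Then Y is [string n 0 0], which restricts to the
    preprojective Kronecker module with dimension vector (n, n+1).

    The module M is forced to be the Kronecker module preceding Y: the string
    of dimensions n-1 and n at [source] and [sink], or the simple at [source]
    when n = 0 ([partner]).  It meets the conditions because morphisms between these
    strings are Toeplitz matrices at the sink, and because the Euler form, computing
    dim Hom - dim Ext^1, then leaves no room for extensions.  Conversely,
    vanishing of Hom(Y, M) and Ext^1(Y, M) exhibits this module as a direct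
    summand of M ([kronecker_retract], by induction along reflection functors),
    and M is indecomposable.

    The list is obtained by solving the two divisibility conditions for t
    according to the position of v: at [source], at [sink], or inside one of the
    two paths.  The string of M has both ends one step short of completing a
    path, which locates it in turn as an iterated inverse translate. *)

(** * Isomorphisms, retracts and indecomposability *)

Section Morphisms.
Variables (K : fieldType) (Q : quiver).
Local Open Scope ring_scope.
Implicit Types (M N P X Y : rep K Q).

Lemma hom_comp M N P (f : fam M N) (g : fam N P) :
  is_hom f -> is_hom g -> is_hom (fun v => f v *m g v).
Proof. by move=> hf hg a; rewrite mulmxA hf -!mulmxA hg. Qed.

Lemma hom_id M : is_hom (fun v => 1%:M : 'M_(dim M v)).
Proof. by move=> a; rewrite mulmx1 mul1mx. Qed.

Lemma hom_lincomb M N (k : K) (f g : fam M N) :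
  is_hom f -> is_hom g -> is_hom (fun v => k *: f v + g v).
Proof.
by move=> hf hg a; rewrite mulmxDr mulmxDl -scalemxAr -scalemxAl hf hg.
Qed.

Lemma hom0 M N : is_hom (fun v => 0 : 'M_(dim M v, dim N v)).
Proof. by move=> a; rewrite mulmx0 mul0mx. Qed.

Lemma isom_refl M : isom M M.
Proof.
by exists (fun v => 1%:M), (fun v => 1%:M); split=> [||v|v];
  rewrite ?mulmx1 //; apply: hom_id.
Qed.

Lemma isom_sym M N : isom M N -> isom N M.
Proof. by case=> f [g [hf hg fg gf]]; exists g, f; split. Qed.

Lemma isom_trans M N P : isom M N -> isom N P -> isom M P.
Proof.
case=> f [g [hf hg fg gf]] [f' [g' [hf' hg' fg' gf']]].
exists (fun v => f v *m f' v), (fun v => g' v *m g v).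
split=> [||v|v]; try exact: hom_comp.
  by rewrite mulmxA -(mulmxA (f v)) fg' mulmx1 fg.
by rewrite mulmxA -(mulmxA (g' v)) gf mulmx1 gf'.
Qed.

Lemma dim_le_of_row_free m n (A : 'M[K]_(m, n)) : row_free A -> (m <= n)%N.
Proof. by move/eqP=> <-; apply: rank_leq_col. Qed.

Lemma dim_le_of_row_full m n (A : 'M[K]_(m, n)) : row_full A -> (n <= m)%N.
Proof. by move/eqP=> <-; apply: rank_leq_row. Qed.

Lemma isom_dim M N : isom M N -> forall v, dim M v = dim N v.
Proof.
case=> f [g [_ _ fg gf]] v; apply/eqP; rewrite eqn_leq.
apply/andP; split; [apply: (@dim_le_of_row_free _ _ (f v))
                   |apply: (@dim_le_of_row_free _ _ (g v))];
  apply/row_freeP; [by exists (g v)|by exists (f v)].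
Qed.

(** The cast between the spaces at equal vertices, extended by zero to distinct
    ones, so that a family supported at one vertex needs no case distinction on
    the type of its matrices. *)
Definition transport X v w : 'M[K]_(dim X v, dim X w) :=
  if @eqP _ v w is ReflectT e then castmx (erefl, congr1 (dim X) e) 1%:M
  else 0.

Lemma transport_id X v : transport X v v = 1%:M.
Proof.
by rewrite /transport; case: eqP => // e; rewrite (eq_axiomK e) castmx_id.
Qed.

Lemma transport_neq X v w : v != w -> transport X v w = 0.
Proof. by rewrite /transport; case: eqP. Qed.

End Morphisms.

Section IsomInvariance.
Variables (K : fieldType) (Q : quiver).
Local Open Scope ring_scope.
Implicit Types (M N P X Y : rep K Q).

Lemma hom_vanishes_isom X X' Y Y' :
  isom X X' -> isom Y Y' -> hom_vanishes X Y -> hom_vanishes X' Y'.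
Proof.
case=> a [a' [ha ha' aa' a'a]] [b [b' [hb hb' bb' b'b]]] H f hf v.
have /H/(_ v) E : is_hom (fun v => a v *m f v *m b' v).
  by apply: hom_comp => //; apply: hom_comp.
rewrite -(mul1mx (f v)) -(mulmx1 (_ *m f v)) -a'a -b'b.
by rewrite -!mulmxA (mulmxA (f v)) (mulmxA (a v)) (mulmxA (a v)) E mul0mx mulmx0.
Qed.

Lemma ext1_vanishes_isom X X' Y Y' :
  isom X X' -> isom Y Y' -> ext1_vanishes X Y -> ext1_vanishes X' Y'.
Proof.
case=> a [a' [ha ha' aa' a'a]] [b [b' [hb hb' bb' b'b]]] H E f g hf hg mf eg fg.
have [||v|v|v|s [hs sg]] :=
  H E (fun v => b v *m f v) (fun v => g v *m a' v).
- exact: hom_comp.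
- exact: hom_comp.
- have /row_freeP[f' ff'] := mf v; apply/row_freeP.
  by exists (f' *m b' v); rewrite mulmxA -(mulmxA (b v)) ff' mulmx1 bb'.
- have /row_fullP[g' gg'] := eg v; apply/row_fullP.
  by exists (a v *m g'); rewrite mulmxA -(mulmxA (a v)) gg' mulmx1 aa'.
- have e1 : (b v *m f v :=: f v)%MS.
    apply/eqmxP/andP; split; first exact: submxMl.
    by apply/submxP; exists (b' v); rewrite mulmxA b'b mul1mx.
  apply: (eqmx_trans e1); apply: (eqmx_trans (fg v)).
  apply/eqmxP/andP; split; apply/sub_kermxP.
    by rewrite mulmxA mulmx_ker mul0mx.
  rewrite -[X in _ *m X]mulmx1 -a'a 2!mulmxA -(mulmxA _ (g v)) mulmx_ker.
  by rewrite mul0mx.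
exists (fun v => a' v *m s v); split; first exact: hom_comp.
move=> v; rewrite -(mulmx1 (g v)) -a'a (mulmxA (g v)) mulmxA.
by rewrite -(mulmxA (a' v)) sg mulmx1 a'a.
Qed.

Lemma indecomposable_isom X X' :
  isom X X' -> indecomposable X -> indecomposable X'.
Proof.
move=> i [nz dec]; split; last first.
  by move=> A B iAB; apply: dec; apply: isom_trans iAB.
by move=> z; apply: nz => v; rewrite (isom_dim i).
Qed.

End IsomInvariance.

Section Subrepresentations.
Variables (K : fieldType) (Q : quiver).
Local Open Scope ring_scope.
Implicit Types (M N P X Y : rep K Q).

Variables (M : rep K Q) (U : forall v, 'M[K]_(dim M v)).

Definition subrep_rep : rep K Q :=
  @Rep K Q (fun v => \rank (U v))
    (fun a => row_base (U (src a)) *m act M a *m pinvmx (row_base (U (tgt a)))).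

Definition subrep_incl : fam subrep_rep M := fun v => row_base (U v).

Hypothesis sU : subrep U.

Lemma hom_subrep_incl : is_hom subrep_incl.
Proof.
move=> a; rewrite /= mulmxKpV //; rewrite eq_row_base.
by apply: submx_trans (sU a); apply: submxMr; rewrite eq_row_base.
Qed.

Lemma mono_subrep_incl : mono subrep_incl.
Proof. by move=> v; apply: row_base_free. Qed.

Lemma subrep_corestrict N (f : fam N M) :
    is_hom f -> (forall v, (f v <= U v)%MS) ->
  exists f' : fam N subrep_rep,
    is_hom f' /\ forall v, f' v *m subrep_incl v = f v.
Proof.
move=> hf le; pose f' : fam N subrep_rep := fun v => f v *m pinvmx (row_base (U v)).
have E v : f' v *m subrep_incl v = f v.
  by rewrite /f' mulmxKpV // eq_row_base.
exists f'; split=> // a.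
apply: (row_free_inj (mono_subrep_incl (tgt a))).
by rewrite -mulmxA -[RHS]mulmxA E hom_subrep_incl mulmxA E hf.
Qed.

End Subrepresentations.

Section Indecomposability.
Variables (K : fieldType) (Q : quiver).
Local Open Scope ring_scope.
Implicit Types (M N P X Y : rep K Q).

Lemma subrep_ker M N (f : fam M N) : is_hom f -> subrep (fun v => kermx (f v)).
Proof.
by move=> hf a; apply/sub_kermxP; rewrite -mulmxA hf mulmxA mulmx_ker mul0mx.
Qed.

(** The kernel of the retraction is a complement of N, and an indecomposable
    module has no room for it beside a nonzero summand. *)
Lemma isom_of_retract M N (i : fam N M) (r : fam M N) :
    indecomposable M -> ~ is_zero N -> is_hom i -> is_hom r ->
    (forall v, i v *m r v = 1%:M) -> isom M N.
Proof.
move=> [_ dec] nzN hi hr ir.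
pose C := subrep_rep (fun v => kermx (r v)).
have sK := subrep_ker hr.
have hj := hom_subrep_incl sK.
pose j := @subrep_incl _ _ M (fun v => kermx (r v)).
have hd : is_hom (fun v => 1%:M - r v *m i v).
  by move=> a; rewrite mulmxBr mulmxBl mulmx1 mul1mx mulmxA hr -mulmxA hi mulmxA.
have [v|c [hc cj]] := subrep_corestrict sK hd.
  by apply/sub_kermxP; rewrite mulmxBl mul1mx -mulmxA ir mulmx1 subrr.
have jr v : j v *m r v = 0.
  by apply/sub_kermxP; rewrite /j /subrep_incl eq_row_base.
have jfree := mono_subrep_incl (fun v => kermx (r v)).
have jc v : j v *m c v = 1%:M.
  apply: (row_free_inj (jfree v)).
  by rewrite -mulmxA cj mulmxBr mulmx1 mulmxA jr mul0mx subr0 mul1mx.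
have ic v : i v *m c v = 0.
  apply: (row_free_inj (jfree v)).
  by rewrite -mulmxA cj mulmxBr mulmx1 mulmxA ir mul1mx subrr mul0mx.
have iso : isom M (dsum N C).
  exists (fun v => row_mx (r v) (c v)), (fun v => col_mx (i v) (j v)).
  split=> [a|a|v|v] /=.
  - by rewrite mul_mx_row hr hc mul_row_block !mulmx0 addr0 add0r.
  - by rewrite mul_block_col !mul0mx addr0 add0r mul_col_mx hi hj.
  - by rewrite mul_row_col cj addrC subrK.
  - by rewrite mul_col_row ir ic jr jc -scalar_mx_block.
have [/nzN//|zC] := dec _ _ iso.
exists r, i; split=> // v.
have : 1%:M - r v *m i v = 0.
  have /eqP : \rank (kermx (r v)) = 0%N := zC v.
  rewrite mxrank_eq0 => /eqP k0; suff J : j v = 0 by rewrite -cj -/(j v) J mulmx0.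
  by apply/eqP; rewrite -submx0 -k0 /j /subrep_incl eq_row_base.
by move/eqP; rewrite subr_eq0 => /eqP.
Qed.

(** The idempotent of a summand is a scalar, hence 0 or 1. *)
Lemma indecomposable_of_scalar_end M :
    ~ is_zero M ->
    (forall f : fam M M, is_hom f -> exists k : K, forall v, f v = k%:M) ->
  indecomposable M.
Proof.
move=> nz sc; split=> // X Y [a [b [ha hb ab ba]]].
pose e v : 'M[K]_(dim (dsum X Y) v) := block_mx 1%:M 0 0 0.
have he : is_hom (e : fam (dsum X Y) (dsum X Y)).
  by move=> c; rewrite /= !mulmx_block !(mulmx0, mul0mx, mulmx1, mul1mx, addr0, add0r).
have [k Ek] := sc _ (hom_comp (hom_comp ha he) hb).
have eE v : e v = k%:M.
  have := congr1 (fun A => b v *m A *m a v) (Ek v).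
  rewrite !mulmxA ba mul1mx -!mulmxA ba mulmx1 => ->.
  by rewrite -scalar_mxC mulmxA ba mul1mx.
have [k0|k0] := eqVneq k 1.
  right=> v; have := eE v; rewrite k0 /e (scalar_mx_block (dim X v) (dim Y v)).
  move/eq_block_mx=> [_ _ _]; case: (dim Y v) => // m /matrixP/(_ ord0 ord0).
  by rewrite !mxE eqxx => /eqP; rewrite eq_sym oner_eq0.
left=> v; have := eE v; rewrite /e (scalar_mx_block (dim X v) (dim Y v)).
move/eq_block_mx=> [+ _ _ _]; case: (dim X v) => // m /matrixP/(_ ord0 ord0).
by rewrite !mxE eqxx => /esym/eqP; rewrite (negPf k0).
Qed.

End Indecomposability.

(** * Independence of the transpose from the presentation *)

Section ProjectivePresentations.
Variables (K : fieldType) (Q : quiver).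
Local Open Scope ring_scope.
Implicit Types (M N P X Y : rep K Q).

(** The image of f and the kernel of e together span P, and the latter may be
    left out. *)
Lemma epi_of_superfluous_ker P P' N (e : fam P N) (e' : fam P' N)
    (f : fam P' P) :
    is_hom f -> epi e' -> superfluous (fun v => kermx (e v)) ->
    (forall v, f v *m e v = e' v) ->
  epi f.
Proof.
move=> hf ee' sup fe v.
suff: row_full (<<f v>>%MS) by rewrite /row_full mxrank_gen.
move: v; apply: sup => [a|v].
  by rewrite (eqmxMr _ (genmxE _)) genmxE -hf submxMl.
have /row_fullP[s se'] := ee' v.
rewrite -sub1mx; set I := 1%:M.
have -> : I = (I - e v *m s *m f v) + e v *m s *m f v by rewrite subrK.
apply: addmx_sub_adds; last by rewrite genmxE submxMl.
apply/sub_kermxP; rewrite mulmxBl mul1mx -!mulmxA fe se' mulmx1.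
by rewrite subrr.
Qed.

Lemma isom_of_epis P P' (f : fam P' P) (g : fam P P') :
    is_hom f -> epi f -> epi g ->
  exists f' : fam P P', [/\ is_hom f', forall v, f v *m f' v = 1%:M
    & forall v, f' v *m f v = 1%:M].
Proof.
move=> hf ef eg.
have d v : dim P v = dim P' v.
  by apply/eqP; rewrite eqn_leq (dim_le_of_row_full (ef v)) (dim_le_of_row_full (eg v)).
have ff v : row_free (f v).
  by have /eqP r := ef v; rewrite /row_free r d.
have E v : f v *m pinvmx (f v) = 1%:M by apply: mulmxVp.
have E' v : pinvmx (f v) *m f v = 1%:M by apply: mulVpmx.
exists (fun v => pinvmx (f v)); split=> // a.
apply: (row_free_inj (ff (tgt a))); rewrite -mulmxA E' mulmx1.
by rewrite -mulmxA hf mulmxA E' mul1mx.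
Qed.

Lemma lift_through_exact P P1 P0 N (h : fam P1 P0) (e : fam P0 N)
    (k : fam P P0) :
    projective P -> is_hom h -> is_hom e -> exact_at h e -> is_hom k ->
    (forall v, k v *m e v = 0) ->
  exists f : fam P P1, is_hom f /\ forall v, f v *m h v = k v.
Proof.
move=> pP hh he ex hk ke.
have sK := subrep_ker he.
have [v|h' [hh' h'E]] := subrep_corestrict sK hh; first by rewrite ex.
have [v|k' [hk' k'E]] := subrep_corestrict sK hk; first exact/sub_kermxP.
have eh' : epi h'.
  move=> v; rewrite /row_full; apply/eqP.
  have /mxrankMfree : row_free (@subrep_incl _ _ _ (fun v => kermx (e v)) v).
    exact: mono_subrep_incl.
  by move/(_ _ (h' v)); rewrite h'E ex => <-.
have [f [hf fE]] := pP _ _ _ _ hh' eh' hk'.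
by exists f; split=> // v; rewrite -h'E mulmxA fE k'E.
Qed.

(** Projective covers are unique: a lift between two of them is onto because
    the kernel of the target is superfluous, and onto both ways means
    invertible. *)
Lemma min_proj_presentation_unique P1 P0 P1' P0' N
    (h : fam P1 P0) (e : fam P0 N) (h' : fam P1' P0') (e' : fam P0' N) :
    min_proj_presentation h e -> min_proj_presentation h' e' ->
  exists (f1 : fam P1' P1) (g1 : fam P1 P1') (f0 : fam P0' P0)
         (g0 : fam P0 P0'),
  [/\ [/\ is_hom f1, is_hom g1, is_hom f0 & is_hom g0],
      forall v, g1 v *m f1 v = 1%:M,
      forall v, f1 v *m g1 v = 1%:M,
      forall v, f1 v *m h v = h' v *m f0 v
    & forall v, g1 v *m h' v = h v *m g0 v].
Proof.
move=> [[p1 p0 hh he ee] [ex se sh]] [[p1' p0' hh' he' ee'] [ex' se' sh']].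
have [f0 [hf0 f0E]] := p0' _ _ _ _ he ee he'.
have [k0 [hk0 k0E]] := p0 _ _ _ _ he' ee' he.
have ef0 := epi_of_superfluous_ker hf0 ee' se f0E.
have ek0 := epi_of_superfluous_ker hk0 ee se' k0E.
have [g0 [hg0 fg0 gf0]] := isom_of_epis hf0 ef0 ek0.
have g0E v : g0 v *m e' v = e v by rewrite -f0E mulmxA gf0 mul1mx.
have he0 v : h v *m e v = 0 by apply/sub_kermxP; rewrite ex.
have he0' v : h' v *m e' v = 0 by apply/sub_kermxP; rewrite ex'.
have [||f1 [hf1 f1E]] := @lift_through_exact P1' _ _ _ h e
  (fun v => h' v *m f0 v) p1' hh he ex.
- exact: hom_comp.
- by move=> v; rewrite -mulmxA f0E.
have [||k1 [hk1 k1E]] := @lift_through_exact P1 _ _ _ h' e'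
  (fun v => h v *m g0 v) p1 hh' he' ex'.
- exact: hom_comp.
- by move=> v; rewrite -mulmxA g0E.
(* As above, with the kernel of e in place of N: h and h' both cover it, and
   their own kernels are superfluous. *)
have epi1 (A B A0 B0 : rep K Q) (hA : fam A A0) (hB : fam B B0) (eA : fam A0 N)
    (eB : fam B0 N) (f : fam B A) (g : fam A0 B0) (g' : fam B0 A0) :
    is_hom f -> superfluous (fun v => kermx (hA v)) ->
    exact_at hA eA -> exact_at hB eB ->
    (forall v, g v *m eB v = eA v) -> (forall v, g v *m g' v = 1%:M) ->
    (forall v, f v *m hA v = hB v *m g' v) -> epi f.
  move=> hf sA xA xB gE gg' fE v.
  suff: row_full (<<f v>>%MS) by rewrite /row_full mxrank_gen.
  move: v; apply: sA => [a|v].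
    by rewrite (eqmxMr _ (genmxE _)) genmxE -hf submxMl.
  have /submxP[s sE] : (hA v *m g v <= hB v)%MS.
    rewrite xB; apply/sub_kermxP; rewrite -mulmxA gE.
    by apply/sub_kermxP; rewrite xA.
  rewrite -sub1mx; set I := 1%:M.
  have -> : I = (I - s *m f v) + s *m f v by rewrite subrK.
  apply: addmx_sub_adds; last by rewrite genmxE submxMl.
  apply/sub_kermxP; rewrite mulmxBl mul1mx -!mulmxA fE mulmxA -sE -mulmxA gg'.
  by rewrite mulmx1 subrr.
have ef1 := epi1 _ _ _ _ h h' e e' f1 g0 f0 hf1 sh ex ex' g0E gf0 f1E.
have ek1 := epi1 _ _ _ _ h' h e' e k1 f0 g0 hk1 sh' ex' ex f0E fg0 k1E.
have [g1 [hg1 fg1 gf1]] := isom_of_epis hf1 ef1 ek1.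
exists f1, g1, f0, g0; split=> // v.
rewrite -[h' v]mulmx1 -fg0 (mulmxA (h' v)) -f1E !mulmxA gf1 mul1mx //.
Qed.

End ProjectivePresentations.

Section TransposeUniqueness.
Variables (K : fieldType) (Q : quiver).
Local Open Scope ring_scope.
Implicit Types (N : rep K (op Q)) (T : rep K Q).

Lemma is_transpose_isom_l N N' T :
  isom N N' -> is_transpose N T -> is_transpose N' T.
Proof.
case=> a [b [ha hb ab ba]] [P1 [P0 [h [e [[[p1 p0 hh he ee] [ex se sh]] c]]]]].
exists P1, P0, h, (fun v => e v *m a v); split; last by [].
have K_eq v : (kermx (e v *m a v) :=: kermx (e v))%MS.
  apply/eqmxP/andP; split; apply/sub_kermxP; last first.
    by rewrite mulmxA mulmx_ker mul0mx.
  by rewrite -[X in _ *m X]mulmx1 -ab 2!mulmxA -(mulmxA _ (e v)) mulmx_ker mul0mx.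
split; split=> //; first exact: hom_comp.
- move=> v; have /row_fullP[s se'] := ee v; apply/row_fullP.
  by exists (b v *m s); rewrite mulmxA -(mulmxA (b v)) se' mulmx1 ba.
- by move=> v; apply: eqmx_trans (ex v) (eqmx_sym (K_eq v)).
- move=> U sU full v; apply: se => // w.
  by rewrite /row_full -(adds_eqmx (K_eq w) (eqmx_refl _)); apply: full.
Qed.

Lemma is_transpose_isom_r N T T' :
  isom T T' -> is_transpose N T -> is_transpose N T'.
Proof.
case=> a [b [ha hb ab ba]] [P1 [P0 [h [e [pres [c [c1 c2 c3 c4]]]]]]].
exists P1, P0, h, e; split=> //.
exists (fun v f => c v f *m a v); split.
- by move=> v k f g hf hg; rewrite c1 // mulmxDl scalemxAl.
- move=> v y; have [f hf fE] := c2 v (y *m b v).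
  by exists f => //; rewrite fE -mulmxA ba mulmx1.
- move=> v f hf; rewrite -(c3 v f hf); split=> [z|->]; last by rewrite mul0mx.
  by rewrite -(mulmx1 (c v f)) -ab mulmxA z mul0mx.
- by move=> x f hf; rewrite c4 // -!mulmxA ha.
Qed.

(** A morphism between two presentations induces a morphism of the transposes:
    each of them is a quotient of Hom(P1, A), and precomposition with f1 carries
    the maps that factor through h to maps that factor through h'. *)
Lemma transpose_functorial T T' (P1 P0 P1' P0' : rep K (op Q))
    (h : fam P1 P0) (h' : fam P1' P0')
    (c : forall v : vertex (op Q), fam P1 (@proj K (op Q) v) -> 'rV[K]_(dim T v))
    (c' : forall v : vertex (op Q),
       fam P1' (@proj K (op Q) v) -> 'rV[K]_(dim T' v))
    (f1 : fam P1' P1) (f0 : fam P0' P0) :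
    is_hom f1 -> is_hom f0 -> (forall v, f1 v *m h v = h' v *m f0 v) ->
    (forall v (k : K) (f g : fam P1 (@proj K (op Q) v)),
       is_hom f -> is_hom g ->
       c v (fun x => k *: f x + g x) = k *: c v f + c v g) ->
    (forall v (y : 'rV[K]_(dim T v)), exists2 f, is_hom f & c v f = y) ->
    (forall v (f : fam P1 (@proj K (op Q) v)), is_hom f -> c v f = 0 ->
       exists g : fam P0 (@proj K (op Q) v),
         is_hom g /\ forall x, f x = h x *m g x) ->
    (forall (a : arrow Q) (f : fam P1 (@proj K (op Q) (src a))), is_hom f ->
       c (tgt a) (fun x => f x *m @lmul K (op Q) a x) = c (src a) f *m act T a) ->
    (forall v (k : K) (f g : fam P1' (@proj K (op Q) v)),
       is_hom f -> is_hom g ->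
       c' v (fun x => k *: f x + g x) = k *: c' v f + c' v g) ->
    (forall v (f : fam P1' (@proj K (op Q) v)), is_hom f ->
       (exists g : fam P0' (@proj K (op Q) v),
          is_hom g /\ forall x, f x = h' x *m g x) -> c' v f = 0) ->
    (forall (a : arrow Q) (f : fam P1' (@proj K (op Q) (src a))), is_hom f ->
       c' (tgt a) (fun x => f x *m @lmul K (op Q) a x)
       = c' (src a) f *m act T' a) ->
    (forall a : arrow Q, is_hom (@lmul K (op Q) a)) ->
  exists F : fam T T', is_hom F /\
    forall v (f : fam P1 (@proj K (op Q) v)), is_hom f ->
      c v f *m F v = c' v (fun x => f1 x *m f x).
Proof.
move=> hf1 hf0 sq c_lin c_surj c_ker c_nat c'_lin c'_ker c'_nat hl.
pose u v y : fam P1 (@proj K (op Q) v) := projT1 (cid2 (c_surj v y)).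
have hu v y : is_hom (u v y) by rewrite /u; case: cid2.
have cu v y : c v (u v y) = y by rewrite /u; case: cid2.
pose d v (f : fam P1 (@proj K (op Q) v)) := c' v (fun x => f1 x *m f x).
have d_lin v k f g : is_hom f -> is_hom g ->
    d v (fun x => k *: f x + g x) = k *: d v f + d v g.
  move=> hf hg; rewrite /d -c'_lin; try exact: hom_comp.
  by congr (c' v _); apply: functional_extensionality_dep => x;
     rewrite mulmxDr scalemxAr.
have d_ker v f : is_hom f -> c v f = 0 -> d v f = 0.
  move=> hf /(c_ker _ _ hf)[g [hg fE]]; apply: c'_ker; first exact: hom_comp.
  exists (fun x => f0 x *m g x); split; first exact: hom_comp.
  by move=> x; rewrite fE !mulmxA sq.
have d_eq v f g : is_hom f -> is_hom g -> c v f = c v g -> d v f = d v g.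
  move=> hf hg fg; have hm := hom_lincomb (-1) hf hg.
  have := d_ker _ _ hm; rewrite c_lin // fg scaleN1r addNr => /(_ erefl).
  by rewrite d_lin // scaleN1r addrC => /eqP; rewrite subr_eq0 => /eqP.
pose F v := \matrix_(i, j) d v (u v (delta_mx 0 i)) 0 j.
have c0 v : c v (fun=> 0) = 0.
  have := c_lin v 1 _ _ (hom0 _ _) (hom0 _ _).
  rewrite (_ : (fun x => _) = (fun=> 0)).
    by rewrite scale1r => /eqP; rewrite -subr_eq subrr => /eqP.
  by apply: functional_extensionality_dep => x; rewrite scaler0 addr0.
have FE v (y : 'rV_(dim T v)) : y *m F v = d v (u v y).
  pose S (A : seq 'I_(dim T v)) : fam P1 (@proj K (op Q) v) :=
    fun x => \sum_(i <- A) y 0 i *: u v (delta_mx 0 i) x.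
  have [hS [cS dS]] : is_hom (S (index_enum _)) /\
    c v (S (index_enum _)) = \sum_i y 0 i *: delta_mx 0 i /\
    d v (S (index_enum _)) = \sum_i y 0 i *: d v (u v (delta_mx 0 i)).
    elim: (index_enum _) => [|i A [hS [cS dS]]].
      have -> : S [::] = fun=> 0.
        by apply: functional_extensionality_dep => x; rewrite /S big_nil.
      by rewrite !big_nil c0; split; [exact: hom0|split=> //; apply: d_ker; [exact: hom0|]].
    have -> : S (i :: A) = fun x => y 0 i *: u v (delta_mx 0 i) x + S A x.
      by apply: functional_extensionality_dep => x; rewrite /S big_cons.
    rewrite !big_cons c_lin ?d_lin // cu cS dS; split=> //.
    exact: hom_lincomb.
  rewrite (d_eq _ (u v y) _ (hu _ _) hS); last by rewrite cu cS -row_sum_delta.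
  rewrite dS; apply/rowP=> j; rewrite !mxE summxE; apply: eq_bigr => i _.
  by rewrite !mxE.
have cF v f : is_hom f -> c v f *m F v = d v f.
  by move=> hf; rewrite FE; apply: d_eq => //; rewrite cu.
exists F; split=> // a; apply/row_matrixP=> i; rewrite !rowE.
have [f hf <-] := c_surj _ (delta_mx 0 i : 'rV_(dim T (src a))).
rewrite 2!mulmxA -c_nat // cF; last exact: (hom_comp hf (hl a)).
rewrite cF // -c'_nat; last exact: hom_comp.
by congr (c' _ _); apply: functional_extensionality_dep => x; rewrite mulmxA.
Qed.

Lemma is_transpose_unique N T T' :
    (forall a : arrow Q, is_hom (@lmul K (op Q) a)) ->
  is_transpose N T -> is_transpose N T' -> isom T T'.
Proof.
move=> hl [P1 [P0 [h [e [pr [c [c1 c2 c3 c4]]]]]]].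
case=> [P1' [P0' [h' [e' [pr' [c' [c1' c2' c3' c4']]]]]]].
have [f1 [g1 [f0 [g0 [[hf1 hg1 hf0 hg0] gf1 fg1 sf sg]]]]] :=
  min_proj_presentation_unique pr pr'.
have [F [hF FE]] := transpose_functorial hf1 hf0 sf c1 c2
  (fun v f hf => (c3 v f hf).1) c4 c1' (fun v f hf => (c3' v f hf).2) c4' hl.
have [G [hG GE]] := transpose_functorial hg1 hg0 sg c1' c2'
  (fun v f hf => (c3' v f hf).1) c4' c1 (fun v f hf => (c3 v f hf).2) c4 hl.
exists F, G; split=> // v; apply/row_matrixP=> i; rewrite !rowE mulmx1.
  have [f hf <-] := c2 v (delta_mx 0 i); rewrite mulmxA FE // GE; last exact: hom_comp.
  congr (c _ _); apply: functional_extensionality_dep => x.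
  by rewrite mulmxA gf1 mul1mx.
have [f hf <-] := c2' v (delta_mx 0 i); rewrite mulmxA GE // FE; last exact: hom_comp.
congr (c' _ _); apply: functional_extensionality_dep => x.
by rewrite mulmxA fg1 mul1mx.
Qed.

End TransposeUniqueness.

Section InverseTranslate.
Variables (K : fieldType) (Q : quiver).
Implicit Types (M N X : rep K Q).

Lemma isom_dual M N : isom M N -> isom (dual M) (dual N).
Proof.
case=> a [b [ha hb ab ba]].
exists (fun v => (b v)^T)%R, (fun v => (a v)^T)%R; split=> [x|x|v|v] /=.
- by rewrite -!trmx_mul hb.
- by rewrite -!trmx_mul ha.
- by rewrite -trmx_mul ab trmx1.
- by rewrite -trmx_mul ba trmx1.
Qed.

Lemma is_tauinv_isom M M' X X' :
  isom M M' -> isom X X' -> is_tauinv M X -> is_tauinv M' X'.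
Proof.
move=> iM iX t; apply: (is_transpose_isom_r iX).
exact: (is_transpose_isom_l (isom_dual iM)).
Qed.

End InverseTranslate.

(** * Projective modules recognised by their bases *)

Section Forests.
Variables (K : fieldType) (Q : quiver) (dep : vertex Q -> nat).
Hypothesis dep_lt : forall a : arrow Q, (dep (src a) < dep (tgt a))%N.
Local Open Scope ring_scope.
Implicit Types (P X Y : rep K Q) (v w : vertex Q).

(** Arrows carry basis vectors to basis vectors: each is injective on the basis
    at its source, and images under different arrows are disjoint.  [par] records from
    where a basis vector comes, so that the vectors with [par] equal to None are
    the roots of a forest. *)
Definition forest_basis P (par : vertex Q -> nat -> option (arrow Q * nat)) :=
  (forall w (y : 'I_(dim P w)) a x, par w y = Some (a, x) ->
     exists x' : 'I_(dim P (src a)), [/\ x' = x :> nat, tgt a = w &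
       forall j : 'I_(dim P (tgt a)), act P a x' j = (j == y :> nat)%:R]) /\
  (forall a (x : 'I_(dim P (src a))),
     exists y : 'I_(dim P (tgt a)), par (tgt a) y = Some (a, x : nat)).

Variables (P : rep K Q) (par : vertex Q -> nat -> option (arrow Q * nat)).
Hypothesis forestP : forest_basis P par.

Lemma forest_row X (f : fam P X) w (y : 'I_(dim P w)) a x :
    is_hom f -> par w y = Some (a, x) ->
  exists x' : 'I_(dim P (src a)), [/\ x' = x :> nat, tgt a = w &
    row y (f w) = row x' (f (src a)) *m act X a *m transport X (tgt a) w].
Proof.
move=> hf /(proj1 forestP) [x' [x'x tw ax]]; exists x'; split=> //.
move: y ax; rewrite -tw => y ax; rewrite transport_id mulmx1 -row_mul -hf row_mul.
suff -> : row x' (act P a) = delta_mx 0 y by rewrite -rowE.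
by apply/rowP=> j; rewrite !mxE ax eqxx.
Qed.

Lemma forest_unique X (f g : fam P X) :
    is_hom f -> is_hom g ->
    (forall w (y : 'I_(dim P w)), par w y = None ->
       row y (f w) = row y (g w)) ->
  forall w, f w = g w.
Proof.
move=> hf hg fg w; have [n] := ubnP (dep w); elim: n w => // n IH w lt.
apply/row_matrixP=> y; case E: (par w y) => [[a x]|]; last exact: fg.
have [x1 [e1 tw ->]] := forest_row hf E.
have [x2 [e2 _ ->]] := forest_row hg E.
rewrite IH; last by apply: leq_trans (dep_lt a) _; rewrite tw.
by rewrite (_ : x1 = x2) //; apply: val_inj; rewrite /= e1 e2.
Qed.

Fixpoint forest_value X (G : forall w, nat -> 'rV[K]_(dim X w)) n w y :
    'rV[K]_(dim X w) :=
  if n is n'.+1 then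
    if par w y is Some (a, x) then
      forest_value G n' (src a) x *m act X a *m transport X (tgt a) w
    else G w y
  else 0.

Lemma forest_value_stable X (G : forall w, nat -> 'rV[K]_(dim X w)) n n' w y :
  (y < dim P w)%N -> (dep w < n)%N -> (dep w < n')%N ->
  forest_value G n w y = forest_value G n' w y.
Proof.
elim: n n' w y => // n IH [//|n'] w y yP ln ln' /=.
case E: (par w y) => [[a x]|//].
have [x' [x'x tw _]] := (proj1 forestP) w (Ordinal yP) a x E.
have lt := dep_lt a; rewrite tw in lt.
rewrite (IH n') -?x'x ?ltn_ord //.
- by apply: leq_trans lt _.
- by apply: leq_trans lt _.
Qed.

(** The images of the roots may be prescribed, and the others are then forced;
    the recursion is on the depth of the vertex. *)
Lemma forest_exists X (G : forall w, nat -> 'rV[K]_(dim X w)) :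
  exists f : fam P X, is_hom f /\
    forall w (y : 'I_(dim P w)), par w y = None -> row y (f w) = G w y.
Proof.
exists (fun w => \matrix_(y < dim P w) forest_value G (dep w).+1 w y).
split=> [a|w y E]; last by rewrite rowK /= E.
apply/row_matrixP=> x; rewrite !row_mul rowK.
have [y E] := (proj2 forestP) a x.
have [x' [/val_inj-> _ ax]] := (proj1 forestP) _ _ _ _ E.
have -> : row x (act P a) = delta_mx 0 y.
  by apply/rowP=> j; rewrite !mxE ax eqxx.
rewrite -rowE rowK /= E transport_id mulmx1; congr (_ *m _).
rewrite -[RHS]/(forest_value G (dep (src a)).+1 (src a) x).
by apply: forest_value_stable => //; apply: dep_lt.
Qed.

(** P is free on its roots, so lifting the images of the roots is enough. *)
Lemma forest_projective : projective P.
Proof.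
move=> X Y g f hg eg hf.
pose G w (y : nat) : 'rV_(dim X w) :=
  if insub y is Some y' then row y' (f w) *m pinvmx (g w) else 0.
have [f' [hf' f'G]] := forest_exists G; exists f'; split=> //.
apply: forest_unique => [|//|w y E]; first exact: hom_comp.
rewrite row_mul f'G // /G valK mulmxKpV //.
exact: submx_full.
Qed.

(** The universal property of the projective at v with its trivial path, which
    characterises the pair up to a unique isomorphism. *)
Definition free_at P v (b : 'rV[K]_(dim P v)) :=
  forall X (y : 'rV[K]_(dim X v)), exists f : fam P X,
    [/\ is_hom f, b *m f v = y &
        forall g : fam P X, is_hom g -> b *m g v = y -> forall w, g w = f w].

Lemma forest_free_at v (x0 : 'I_(dim P v)) :
    (forall w (y : 'I_(dim P w)), par w y = None -> w = v /\ y = x0 :> nat) ->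
    par v x0 = None ->
  free_at (delta_mx 0 x0).
Proof.
move=> root root0 X y.
have [f [hf fG]] := forest_exists (fun w _ => y *m transport X v w).
have bf : delta_mx 0 x0 *m f v = y by rewrite -rowE fG // transport_id mulmx1.
exists f; split=> // g hg bg; apply: forest_unique => // w z E.
have [wv] := root w z E; move: z E; rewrite wv => z E /val_inj->.
by rewrite !rowE bg bf.
Qed.

End Forests.

Section FreeOnOneGenerator.
Variables (K : fieldType) (Q : quiver).
Local Open Scope ring_scope.
Implicit Types (P X Y : rep K Q) (v w : vertex Q).

Lemma free_at_unique P v (b : 'rV[K]_(dim P v)) X (f g : fam P X) :
  free_at b -> is_hom f -> is_hom g -> b *m f v = b *m g v ->
  forall w, f w = g w.
Proof.
move=> fr hf hg e w; have [h [_ _ uq]] := fr X (b *m g v).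
by rewrite (uq f hf e) (uq g hg erefl).
Qed.

Lemma free_at_isom P P' v (b : 'rV[K]_(dim P v)) (b' : 'rV[K]_(dim P' v)) :
    free_at b -> free_at b' ->
  exists (f : fam P P') (g : fam P' P), [/\ is_hom f /\ is_hom g,
    b *m f v = b', forall v, f v *m g v = 1%:M & forall v, g v *m f v = 1%:M].
Proof.
move=> fr fr'; have [f [hf bf _]] := fr _ b'; have [g [hg bg _]] := fr' _ b.
exists f, g; split=> //.
  apply: (free_at_unique fr); [exact: hom_comp|exact: hom_id|].
  by rewrite mulmxA bf bg mulmx1.
apply: (free_at_unique fr'); [exact: hom_comp|exact: hom_id|].
by rewrite mulmxA bg bf mulmx1.
Qed.

End FreeOnOneGenerator.

Section PathBasis.
Variables (K : fieldType) (Q : quiver) (dep : vertex Q -> nat).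
Hypothesis dep_lt : forall a : arrow Q, (dep (src a) < dep (tgt a))%N.
Hypothesis dep_bound : forall v, (dep v < #|vertex Q|)%N.
Local Open Scope ring_scope.
Implicit Types (v w : vertex Q).

Lemma walk_size v w (s : seq (arrow Q)) : walk v w s -> (size s + dep v <= dep w)%N.
Proof.
elim: s v => [|a s IH] v /=; first by move/eqP->.
case/andP=> /eqP<- /IH; have := dep_lt a; lia.
Qed.

Lemma walk_rcons v w (s : seq (arrow Q)) a :
  walk v w (rcons s a) = walk v (src a) s && (tgt a == w).
Proof.
elim: s v => [|b s IH] v /=; first by rewrite eq_sym.
by rewrite IH andbA.
Qed.

Definition path_list v w : seq (seq (arrow Q)) :=
  [seq (val s : seq (arrow Q)) | s <- enum (paths v w)].

Lemma mem_path_list v w s : (s \in path_list v w) = walk v w s.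
Proof.
apply/mapP/idP => [[t]|ws].
  by rewrite mem_enum inE => ? ->.
have sz : (size s <= #|vertex Q|)%N.
  apply: leq_trans (ltnW (dep_bound w)); apply: leq_trans (walk_size ws).
  exact: leq_addr.
by exists (Bseq sz); rewrite // mem_enum inE.
Qed.

Lemma uniq_path_list v w : uniq (path_list v w).
Proof. by rewrite map_inj_uniq ?enum_uniq //; apply: val_inj. Qed.

Lemma size_path_list v w : size (path_list v w) = #|paths v w|.
Proof. by rewrite size_map -cardE. Qed.

Lemma nth_path_list v w (i : 'I_#|paths v w|) :
  nth [::] (path_list v w) i = enum_val i :> seq _.
Proof.
rewrite (nth_map (enum_val i)) -?cardE ?ltn_ord //.
by rewrite -(enum_val_nth (enum_val i)).
Qed.

Lemma path_index v w s : walk v w s ->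
  exists i : 'I_#|paths v w|, enum_val i = s :> seq _ /\ i = index s (path_list v w) :> nat.
Proof.
move=> ws; have lt : (index s (path_list v w) < #|paths v w|)%N.
  by rewrite -size_path_list index_mem mem_path_list.
by exists (Ordinal lt); rewrite -nth_path_list nth_index ?mem_path_list.
Qed.

Lemma index_path v w (i : 'I_#|paths v w|) :
  index (enum_val i : seq _) (path_list v w) = i.
Proof.
by rewrite -nth_path_list index_uniq ?uniq_path_list // size_path_list.
Qed.

Lemma enum_path_inj v w (i j : 'I_#|paths v w|) :
  ((enum_val i : seq _) == (enum_val j : seq _)) = (i == j).
Proof. by rewrite (inj_eq val_inj) (inj_eq enum_val_inj). Qed.

Lemma walk_enum_val v w (i : 'I_#|paths v w|) : walk v w (enum_val i).
Proof. by have := enum_valP i; rewrite inE. Qed.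

(** A nontrivial path comes from the path without its last arrow. *)
Definition path_parent v w (y : nat) : option (arrow Q * nat) :=
  if rev (nth [::] (path_list v w) y) is a :: s then
    Some (a, index (rev s) (path_list v (src a))) else None.

Lemma proj_forest v : forest_basis (@proj K Q v) (path_parent v).
Proof.
split=> [w y a x|a x].
  have wy := walk_enum_val y; rewrite /path_parent nth_path_list.
  case E: (rev _) => [//|b s] [<- <-].
  have ey : enum_val y = rcons (rev s) b :> seq _.
    by rewrite -rev_cons -E revK.
  rewrite ey walk_rcons in wy; have /andP[ws /eqP tw] := wy.
  have [i [iE <-]] := path_index ws; exists i; split=> //.
  move: y E ey {wy}; rewrite -tw => y E ey j; rewrite mxE iE.
  by rewrite -ey eq_sym enum_path_inj.
have ws := walk_enum_val x.
have [|y [yE _]] := @path_index v (tgt a) (rcons (enum_val x) a).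
  by rewrite walk_rcons ws eqxx.
exists y; rewrite /path_parent nth_path_list yE rev_rcons revK.
by rewrite index_path.
Qed.

Definition proj_gen v : 'rV[K]_(dim (@proj K Q v) v) :=
  \row_(i < #|paths v v|) ((enum_val i : #|vertex Q|.-bseq _) == [::] :> seq _)%:R.

Lemma proj_free_at v : free_at (proj_gen v).
Proof.
have [x0 [x0E _]] := @path_index v v [::] (eqxx v).
have -> : proj_gen v = delta_mx 0 x0.
  by apply/rowP=> j; rewrite !mxE eqxx -x0E enum_path_inj.
apply: (forest_free_at dep_lt (proj_forest v)) => [w y|]; last first.
  by rewrite /path_parent nth_path_list x0E.
have wy := walk_enum_val y; rewrite /path_parent nth_path_list.
case E: (rev _) => // _.
have e : enum_val y = [::] :> seq _ by rewrite -[LHS]revK E.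
move: wy; rewrite e /= => /eqP vw; split=> //; move: y E e; rewrite -vw => y E e.
suff -> : y = x0 by [].
by apply/eqP; rewrite -enum_path_inj e x0E.
Qed.

Lemma hom_lmul (a : arrow Q) : is_hom (@lmul K Q a).
Proof.
move=> b; apply/matrixP=> i j; rewrite !mxE /=.
have wi := walk_enum_val i.
have [|k [kE _]] := @path_index (tgt a) (tgt b) (rcons (enum_val i) b).
  by rewrite walk_rcons wi eqxx.
have [|l [lE _]] := @path_index (src a) (src b) (a :: (enum_val i : seq _)).
  by rewrite /= eqxx.
rewrite (bigD1 k) //= big1 ?addr0; last first.
  by move=> m nm; rewrite !mxE -kE enum_path_inj eq_sym (negPf nm) mul0r.
rewrite (bigD1 l) //= big1 ?addr0; last first.
  by move=> m nm; rewrite !mxE -lE enum_path_inj eq_sym (negPf nm) mul0r.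
by rewrite !mxE kE lE !eqxx !mul1r.
Qed.

(** This equation determines left multiplication by a, since the trivial path
    generates; it is how the map is recognised in other models of P_v. *)
Lemma lmul_proj_gen (a : arrow Q) :
  proj_gen (tgt a) *m @lmul K Q a (tgt a) =
  proj_gen (src a) *m act (@proj K Q (src a)) a.
Proof.
have gE v : exists2 x : 'I_(dim (@proj K Q v) v),
    enum_val x = [::] :> seq _ & proj_gen v = delta_mx 0 x.
  have [x [xE _]] := @path_index v v [::] (eqxx v); exists x => //.
  by apply/rowP=> j; rewrite !mxE eqxx -xE enum_path_inj.
have [x xE ->] := gE (tgt a); have [y yE ->] := gE (src a).
by rewrite -!rowE; apply/rowP=> j; rewrite !mxE xE yE.
Qed.

End PathBasis.

Section TransposeFromModels.
Variables (K : fieldType) (Q : quiver) (dep : vertex (op Q) -> nat).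
Hypothesis dep_lt : forall a : arrow (op Q), (dep (src a) < dep (tgt a))%N.
Hypothesis dep_bound : forall v, (dep v < #|vertex (op Q)|)%N.
Local Open Scope ring_scope.

(** The transpose may be computed with any chosen copies [B v] of the
    indecomposable projectives, since these are determined up to a unique
    isomorphism by their generators [b v]. *)
Lemma is_transpose_of_models (N : rep K (op Q)) (T : rep K Q)
    (P1 P0 : rep K (op Q)) (h : fam P1 P0) (e : fam P0 N)
    (B : vertex (op Q) -> rep K (op Q)) (b : forall v, 'rV[K]_(dim (B v) v))
    (l : forall a : arrow (op Q), fam (B (tgt a)) (B (src a)))
    (c : forall v : vertex (op Q), fam P1 (B v) -> 'rV[K]_(dim T v)) :
    min_proj_presentation h e ->
    (forall v, free_at (b v)) ->
    (forall a, is_hom (l a)) ->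
    (forall a, b (tgt a) *m l a (tgt a) = b (src a) *m act (B (src a)) a) ->
    (forall v (k : K) (f g : fam P1 (B v)),
       c v (fun x => k *: f x + g x) = k *: c v f + c v g) ->
    (forall v (y : 'rV[K]_(dim T v)), exists2 f, is_hom f & c v f = y) ->
    (forall v (f : fam P1 (B v)), is_hom f -> c v f = 0 ->
         exists g : fam P0 (B v), is_hom g /\ forall x, f x = h x *m g x) ->
    (forall v (g : fam P0 (B v)), is_hom g -> c v (fun x => h x *m g x) = 0) ->
    (forall (a : arrow Q) (f : fam P1 (B (src a))), is_hom f ->
       c (tgt a) (fun x => f x *m l a x) = c (src a) f *m act T a) ->
  is_transpose N T.
Proof.
move=> pres fb hl bl c1 c2 c3 c3' c4.
exists P1, P0, h, e; split=> //.
have pf v : free_at (@proj_gen K (op Q) v).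
  exact: (@proj_free_at K (op Q) dep dep_lt dep_bound v).
have iso v := cid (free_at_isom (pf v) (fb v)).
pose t v := projT1 (iso v).
have iso' v := cid (projT2 (iso v)).
pose t' v := projT1 (iso' v).
have tP v : [/\ is_hom (t v), is_hom (t' v),
    @proj_gen K (op Q) v *m t v v = b v,
    forall w, t v w *m t' v w = 1%:M & forall w, t' v w *m t v w = 1%:M].
  by rewrite /t /t'; case: (projT2 (iso' v)) => [[? ?] ? ? ?].
exists (fun v f => c v (fun x => f x *m t v x)); split.
- move=> v k f g hf hg; rewrite -c1; congr (c v _).
  by apply: functional_extensionality_dep => x; rewrite mulmxDl scalemxAl.
- move=> v y; have [f hf <-] := c2 v y; have [_ ht' _ _ t't] := tP v.
  exists (fun x => f x *m t' v x); first exact: hom_comp.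
  congr (c v _); apply: functional_extensionality_dep => x.
  by rewrite -mulmxA t't mulmx1.
- move=> v f hf; have [ht ht' _ tt' t't] := tP v; split=> [|[g [hg fE]]].
    move/c3=> [|g [hg gE]]; first exact: hom_comp.
    exists (fun x => g x *m t' v x); split=> [|x]; first exact: hom_comp.
    by rewrite mulmxA -gE -mulmxA tt' mulmx1.
  have <- := c3' v (fun x => g x *m t v x) (hom_comp hg ht).
  by congr (c v _); apply: functional_extensionality_dep => x; rewrite fE mulmxA.
- move=> a f hf; have [hts _ ts _ _] := tP (src a).
  have [htt _ tt _ _] := tP (tgt a).
  rewrite -c4; last exact: hom_comp.
  congr (c _ _); apply: functional_extensionality_dep => x.
  rewrite -!mulmxA; congr (_ *m _); move: x.
  apply: (free_at_unique (pf (tgt (a : arrow (op Q))))).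
  + by apply: hom_comp htt; apply: (@hom_lmul K (op Q) dep dep_lt dep_bound a).
  + exact: (hom_comp hts (hl a)).
  rewrite mulmxA [RHS]mulmxA ts.
  transitivity (b (tgt a) *m act (B (tgt a)) a); last exact: esym (bl a).
  transitivity (@proj_gen K (op Q) (tgt a)
    *m (t (tgt a) (tgt a) *m act (B (tgt a)) a)); last by rewrite mulmxA tt.
  transitivity (@proj_gen K (op Q) (tgt a)
    *m (act (@proj K (op Q) (tgt a)) a *m t (tgt a) (src a))).
    rewrite mulmxA; congr (_ *m _).
    exact: (@lmul_proj_gen K (op Q) dep dep_lt dep_bound a).
  by congr (_ *m _); apply: htt.
Qed.

End TransposeFromModels.

(** * Modules with aligned bases *)

Section Entries.
Variable K : fieldType.
Local Open Scope ring_scope.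

(** Entries at natural-number positions, zero outside the matrix: the explicit
    modules have spaces whose dimensions are only provably equal, and these
    entries can be compared across them. *)
Definition ent m n (A : 'M[K]_(m, n)) (x y : nat) : K :=
  if insub x is Some i then if insub y is Some j then A i j else 0 else 0.

Definition mkmx m n (F : nat -> nat -> K) : 'M[K]_(m, n) :=
  \matrix_(i < m, j < n) F i j.

(** Ones where x - y = b - a, with two offsets because the difference may have
    either sign. *)
Definition diagmx m n (a b : nat) : 'M[K]_(m, n) :=
  mkmx m n (fun x y => (x + a == y + b)%N%:R).

Lemma ent_ord m n (A : 'M_(m, n)) (i : 'I_m) (j : 'I_n) : ent A i j = A i j.
Proof. by rewrite /ent !valK. Qed.

Lemma ent_row_out m n (A : 'M_(m, n)) x y : (m <= x)%N -> ent A x y = 0.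
Proof. by move=> h; rewrite /ent insubF // ltnNge h. Qed.

Lemma ent_col_out m n (A : 'M_(m, n)) x y : (n <= y)%N -> ent A x y = 0.
Proof.
by move=> h; rewrite /ent; case: insub => // i; rewrite insubF // ltnNge h.
Qed.

Lemma ent_ext m n (A B : 'M_(m, n)) :
  (forall x y, (x < m)%N -> (y < n)%N -> ent A x y = ent B x y) -> A = B.
Proof. by move=> h; apply/matrixP=> i j; rewrite -!ent_ord h. Qed.

Lemma ent_mk m n F x y :
  ent (mkmx m n F) x y = if (x < m)%N && (y < n)%N then F x y else 0.
Proof.
have [lx|lx] := ltnP x m; last by rewrite ent_row_out.
have [ly|ly] := ltnP y n; last by rewrite ent_col_out.
by rewrite -[x]/(val (Ordinal lx)) -[y]/(val (Ordinal ly)) ent_ord mxE.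
Qed.

Lemma ent0 m n x y : ent (0 : 'M_(m, n)) x y = 0.
Proof. by rewrite /ent; do 2!case: insub => // ?; rewrite mxE. Qed.

Lemma entD m n (A B : 'M_(m, n)) x y : ent (A + B) x y = ent A x y + ent B x y.
Proof.
rewrite /ent; case: insub => [i|]; last by rewrite addr0.
by case: insub => [j|]; rewrite ?addr0 // mxE.
Qed.

Lemma entZ m n (k : K) (A : 'M_(m, n)) x y : ent (k *: A) x y = k * ent A x y.
Proof.
rewrite /ent; case: insub => [i|]; last by rewrite mulr0.
by case: insub => [j|]; rewrite ?mulr0 // mxE.
Qed.

Lemma entN m n (A : 'M_(m, n)) x y : ent (- A) x y = - ent A x y.
Proof. by rewrite -scaleN1r entZ mulN1r. Qed.

Lemma ent1 n x y : ent (1%:M : 'M_n) x y = ((x < n) && (x == y))%N%:R.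
Proof.
have [lx|lx] := ltnP x n; last by rewrite ent_row_out.
have [ly|ly] := ltnP y n; last by rewrite ent_col_out // (ltn_eqF (leq_trans lx ly)).
by rewrite -[x]/(val (Ordinal lx)) -[y]/(val (Ordinal ly)) ent_ord mxE.
Qed.

Lemma ent_mulmx m n l (A : 'M_(m, n)) (B : 'M_(n, l)) x y :
  ent (A *m B) x y = \sum_(k < n) ent A x k * ent B k y.
Proof.
have [lx|lx] := ltnP x m; last first.
  by rewrite ent_row_out ?big1 // => k _; rewrite ent_row_out ?mul0r.
have [ly|ly] := ltnP y l; last first.
  by rewrite ent_col_out ?big1 // => k _; rewrite (ent_col_out B) ?mulr0.
rewrite -[x]/(val (Ordinal lx)) -[y]/(val (Ordinal ly)) ent_ord mxE.
by apply: eq_bigr => k _; rewrite !ent_ord.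
Qed.

Lemma ent_mul_diag m n l (A : 'M_(m, n)) a b x y :
  ent (A *m diagmx n l a b) x y =
  if (y < l)%N && (a <= y + b)%N then ent A x (y + b - a) else 0.
Proof.
rewrite ent_mulmx; case: ifP => [/andP[ly ab]|H]; last first.
  apply: big1 => k _; rewrite ent_mk ltn_ord /=; case: ifP => ly; last by rewrite mulr0.
  rewrite (_ : (k + a == y + b)%N = false) ?mulr0 //; lia.
have [lk|lk] := ltnP (y + b - a) n; last first.
  rewrite ent_col_out //; apply: big1 => k _; have lt := ltn_ord k.
  rewrite ent_mk lt ly /=.
  rewrite (_ : (k + a == y + b)%N = false) ?mulr0 //; lia.
rewrite (bigD1 (Ordinal lk)) //= big1 => [|k nk].
  rewrite ent_mk /= lk ly /= (_ : (_ == _)%N = true) ?mulr1 ?addr0 //; lia.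
rewrite ent_mk ltn_ord ly /= (_ : (k + a == y + b)%N = false) ?mulr0 //.
by apply/negP => /eqP e; move/eqP: nk; apply; apply: val_inj => /=; lia.
Qed.

Lemma trmx_diag m n a b : (diagmx m n a b)^T = diagmx n m b a.
Proof. by apply/matrixP=> i j; rewrite !mxE eq_sym. Qed.

Lemma ent_tr m n (A : 'M_(m, n)) x y : ent A^T x y = ent A y x.
Proof.
rewrite /ent; case: insub => [i|]; last by case: insub.
by case: insub => [j|] //; rewrite mxE.
Qed.

Lemma ent_diag_mul m n l (A : 'M_(n, l)) a b x y :
  ent (diagmx m n a b *m A) x y =
  if (x < m)%N && (b <= x + a)%N then ent A (x + a - b) y else 0.
Proof.
by rewrite -[LHS]ent_tr trmx_mul trmx_diag ent_mul_diag ent_tr.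
Qed.

Lemma if_natr (b c : bool) : (if b return K then c%:R else 0) = (b && c)%:R :> K.
Proof. by case: b. Qed.

Lemma if_opp (b : bool) (k : K) : (if b then - k else 0) = - (if b then k else 0).
Proof. by case: b; rewrite ?oppr0. Qed.

End Entries.

Section AlignedRepresentations.
Variables (K : fieldType) (Q : quiver).
Local Open Scope ring_scope.

Definition align (st : bool) m n : 'M[K]_(m, n) :=
  if st then diagmx K m n 0 0 else diagmx K m n n m.

(** Every explicit module below has a basis at each vertex that each arrow maps
    injectively to the first, or to the last, basis vectors at its target,
    except that arrows pointing to a smaller space drop the surplus. *)
Definition aligned (st : pred (arrow Q)) (d : vertex Q -> nat) : rep K Q :=
  @Rep K Q d (fun a => align (st a) (d (src a)) (d (tgt a))).

Lemma ent_mul_align m n l (A : 'M[K]_(m, n)) st x y :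
  ent (A *m align st n l) x y =
  if (y < l)%N then
    if st then ent A x y
    else if (l <= y + n)%N then ent A x (y + n - l) else 0
  else 0.
Proof.
rewrite /align; case: st; rewrite ent_mul_diag; case: (ltnP y l) => //= ly.
by rewrite addn0 subn0.
Qed.

Lemma ent_align_mul m n l (A : 'M[K]_(n, l)) st x y :
  ent (align st m n *m A) x y =
  if (x < m)%N then
    if st then ent A x y
    else if (m <= x + n)%N then ent A (x + n - m) y else 0
  else 0.
Proof.
rewrite /align; case: st; rewrite ent_diag_mul; case: (ltnP x m) => //= lx.
by rewrite addn0 subn0.
Qed.

Lemma align_mulK st m n : (m <= n)%N -> align st m n *m align st n m = 1%:M.
Proof.
move=> le; apply: ent_ext => x y lx ly; rewrite ent_mul_align ly ent1 lx /align.
case: st; first by rewrite ent_mk lx (leq_trans ly le) !addn0.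
have -> : (m <= y + n)%N by lia.
rewrite ent_mk lx /= (_ : (y + n - m < n)%N = true); last by apply/idP; lia.
by rewrite subnK ?eqn_add2r //; lia.
Qed.

Lemma row_free_align st m n : (m <= n)%N -> row_free (align st m n).
Proof. by move=> le; apply/row_freeP; exists (align st n m); apply: align_mulK. Qed.

Lemma row_full_align st m n : (n <= m)%N -> row_full (align st m n).
Proof. by move=> le; apply/row_fullP; exists (align st n m); apply: align_mulK. Qed.

Lemma hom_alignedP st st' d d' (f : fam (aligned st d) (aligned st' d')) :
  is_hom f <-> forall a x y, (x < d (src a))%N -> (y < d' (tgt a))%N ->
    (if st a then ent (f (tgt a)) x y
     else if (d (src a) <= x + d (tgt a))%N
       then ent (f (tgt a)) (x + d (tgt a) - d (src a)) y else 0) =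
    (if st' a then ent (f (src a)) x y
     else if (d' (tgt a) <= y + d' (src a))%N
       then ent (f (src a)) x (y + d' (src a) - d' (tgt a)) else 0).
Proof.
split=> [hf a x y lx ly|H a].
  have := congr1 (fun A => ent A x y) (hf a).
  by rewrite /= ent_align_mul ent_mul_align lx ly.
by apply: ent_ext => x y lx ly; rewrite /= ent_align_mul ent_mul_align lx ly H.
Qed.

Lemma align_mul st m l r :
  (m <= l)%N || (r <= l)%N -> align st m l *m align st l r = align st m r.
Proof.
move=> le; apply: ent_ext => x y lx ly; rewrite ent_mul_align ly.
case: st; rewrite !ent_mk lx ly /=.
  by rewrite if_natr; congr (_%:R); lia.
by rewrite !if_natr; congr (_%:R); lia.
Qed.

Lemma dim_aligned st (d : vertex Q -> nat) v : dim (aligned st d) v = d v.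
Proof. by []. Qed.

Section Forest.
Variables (st : pred (arrow Q)) (d : vertex Q -> nat).

Definition covers (a : arrow Q) (y : nat) : bool :=
  if st a then (y < d (src a))%N else (d (tgt a) <= y + d (src a))%N.

Definition aligned_parent (w : vertex Q) (y : nat) : option (arrow Q * nat) :=
  if [pick a | (tgt a == w) && covers a y] is Some a
  then Some (a, if st a then y else (y + d (src a) - d (tgt a))%N) else None.

Hypothesis d_mono : forall a, (d (src a) <= d (tgt a))%N.
Hypothesis covers_disjoint : forall a b y, tgt a = tgt b ->
  (y < d (tgt a))%N -> covers a y -> covers b y -> a = b.

Lemma aligned_forest : forest_basis (aligned st d) aligned_parent.
Proof.
split=> [w y a x|a x]; rewrite /aligned_parent.
  case: pickP => // b /andP[/eqP tw cov] [<- <-] {a x}.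
  have ly : (y < d w)%N := ltn_ord y.
  move: y cov ly; rewrite -tw /covers => y cov ly.
  have lt : ((if st b then (y : nat) else (y + d (src b) - d (tgt b))%N) < d (src b))%N.
    by move: cov ly; case: ifP => //; lia.
  exists (Ordinal lt); split=> // j; rewrite /= /align.
  by case: (st b) lt cov => lt cov; rewrite mxE /= ?addn0 ?subnK ?eqn_add2r // eq_sym.
have lx : (x < d (src a))%N := ltn_ord x; have dm := d_mono a.
pose y := if st a then (x : nat) else (x + d (tgt a) - d (src a))%N.
have ly : (y < d (tgt a))%N by rewrite /y; case: ifP; lia.
have cov : covers a y by rewrite /covers /y; case: (st a); lia.
exists (Ordinal ly); case: pickP => [b /andP[/eqP tw cov']|/(_ a)]; last first.
  by rewrite /= eqxx cov.
rewrite -(covers_disjoint (esym tw) ly cov cov') /= /y.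
congr (Some (_, _)); case: (st a) => //.
by rewrite subnK ?addnK // (leq_trans dm) ?leq_addl.
Qed.

Lemma aligned_parent_None w y :
  aligned_parent w y = None -> forall a, tgt a = w -> ~~ covers a y.
Proof.
rewrite /aligned_parent; case: pickP => // H _ a tw.
by have := H a; rewrite tw eqxx /= => ->.
Qed.

Lemma aligned_root (v : vertex Q) (y : nat) :
    (y < d v)%N -> (forall a, tgt a = v -> d (src a) = 0%N) ->
  aligned_parent v y = None.
Proof.
move=> ly H; rewrite /aligned_parent; case: pickP => // a /andP[/eqP tw].
rewrite /covers (H a tw) tw addn0; case: ifP => // _; lia.
Qed.

End Forest.

End AlignedRepresentations.

Section AlignedDual.
Variables (K : fieldType) (Q : quiver).
Local Open Scope ring_scope.

Lemma isom_dual_aligned (st : pred (arrow Q)) (d : vertex Q -> nat) :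
  isom (@aligned K (op Q) st d) (dual (@aligned K Q st d)).
Proof.
have E a : (act (@aligned K Q st d) a)^T = align K (st a) (d (tgt a)) (d (src a)).
  by rewrite /= /align; case: ifP => _; rewrite trmx_diag.
exists (fun v => 1%:M), (fun v => 1%:M).
by split=> [a|a|v|v] //=; rewrite ?mulmx1 ?mul1mx // -E.
Qed.

End AlignedDual.

(** * The two paths, string modules and their covers *)

Section AtildeEndpoints.
Variables (p q : nat).
Hypotheses (hp : (0 < p)%N) (hq : (0 < q)%N).
Local Notation Q := (Atilde p q).

Definition is_inl (a : 'I_p + 'I_q) : bool := if a is inl _ then true else false.

Definition arrow_from (a : 'I_p + 'I_q) : nat :=
  match a with
  | inl i => if i.+1 < p then i.+1 else (p + q).-1
  | inr j => p + j
  end.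

Definition arrow_to (a : 'I_p + 'I_q) : nat :=
  match a with inl i => i | inr j => if j == 0 :> nat then 0 else (p + j).-1 end.

Lemma val_vtx i : i < p + q -> vtx p q i = i :> nat.
Proof. by move=> lt; rewrite /vtx inordK //; lia. Qed.

Lemma val_src (a : arrow Q) : @src Q a = arrow_from a :> nat.
Proof.
by case: a => i /=; rewrite val_vtx //; have := ltn_ord i; try case: ifP; lia.
Qed.

Lemma val_tgt (a : arrow Q) : @tgt Q a = arrow_to a :> nat.
Proof.
by case: a => i /=; rewrite val_vtx //; have := ltn_ord i; try case: ifP; lia.
Qed.

Lemma val_op_src (a : arrow (op Q)) : @src (op Q) a = arrow_to a :> nat.
Proof. exact: val_tgt. Qed.

Lemma val_op_tgt (a : arrow (op Q)) : @tgt (op Q) a = arrow_from a :> nat.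
Proof. exact: val_src. Qed.

Lemma vertex_le (v : vertex Q) : v <= (p + q).-1.
Proof. by have := ltn_ord v. Qed.

Lemma arrowP (a : 'I_p + 'I_q) :
  (is_inl a /\ (arrow_to a < p)%N /\
     arrow_from a = if (arrow_to a).+1 < p then (arrow_to a).+1 else (p + q).-1)
  \/ (is_inl a = false /\ (p <= arrow_from a < p + q)%N /\
     arrow_to a = if arrow_from a == p then 0 else (arrow_from a).-1).
Proof.
case: a => i /=; have := ltn_ord i; [left|right]; split=> //; split=> //; try lia.
by case: ifP; case: ifP; lia.
Qed.

Lemma arrow_from_lt (a : 'I_p + 'I_q) : arrow_to a < arrow_from a.
Proof.
case: (arrowP a) => [[_ [lt ->]]|[_ [lt ->]]]; case: ifP; lia.
Qed.

Lemma arrow_inj (a b : 'I_p + 'I_q) :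
  is_inl a = is_inl b -> arrow_from a = arrow_from b -> a = b.
Proof.
case: a b => [i|i] [j|j] //= _; have := ltn_ord i; have := ltn_ord j => lj li e.
  congr inl; apply: val_inj => /=; move: e; do 2!case: ifP; lia.
by congr inr; apply: val_inj => /=; lia.
Qed.

Lemma arrow_to_inj (a b : 'I_p + 'I_q) :
  is_inl a = is_inl b -> arrow_to a = arrow_to b -> a = b.
Proof.
case: a b => [i|i] [j|j] //= _; first by move/val_inj->.
have := ltn_ord i; have := ltn_ord j => lj li e; congr inr; apply: val_inj => /=.
by move: e; do 2!case: eqP; lia.
Qed.

Lemma inl_arrow_into k : k < p -> exists a : 'I_p + 'I_q,
  is_inl a /\ arrow_to a = k.
Proof. by move=> lt; exists (inl (Ordinal lt)). Qed.

Lemma inr_arrow_from k : p <= k < p + q -> exists a : 'I_p + 'I_q,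
  is_inl a = false /\ arrow_from a = k.
Proof.
move=> lt; have lt' : k - p < q by lia.
by exists (inr (Ordinal lt')); split=> //=; lia.
Qed.

End AtildeEndpoints.

Ltac split_ifs :=
  repeat match goal with
  | |- context [if ?b then _ else _] => let E := fresh "E" in case E : b
  end.

Section ExplicitModules.
Variables (K : fieldType) (p q : nat).
Hypotheses (hp : (0 < p)%N) (hq : (0 < q)%N) (hpq : (1 < p + q)%N).
Local Notation Q := (Atilde p q).
Local Notation s := (p + q).-1.

Definition string_dim n i j (v : nat) : nat :=
  n + (if v < p then v <= j else v - p < i)%N.

(** The string module of a walk through n+1 copies of the sink and n copies of
    the source, prolonged by j steps up the path of p arrows at one end and by i
    steps up the path of q arrows at the other.  Basis vectors are numbered in
    the order of the walk, so that the path of p arrows, the first path, takes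
    the x-th copy of the source to the x-th copy of the sink, and the path of q
    arrows, the second path, takes it to the next one. *)
Definition string n i j : rep K Q :=
  @aligned K Q (@is_inl p q) (string_dim n i j).

Definition top_dim n (v : nat) : nat := if v == s then n.+1 + n.+1 else n.+1.

(** The projective cover of the dual of a string: n+1 copies of the projective
    at 0 over the opposite quiver, where it has dimension two at the vertex s
    because both paths end there. *)
Definition top_cover n : rep K (op Q) :=
  @aligned K (op Q) (@is_inl p q) (top_dim n).

Definition syz_dim n i j (v : nat) : nat :=
  if v < p then nat_of_bool (j < v)
  else if v < s then nat_of_bool (i <= v - p) else n.+2.

(** The kernel of that cover: it has n+2 basis vectors at s, of which the last
    one starts on the first path where the string stops, and the first one
    likewise on the second path. *)
Definition syz_cover n i j : rep K (op Q) :=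
  @aligned K (op Q) (fun a => ~~ @is_inl p q a) (syz_dim n i j).

Definition oproj_dim (v w : nat) : nat :=
  if v == 0 then (if w == s then 2 else 1)
  else if v < p then (v <= w) && (w < p) || (w == s) else v <= w.

(** The indecomposable projective at v over the opposite quiver. *)
Definition oproj (v : vertex (op Q)) : rep K (op Q) :=
  @aligned K (op Q) (@is_inl p q) (oproj_dim v).

Lemma op_dep (a : arrow (op Q)) : @src (op Q) a < @tgt (op Q) a.
Proof. by rewrite val_op_src // val_op_tgt // arrow_from_lt. Qed.

Lemma op_dep_bound (v : vertex (op Q)) : v < #|vertex (op Q)|.
Proof. by rewrite card_ord ltn_ord. Qed.


(** Two arrows of the opposite quiver end at the same vertex only at s, so only
    there can images overlap. *)
Lemma op_aligned_forest (st : pred (arrow (op Q))) (d : nat -> nat) :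
    (forall a : 'I_p + 'I_q, d (arrow_to a) <= d (arrow_from a)) ->
    (forall (a b : 'I_p + 'I_q) y, is_inl a -> is_inl b = false -> y < d s ->
       (if st a then y < d p.-1 else d s <= y + d p.-1) ->
       (if st b then y < d (if q == 1 then 0 else s.-1)
        else d s <= y + d (if q == 1 then 0 else s.-1)) ->
       False) ->
  forest_basis (@aligned K (op Q) st d) (aligned_parent st (fun v => d v)).
Proof.
move=> mono disj; apply: aligned_forest => [a|a b y].
  by rewrite val_op_src // val_op_tgt //.
have D (a' b' : 'I_p + 'I_q) : is_inl a' -> is_inl b' = false ->
    arrow_from a' = arrow_from b' -> y < d (arrow_from a') ->
    (if st a' then y < d (arrow_to a')
     else d (arrow_from a') <= y + d (arrow_to a')) ->
    (if st b' then y < d (arrow_to b')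
     else d (arrow_from b') <= y + d (arrow_to b')) -> False.
  move=> ia ib; have := arrowP hp hq a'; have := arrowP hp hq b'.
  rewrite ia ib => pb pa e.
  have [fs ta] : arrow_from a' = s /\ arrow_to a' = p.-1.
    by move: pa pb; rewrite -e; split_ifs; lia.
  have tb : arrow_to b' = if q == 1 then 0 else s.-1.
    by move: pb; rewrite -e fs; split_ifs; lia.
  by rewrite -e fs ta tb; apply: disj.
rewrite /covers; move/(congr1 val); rewrite /= !val_src // !val_tgt // => e.
case Ea: (is_inl a); case Eb: (is_inl b) => ly ca cb.
- by apply: (arrow_inj hp hq); rewrite ?Ea ?Eb.
- by case: (D a b).
- by case: (D b a); rewrite // -?e // ?e.
- by apply: (arrow_inj hp hq); rewrite ?Ea ?Eb.
Qed.

Lemma top_cover_projective n : projective (top_cover n).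
Proof.
apply: (forest_projective op_dep); apply: op_aligned_forest => [a|a b y -> ->].
  by have := arrowP hp hq a; rewrite /top_dim; split_ifs; lia.
by rewrite /top_dim; case: (q =P 1) => q1; split_ifs; lia.
Qed.

Lemma syz_cover_projective n i j : projective (syz_cover n i j).
Proof.
apply: (forest_projective op_dep); apply: op_aligned_forest => [a|a b y -> ->].
  by have := arrowP hp hq a; rewrite /syz_dim; split_ifs; lia.
by rewrite /syz_dim; case: (q =P 1) => q1; split_ifs; lia.
Qed.

Lemma oproj_forest (v : vertex (op Q)) :
  forest_basis (oproj v)
    (@aligned_parent (op Q) (@is_inl p q) (fun w => oproj_dim v w)).
Proof.
have lv := vertex_le v.
apply: op_aligned_forest => [a|a b y -> ->].
  by have := arrowP hp hq a; rewrite /oproj_dim; split_ifs; lia.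
by rewrite /oproj_dim; case: (q =P 1) => q1; split_ifs; lia.
Qed.

Lemma oproj_dim1 (v : vertex (op Q)) : oproj_dim v v = 1.
Proof. by have := vertex_le v; rewrite /oproj_dim; split_ifs; lia. Qed.

Definition oproj_gen (v : vertex (op Q)) : 'rV[K]_(dim (oproj v) v) := const_mx 1%R.

Lemma oproj_free v : free_at (oproj_gen v).
Proof.
have lt : 0 < dim (oproj v) v by rewrite /= oproj_dim1.
have -> : oproj_gen v = delta_mx 0%R (Ordinal lt).
  apply/rowP=> j; rewrite !mxE eqxx /=; have := ltn_ord j; rewrite [X in _ < X]oproj_dim1.
  by case: j => [[|j]].
have lv := vertex_le v.
apply: (forest_free_at op_dep (oproj_forest v)) => [w y|]; last first.
  apply: aligned_root => // a /(congr1 val); rewrite val_op_src //= val_src // => <-.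
  by have := arrowP hp hq a; rewrite /oproj_dim; split_ifs; lia.
have lw := vertex_le w; have ly : y < oproj_dim v w by exact: ltn_ord.
move/aligned_parent_None => H.
suff : v = w :> nat.
  move=> vw; split; first exact/esym/val_inj.
  by move: ly; rewrite -vw oproj_dim1 /=; case: (y : nat).
apply/eqP; apply: contraT => nvw.
have cov (a : 'I_p + 'I_q) : arrow_from a = w ->
  (if is_inl a then y < oproj_dim v (arrow_to a)
   else oproj_dim v w <= y + oproj_dim v (arrow_to a)) -> False.
  move=> fa; have /H : @tgt (op Q) a = w by apply: val_inj; rewrite /= val_src.
  by rewrite /covers val_op_src // val_op_tgt // fa => /negP.
have [lp|lp] := ltnP w p.
  have [w0|w0] := posnP w; first by move: ly; rewrite /oproj_dim w0; split_ifs; lia.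
  have [|a [ia ta]] := @inl_arrow_into p q w.-1; first by lia.
  case: (cov a); first by have := arrowP hp hq a; rewrite ia ta; split_ifs; lia.
  by rewrite ia ta; move: ly; rewrite /oproj_dim; split_ifs; lia.
have [|a [ia fa]] := @inr_arrow_from p q hp hq w; first by lia.
have pa := arrowP hp hq a; rewrite ia fa in pa.
have [ws|ws] := eqVneq (w : nat) s; last first.
  by case: (cov a) => //; move: ly pa; rewrite ia /oproj_dim; split_ifs; lia.
have [|b [ib tb]] := @inl_arrow_into p q p.-1; first by lia.
have pb := arrowP hp hq b; rewrite ib tb in pb.
have fb : arrow_from b = w by move: pb; split_ifs; lia.
have ca := cov a fa; have cb := cov b fb; rewrite ia in ca; rewrite ib tb in cb.
have {}pa : arrow_to a = (if w == p :> nat then 0 else w.-1) by lia.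
have [l1|l1] := ltnP y (oproj_dim v p.-1); first by case: cb.
case: ca; rewrite pa; move: ly l1; rewrite /oproj_dim; split_ifs; lia.
Qed.

Definition op_sink : vertex (op Q) := vtx p q s.

Lemma val_op_sink : op_sink = s :> nat.
Proof. by rewrite val_vtx //; lia. Qed.

Lemma oproj_dim_mono (v : vertex (op Q)) (a : 'I_p + 'I_q) :
  (oproj_dim v (arrow_to a) <= oproj_dim v (arrow_from a))%N.
Proof.
have lv := vertex_le v.
by have := arrowP hp hq a; rewrite /oproj_dim; split_ifs; lia.
Qed.

Lemma oproj_dim_s (v : vertex (op Q)) : oproj_dim v s = (v == 0 :> nat).+1.
Proof. by have := vertex_le v; rewrite /oproj_dim; split_ifs; lia. Qed.

Lemma oproj_dim_anti (a : 'I_p + 'I_q) w : (w <= s)%N ->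
  (oproj_dim (arrow_from a) w <= oproj_dim (arrow_to a) w)%N.
Proof.
move=> lw; have := arrow_from_lt hp hq a.
case: (arrowP hp hq a) => [[_ [lt e]]|[_ [lt e]]].
  by move: e; case: ifP => e1 ->; rewrite /oproj_dim; split_ifs; lia.
by move: e; case: ifP => e1 ->; rewrite /oproj_dim; split_ifs; lia.
Qed.

Lemma oproj_dim_other (a b : 'I_p + 'I_q) : is_inl a != is_inl b ->
  oproj_dim (arrow_from a) (arrow_to b) = 0%N.
Proof.
case: (arrowP hp hq a) => [[-> [la ea]]|[-> [la ea]]];
  case: (arrowP hp hq b) => [[-> [lb eb]]|[-> [lb eb]]] //= _.
  by move: ea; case: ifP => e1 ->; move: eb; case: ifP => e2 ->;
     rewrite /oproj_dim; split_ifs; lia.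
by rewrite /oproj_dim; split_ifs; lia.
Qed.

End ExplicitModules.

(** * The inverse translate of a string module *)

Section TransposeOfString.
Variables (K : fieldType) (p q : nat).
Hypotheses (hp : (0 < p)%N) (hq : (0 < q)%N) (hpq : (1 < p + q)%N).
Variables (n i j : nat).
Hypotheses (hi : (i < q)%N) (hj : (j < p)%N).
Local Open Scope ring_scope.
Local Notation Q := (Atilde p q).
Local Notation s := (p + q).-1.
Local Notation sd := (string_dim p n i j).
Local Notation td := (top_dim p q n).
Local Notation zd := (syz_dim p q n i j).
Local Notation bd := (oproj_dim p q).
Local Notation sv := (op_sink p q).
Local Notation E := (syz_cover K p q n i j).

Lemma string_dim_p v : (v < p)%N -> sd v = (n + (v <= j))%N.
Proof. by rewrite /string_dim => ->. Qed.
Lemma string_dim_q v : (p <= v)%N -> sd v = (n + (v - p < i))%N.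
Proof. by rewrite /string_dim ltnNge => ->. Qed.
Lemma string_dim_s : sd s = n.
Proof. by rewrite string_dim_q; lia. Qed.
Lemma top_dim_s : td s = (n.+1 + n.+1)%N.
Proof. by rewrite /top_dim eqxx. Qed.
Lemma top_dim_lt v : (v < s)%N -> td v = n.+1.
Proof. by rewrite /top_dim; case: eqP => // ->; rewrite ltnn. Qed.

Lemma arrow_from_exists k : (0 < k < p + q)%N ->
  exists a : 'I_p + 'I_q, arrow_from a = k.
Proof.
case/andP=> k0 kpq; have [kp|kp] := ltnP k p; last first.
  by have [|a [_ fa]] := inr_arrow_from hp hq (k := k); [rewrite kp kpq|exists a].
have [|a [ia ta]] := @inl_arrow_into p q k.-1; first lia.
exists a; case: (arrowP hp hq a) => [[_ [_ ->]]|[]]; last by rewrite ia.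
by rewrite ta prednK // kp.
Qed.

Definition ostring : rep K (op Q) := @aligned K (op Q) (@is_inl p q) sd.

(** The vertices on the first path keep the first basis vectors of the cover and
    those on the second path the last ones; at s the two copies are glued. *)
Definition top_map : fam (top_cover K p q n) ostring :=
  fun v => mkmx (td v) (sd v) (fun x y =>
    (((v < p) || (v == s :> nat)) && (x == y)
     || (p <= v) && (x + sd v == y + td v))%N%:R).

Lemma ent_top_map_p (v : vertex (op Q)) x y : (v < p)%N ->
  ent (top_map v) x y = ((y < sd v) && (x == y))%N%:R.
Proof.
move=> vp; rewrite ent_mk if_natr /= vp (leqNgt p) vp /= orbF top_dim_lt; last lia.
by congr (_%:R); rewrite string_dim_p //; case: (v <= j)%N; lia.
Qed.

Lemma ent_top_map_q (v : vertex (op Q)) x y : (p <= v < s)%N ->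
  ent (top_map v) x y = ((y < sd v) && (x + sd v == y + n.+1))%N%:R.
Proof.
move=> /andP[vp vs]; rewrite ent_mk if_natr /= vp (ltnNge v) vp (ltn_eqF vs) /=.
rewrite top_dim_lt //; congr (_%:R); rewrite string_dim_q //.
by case: (v - p < i)%N; lia.
Qed.

Lemma ent_top_map_s (v : vertex (op Q)) x y : v = s :> nat ->
  ent (top_map v) x y = ((y < n) && ((x == y) || (x == y + n.+2)))%N%:R.
Proof.
move=> vs; rewrite ent_mk if_natr /= vs eqxx orbT /= string_dim_s top_dim_s.
have -> : (p <= s)%N by lia.
by congr (_%:R); lia.
Qed.

Lemma hom_top_map : is_hom top_map.
Proof.
apply/hom_alignedP => a x y.
have es := val_op_src hp hq a; have et := val_op_tgt hp hq a.
rewrite es et; case: (arrowP hp hq a) => [[-> [lt e]]|[-> [lt e]]].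
  rewrite (@ent_top_map_p (src a)) es //; rewrite e in et *.
  move: et; case: ifP => lt' et.
    rewrite (@ent_top_map_p (tgt a)) et // !string_dim_p //.
    by rewrite top_dim_lt; last lia; move=> lx ly; congr (_%:R); lia.
  rewrite (@ent_top_map_s (tgt a)) // string_dim_s string_dim_p // top_dim_lt; last lia.
  by move=> lx ly; congr (_%:R); lia.
rewrite e in es *; have [fs|fs] := eqVneq (arrow_from a) s.
  rewrite (@ent_top_map_s (tgt a)) ?et //; move: es; rewrite fs string_dim_s top_dim_s.
  case: ifP => sp es.
    rewrite (@ent_top_map_p (src a)) es // top_dim_lt ?string_dim_p //; try lia.
    by move=> lx ly; rewrite !if_natr; congr (_%:R); lia.
  rewrite (@ent_top_map_q (src a)) es ?top_dim_lt ?string_dim_q //; try lia.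
  by case: (_ < i)%N; move=> lx ly; rewrite !if_natr; congr (_%:R); lia.
rewrite (@ent_top_map_q (tgt a)) et ?(@string_dim_q (arrow_from a)) //; try lia.
rewrite (@top_dim_lt (arrow_from a)); last lia.
move: es; case: eqP => [fp|fp] es.
  rewrite (@ent_top_map_p (src a)) es // top_dim_lt ?string_dim_p //; try lia.
  by case: (_ < i)%N; move=> lx ly; rewrite !if_natr; congr (_%:R); lia.
rewrite (@ent_top_map_q (src a)) es ?top_dim_lt ?string_dim_q //; try lia.
case E1: (_ < i)%N; case E2: (_ < i)%N => lx ly; rewrite !if_natr; congr (_%:R); lia.
Qed.

Lemma epi_top_map : epi top_map.
Proof.
move=> v; have lv := vertex_le v; apply/row_fullP.
have [vp|vp] := ltnP v p.
  exists (diagmx K (sd v) (td v) 0 0); apply: ent_ext => x y lx ly.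
  rewrite ent_diag_mul ent_top_map_p // ent1 lx ly; congr (_%:R); lia.
have [vs|vs] := eqVneq (v : nat) s.
  exists (diagmx K (sd v) (td v) 0 0); apply: ent_ext => x y lx ly.
  rewrite ent_diag_mul ent_top_map_s // ent1 lx; congr (_%:R).
  by move: (lx : x < sd v)%N (ly : y < sd v)%N; rewrite vs string_dim_s; lia.
exists (diagmx K (sd v) (td v) (td v) (sd v)); apply: ent_ext => x y lx ly.
rewrite ent_diag_mul ent_top_map_q ?ent1; last lia.
rewrite if_natr; congr (_%:R).
move: (lx : x < sd v)%N (ly : y < sd v)%N.
by rewrite top_dim_lt ?string_dim_q //; try case: (v - p < i)%N; lia.
Qed.

(** The cover is generated at the vertex 0, where the map to the string has no
    kernel. *)
Lemma superfluous_top_map : superfluous (fun v => kermx (top_map v)).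
Proof.
move=> U sU full.
have U0 (v : vertex (op Q)) : v = 0%N :> nat -> row_full (U v).
  move=> v0; have := full v; suff -> : kermx (top_map v) = 0 by rewrite /row_full adds0mx.
  apply/eqP; rewrite kermx_eq0; apply/row_freeP.
  exists (diagmx K (sd v) (td v) 0 0); apply: ent_ext => x y lx ly.
  rewrite ent_mul_diag ent_top_map_p ?ent1 ?v0 // if_natr; congr (_%:R).
  by move: (lx : x < td v)%N (ly : y < td v)%N;
     rewrite v0 string_dim_p // top_dim_lt; lia.
have step (a : 'I_p + 'I_q) (v w : vertex (op Q)) :
    v = arrow_to a :> nat -> arrow_from a = w -> row_full (U v) ->
    (align K (is_inl a) (td v) (td w) <= U w)%MS.
  move=> ta fa fv.
  have va : v = @src (op Q) a by apply: val_inj; rewrite /= ta val_tgt.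
  have wa : w = @tgt (op Q) a by apply: val_inj; rewrite /= val_src.
  rewrite va wa in fv *; apply: submx_trans (sU a).
  by rewrite -[X in (X <= _)%MS]mul1mx; apply: submxMr; rewrite sub1mx.
have F m (v : vertex (op Q)) : (v < m)%N -> (v < s)%N -> row_full (U v).
  elim: m v => // m IH v vm vs.
  have [v0|v0] := posnP v; first exact: U0.
  have [|a fa] := @arrow_from_exists v; first by lia.
  have lt := arrow_from_lt hp hq a; rewrite fa in lt.
  have eu := val_op_src hp hq a.
  have fu : row_full (U (@src (op Q) a)) by apply: IH; rewrite eu; lia.
  rewrite -sub1mx; apply: submx_trans (step a _ v eu fa fu).
  rewrite sub1mx; apply: (@row_full_align K (is_inl a) (td (@src (op Q) a)) (td v)).
  by rewrite eu (@top_dim_lt v) ?(@top_dim_lt (arrow_to a)) //; apply: ltn_trans vs.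
move=> v; have [vs|vs] := eqVneq (v : nat) s; last first.
  by apply: (F v.+1) => //; have := vertex_le v; lia.
have [|a [ia ta]] := @inl_arrow_into p q p.-1; first lia.
have [|b [ib fb]] := @inr_arrow_from p q hp hq s; first lia.
have fa : arrow_from a = s.
  by have := arrowP hp hq a; rewrite ia ta => -[[_ [_ ->]]|[]] //; case: ifP; lia.
have ea := val_op_src hp hq a; have eb := val_op_src hp hq b.
have lb := arrow_from_lt hp hq b; rewrite fb in lb.
have fua : row_full (U (@src (op Q) a)) by apply: (F p) => //; rewrite ea ta; lia.
have fub : row_full (U (@src (op Q) b)) by apply: (F s) => //; rewrite eb; lia.
have la := step a _ v ea (etrans fa (esym vs)) fua.
have lb' := step b _ v eb (etrans fb (esym vs)) fub.
rewrite -sub1mx.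
pose A := align K true (td v) (td (@src (op Q) a)).
pose B := align K false (td v) (td (@src (op Q) b)).
have -> : 1%:M = A *m align K true (td (@src (op Q) a)) (td v)
             + B *m align K false (td (@src (op Q) b)) (td v).
  apply: ent_ext => x y lx ly; move: (lx : x < td v)%N (ly : y < td v)%N.
  rewrite entD !ent_mul_align ent1 lx ly /align !ent_mk.
  rewrite !ea !eb vs top_dim_s !top_dim_lt ?ta; try lia.
  move=> _ _; have {}lx : (x < n.+1 + n.+1)%N by rewrite -top_dim_s -vs.
  have {}ly : (y < n.+1 + n.+1)%N by rewrite -top_dim_s -vs.
  rewrite !if_natr; have [y1|y1] := ltnP y n.+1.
    rewrite [X in _ = _ + (nat_of_bool X)%:R](_ : _ = false) ?addr0; last by lia.
    by congr (_%:R); lia.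
  rewrite [X in _ = (nat_of_bool X)%:R + _](_ : _ = false) ?add0r; last by lia.
  by congr (_%:R); lia.
rewrite -ia -[X in _ + _ *m align K X _ _]ib.
by apply: addmx_sub; apply: submx_trans (submxMl _ _) _.
Qed.

(** At s the n middle basis vectors are the relations between the copies along
    the two paths, and the outer ones say where the string stops. *)
Definition syz_map : fam (syz_cover K p q n i j) (top_cover K p q n) :=
  fun v => mkmx (zd v) (td v) (fun x y =>
    (((v < p) || (v == s :> nat)) && (x + n.+1 == y + zd v))%N%:R
    - ((p <= v) && (x + td v == y + n.+1))%N%:R).

Lemma ent_syz_map_p (v : vertex (op Q)) x y : (v < p)%N ->
  ent (syz_map v) x y = ((x < (j < v)) && (y == n))%N%:R.
Proof.
move=> vp; rewrite ent_mk /= vp (leqNgt p) vp /= subr0 if_natr.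
rewrite top_dim_lt /syz_dim ?vp; last lia.
by congr (_%:R); case: (j < v)%N; lia.
Qed.

Lemma ent_syz_map_q (v : vertex (op Q)) x y : (p <= v < s)%N ->
  ent (syz_map v) x y = - ((x < (i <= v - p)) && (y == 0))%N%:R.
Proof.
move=> /andP[vp vs]; rewrite ent_mk /= (ltnNge v p) vp (ltn_eqF vs) /= sub0r.
rewrite if_opp; congr (- _); rewrite if_natr top_dim_lt // /syz_dim (ltnNge v p) vp vs /=.
by congr (_%:R); case: (i <= v - p)%N; lia.
Qed.

Lemma ent_syz_map_s (v : vertex (op Q)) x y : v = s :> nat -> (x < n.+2)%N ->
  ent (syz_map v) x y =
  ((x == y.+1) && (y <= n))%N%:R - ((x <= n) && (y == x + n.+1))%N%:R.
Proof.
move=> vs lx; rewrite ent_mk /= vs eqxx orbT /= top_dim_s /syz_dim ltnn.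
have -> : (s < p)%N = false by lia.
have -> : (p <= s)%N by lia.
rewrite lx /=; case: ifP => ly; first by congr (_%:R - _%:R); lia.
have -> : (x == y.+1) && (y <= n)%N = false by lia.
have -> : (x <= n)%N && (y == x + n.+1)%N = false by lia.
by rewrite subrr.
Qed.

Lemma syz_dim_p v : (v < p)%N -> zd v = (j < v)%N.
Proof. by rewrite /syz_dim => ->. Qed.
Lemma syz_dim_q v : (p <= v < s)%N -> zd v = (i <= v - p)%N.
Proof. by case/andP=> vp vs; rewrite /syz_dim (ltnNge v p) vp /= vs. Qed.
Lemma syz_dim_s : zd s = n.+2.
Proof. by rewrite /syz_dim ltnn; have -> : (s < p)%N = false by lia. Qed.

Lemma hom_syz_map : is_hom syz_map.
Proof.
apply/hom_alignedP => a x y.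
have es := val_op_src hp hq a; have et := val_op_tgt hp hq a.
rewrite es et; case: (arrowP hp hq a) => [[-> [lt e]]|[-> [lt e]]]; rewrite /negb.
  rewrite (@ent_syz_map_p (src a)) es //; rewrite e in et *.
  move: et; case: ifP => lt' et.
    rewrite (@ent_syz_map_p (tgt a)) et // !syz_dim_p //.
    rewrite top_dim_lt; last lia.
    by move=> lx ly; rewrite if_natr; congr (_%:R); lia.
  rewrite syz_dim_s syz_dim_p // top_dim_s => lx ly.
  rewrite (@ent_syz_map_s (tgt a)) //; last lia.
  rewrite (_ : (_ <= _)%N = true); last by lia.
  rewrite [X in _ - (nat_of_bool X)%:R](_ : _ = false) ?subr0; last by lia.
  by congr (_%:R); lia.
rewrite e in es *; have [fs|fs] := eqVneq (arrow_from a) s.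
  move: es; rewrite fs top_dim_s.
  case: ifP => sp es.
    by rewrite syz_dim_p.
  have b1 : (p <= s.-1 < s)%N by lia.
  rewrite (@ent_syz_map_q (src a)) es // top_dim_lt ?syz_dim_q //; last by case/andP: b1.
  move=> lx ly; rewrite (@ent_syz_map_s (tgt a)) ?et //; last lia.
  have -> : (x == y.+1) && (y <= n)%N = false by lia.
  rewrite sub0r if_opp; congr (- _); rewrite if_natr; congr (_%:R).
  by lia.
rewrite (@ent_syz_map_q (tgt a)) et; last lia.
rewrite (@top_dim_lt (arrow_from a)); last lia.
move: es; case: eqP => [fp|fp] es; first by rewrite syz_dim_p.
rewrite (@ent_syz_map_q (src a)) es ?top_dim_lt ?syz_dim_q //; try lia.
move=> lx ly; rewrite if_opp; congr (- _); rewrite if_natr; congr (_%:R).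
by lia.
Qed.

Lemma syz_map_pE (v : vertex (op Q)) : (v < p)%N ->
  syz_map v = diagmx K (zd v) (td v) n 0.
Proof.
move=> vp; apply: ent_ext => a b la lb.
move: (la : a < zd v)%N (lb : b < td v)%N => {}la {}lb.
rewrite ent_syz_map_p // ent_mk la lb; congr (_%:R).
by move: la; rewrite syz_dim_p //; lia.
Qed.

Lemma syz_map_qE (v : vertex (op Q)) : (p <= v < s)%N ->
  syz_map v = - diagmx K (zd v) (td v) 0 0.
Proof.
move=> vp; apply: ent_ext => a b la lb.
move: (la : a < zd v)%N (lb : b < td v)%N => {}la {}lb.
rewrite entN ent_syz_map_q // ent_mk la lb; congr (- _%:R).
by move: la; rewrite syz_dim_q //; lia.
Qed.

Lemma syz_map_sE (v : vertex (op Q)) : v = s :> nat ->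
  syz_map v = diagmx K (zd v) (td v) n.+1 n.+2 - diagmx K (zd v) (td v) n.+1 0.
Proof.
move=> vs; have zs : zd v = n.+2 by rewrite vs syz_dim_s.
have ts : td v = (n.+1 + n.+1)%N by rewrite vs top_dim_s.
apply: ent_ext => x y lx ly; move: (lx : x < zd v)%N (ly : y < td v)%N.
move=> {}lx {}ly; rewrite ent_syz_map_s -?zs // entD entN !ent_mk lx ly /=.
by move: lx ly; rewrite zs ts => lx ly; congr (_%:R - _%:R); lia.
Qed.

Lemma mono_syz_map : mono syz_map.
Proof.
move=> v; have lv := vertex_le v.
have [vp|vp] := ltnP v p.
  apply/row_freeP; exists (diagmx K (td v) (zd v) 0 n); apply: ent_ext => x y lx ly.
  move: (lx : x < zd v)%N (ly : y < zd v)%N.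
  rewrite ent_mul_diag ent_syz_map_p ?ent1 // if_natr syz_dim_p // => {}lx {}ly.
  by congr (_%:R); lia.
have [vs|vs] := eqVneq (v : nat) s; last first.
  have b : (p <= v < s)%N by lia.
  apply/row_freeP; exists (- diagmx K (td v) (zd v) 0 0); apply: ent_ext => x y lx ly.
  move: (lx : x < zd v)%N (ly : y < zd v)%N.
  rewrite mulmxN entN ent_mul_diag ent_syz_map_q ?ent1 // if_opp opprK if_natr.
  by rewrite syz_dim_q // => {}lx {}ly; congr (_%:R); lia.
have zs : zd v = n.+2 by rewrite vs syz_dim_s.
have ts : td v = (n.+1 + n.+1)%N by rewrite vs top_dim_s.
have hE := syz_map_sE vs.
rewrite -kermx_eq0; set C := kermx _; have Ch : C *m syz_map v = 0 by apply: mulmx_ker.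
have {}Ch x y : (y < td v)%N -> ent (C *m diagmx K (zd v) (td v) n.+1 n.+2) x y
                = ent (C *m diagmx K (zd v) (td v) n.+1 0) x y.
  move=> ly; have := congr1 (fun A => ent A x y) Ch.
  by rewrite hE mulmxBr entD entN ent0 => /eqP; rewrite subr_eq0 => /eqP.
apply/eqP/ent_ext => x y lx ly; rewrite ent0.
have {}ly : (y < n.+2)%N by rewrite -zs.
have [yn|yn] := leqP y n.
  have := Ch x (y + n.+1)%N; rewrite !ent_mul_diag ts => H.
  have l1 : (y + n.+1 < n.+1 + n.+1)%N by lia.
  move: (H l1); rewrite l1 addn0 leq_addl addnK.
  have -> : (n < y + n.+1 + n.+2)%N by lia.
  by rewrite ent_col_out /= => [<-//|]; rewrite [X in (X <= _)%N]zs; lia.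
have := Ch x n; rewrite !ent_mul_diag ts => H.
have l1 : (n < n.+1 + n.+1)%N by lia.
move: (H l1); rewrite l1 addn0 ltnn /=.
have -> : (n < n + n.+2)%N by lia.
by rewrite (_ : (n + n.+2 - n.+1)%N = y) //; lia.
Qed.

Lemma syz_top_map0 v : syz_map v *m top_map v = 0.
Proof.
have lv := vertex_le v; apply: ent_ext => x y lx ly; rewrite ent0.
move: (lx : x < zd v)%N (ly : y < sd v)%N => {}lx {}ly.
have [vp|vp] := ltnP v p.
  rewrite (syz_map_pE vp) ent_diag_mul lx leq0n ent_top_map_p //=.
  rewrite (_ : (_ && _) = false) //.
  by move: lx ly; rewrite syz_dim_p // string_dim_p //; lia.
have [vs|vs] := eqVneq (v : nat) s; last first.
  have b : (p <= v < s)%N by lia.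
  rewrite (syz_map_qE b) mulNmx entN ent_diag_mul lx leq0n ent_top_map_q //=.
  rewrite (_ : (_ && _) = false) ?oppr0 //.
  by move: lx ly; rewrite syz_dim_q // string_dim_q //; lia.
have zs : zd v = n.+2 by rewrite vs syz_dim_s.
have ts : td v = (n.+1 + n.+1)%N by rewrite vs top_dim_s.
rewrite (syz_map_sE vs) mulmxBl entD entN !ent_diag_mul lx !ent_top_map_s // !if_natr.
apply/eqP; rewrite subr_eq0; apply/eqP; congr (_%:R).
by move: lx ly; rewrite zs vs string_dim_s; lia.
Qed.

Lemma exact_of_dims M N P (f : 'M[K]_(M, N)) (g : 'M[K]_(N, P)) :
  row_free f -> row_full g -> f *m g = 0 -> (M + P = N)%N -> (f :=: kermx g)%MS.
Proof.
move=> /eqP rf /eqP rg fg e; apply/eqmxP.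
have le : (f <= kermx g)%MS by apply/sub_kermxP.
by rewrite -(geq_leqif (mxrank_leqif_eq le)) mxrank_ker rf rg; lia.
Qed.

Lemma string_presentation : min_proj_presentation syz_map top_map.
Proof.
split; split.
- exact: syz_cover_projective.
- exact: top_cover_projective.
- exact: hom_syz_map.
- exact: hom_top_map.
- exact: epi_top_map.
- move=> v; apply: exact_of_dims; [exact: mono_syz_map|exact: epi_top_map|exact: syz_top_map0|].
  have lv := vertex_le v; rewrite -[LHS]/(zd v + sd v)%N -[RHS]/(td v).
  have [vs|vs] := eqVneq (v : nat) s.
    by rewrite vs syz_dim_s string_dim_s top_dim_s; lia.
  rewrite top_dim_lt; last lia.
  have [vp|vp] := ltnP v p; first by rewrite syz_dim_p // string_dim_p //; lia.
  by rewrite syz_dim_q ?string_dim_q //; lia.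
- exact: superfluous_top_map.
- move=> U sU full v; have := full v.
  have /eqP -> : kermx (syz_map v) == 0 by rewrite kermx_eq0 mono_syz_map.
  by rewrite /row_full adds0mx.
Qed.

(** Aligned arrows carry entries unchanged, so the values of a map out of the
    syzygy along a path can be read off at its last vertex. *)
Lemma syz_hom_p (v w : vertex (op Q)) (f : fam (syz_cover K p q n i j) (oproj K v)) y :
  is_hom f -> (j < w < p)%N -> (y < bd v s)%N ->
  ent (f sv) n.+1 y = ent (f w) 0 y.
Proof.
move=> hf + ly; have [m] := ubnP (p - w); elim: m w => // m IH w lm jw.
have [|a [ia ta]] := @inl_arrow_into p q w; first lia.
have ea := arrowP hp hq a; rewrite ia ta in ea.
have ew : w = @src (op Q) a by apply: val_inj; rewrite /= val_tgt.
have mono := oproj_dim_mono hp hq hpq v a; rewrite ta in mono.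
have H y' := (proj1 (hom_alignedP f) hf a 0%N y').
rewrite !(val_op_src hp hq a) !(val_op_tgt hp hq a) ia ta /negb in H.
have zw : zd w = 1%N by rewrite syz_dim_p; lia.
rewrite zw in H.
have [fs|fs] := eqVneq (arrow_from a) s.
  have et : @tgt (op Q) a = sv by apply: val_inj; rewrite /= val_src // val_vtx //; lia.
  by rewrite ew -(H y) // fs // syz_dim_s // et add0n subn1.
have [wp fw] : (w.+1 < p)%N /\ arrow_from a = w.+1.
  by case: ea => [[_ [_ e]]|[//]]; move: fs; rewrite e; case: ifP => // _ /eqP.
have et : @tgt (op Q) a = w.+1 :> nat by rewrite val_op_tgt.
have zt : zd (arrow_from a) = 1%N by rewrite fw syz_dim_p; lia.
have -> : ent (f sv) n.+1 y = ent (f (@tgt (op Q) a)) 0 y.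
  by apply: IH; rewrite et; lia.
rewrite ew; have [ly'|ly'] := ltnP y (bd v (arrow_from a)).
  by rewrite -(H y) // zt.
rewrite !ent_col_out //; first by rewrite -ew; apply: leq_trans mono ly'.
by rewrite dim_aligned val_op_tgt.
Qed.

Lemma syz_hom_q (v w : vertex (op Q)) (f : fam (syz_cover K p q n i j) (oproj K v)) y :
  is_hom f -> (p <= w < s)%N -> (i <= w - p)%N -> (y < bd v s)%N ->
  ent (f sv) 0 y =
  if (bd v s <= y + bd v w)%N then ent (f w) 0 (y + bd v w - bd v s) else 0.
Proof.
move=> hf + + ly; have [m] := ubnP (s - w); elim: m w => // m IH w lm pw iw.
have [|a [ia fa]] := @inr_arrow_from p q hp hq w.+1; first lia.
have ea := arrowP hp hq a; rewrite ia fa in ea.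
have ta : arrow_to a = w.
  by case: ea => [[//]|[_ [_ ->]]]; case: eqP; lia.
have ew : w = @src (op Q) a by apply: val_inj; rewrite /= val_tgt.
have mono := oproj_dim_mono hp hq hpq v a; rewrite ta in mono.
have H y' := (proj1 (hom_alignedP f) hf a 0%N y').
rewrite !(val_op_src hp hq a) !(val_op_tgt hp hq a) ia ta /negb in H.
have zw : zd w = 1%N by rewrite syz_dim_q // iw.
rewrite zw in H.
have [fs|fs] := eqVneq (w.+1 : nat) s.
  have et : @tgt (op Q) a = sv by apply: val_inj; rewrite /= val_src // val_vtx //; lia.
  by move: (H y isT); rewrite fa fs et => /(_ ly) ->; rewrite -ew.
have et : @tgt (op Q) a = w.+1 :> nat by rewrite val_op_tgt.
rewrite (IH (@tgt (op Q) a)) ?et; try lia.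
have mono' : (bd v w.+1 <= bd v s)%N.
  by rewrite /oproj_dim; split_ifs; lia.
have [l1|l1] := leqP (bd v s) (y + bd v w.+1); last first.
  by rewrite (_ : (_ <= _)%N = false) //; rewrite fa in mono; lia.
have := H (y + bd v w.+1 - bd v s)%N isT; rewrite fa => -> //; last by lia.
rewrite ew -ew; case: ifP => l2; case: ifP => l3; try lia; rewrite -?ew //.
by congr (ent _ _ _); lia.
Qed.

(** The outer generators of the syzygy appear on a path before the vertex s, so
    that their images come from the space of the projective at that vertex. *)
Lemma syz_hom_last (v : vertex (op Q)) (f : fam (syz_cover K p q n i j) (oproj K v)) y :
  is_hom f -> (j.+1 < p)%N -> (bd v j.+1 <= y)%N -> ent (f sv) n.+1 y = 0.
Proof.
move=> hf jp ly; have [l|l] := ltnP y (bd v s); last first.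
  by rewrite ent_col_out // dim_aligned (val_op_sink hp hq hpq).
have vj : vtx p q j.+1 = j.+1 :> nat by rewrite val_vtx //; lia.
rewrite (@syz_hom_p _ (vtx p q j.+1) _ _ hf) ?vj ?ltnSn //.
by rewrite ent_col_out // dim_aligned vj.
Qed.

Lemma syz_hom_first (v : vertex (op Q)) (f : fam (syz_cover K p q n i j) (oproj K v)) y :
  is_hom f -> (i.+1 < q)%N -> (y + bd v (p + i) < bd v s)%N -> ent (f sv) 0 y = 0.
Proof.
move=> hf iq ly.
have vj : vtx p q (p + i) = (p + i)%N :> nat by rewrite val_vtx //; lia.
rewrite (@syz_hom_q _ (vtx p q (p + i)) _ _ hf) ?vj ?addKn //; try lia.
by rewrite leqNgt ly.
Qed.

Lemma top_hom_p (v : vertex (op Q)) (g : fam (top_cover K p q n) (oproj K v))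
    (a : 'I_p + 'I_q) x y :
  is_hom g -> is_inl a -> (x <= n)%N -> (y < bd v s)%N ->
  ent (g sv) x y = ent (g (@src (op Q) a)) x y.
Proof.
move=> hg + lx ly; have [m] := ubnP (p - arrow_to a).
elim: m a => // m IH a lm ia.
have ea := arrowP hp hq a; rewrite ia in ea.
have mono := oproj_dim_mono hp hq hpq v a.
have H y' := (proj1 (hom_alignedP g) hg a x y').
rewrite !(val_op_src hp hq a) !(val_op_tgt hp hq a) ia in H.
have tn : td (arrow_to a) = n.+1.
  by rewrite top_dim_lt //; have := arrow_from_lt hp hq a; case: ea => -[_ []] //; case: ifP; lia.
rewrite tn in H.
have [fs|fs] := eqVneq (arrow_from a) s.
  have et : @tgt (op Q) a = sv by apply: val_inj; rewrite /= val_src // val_vtx //; lia.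
  by rewrite -(H y) // ?fs // et.
have [tp fw] : ((arrow_to a).+1 < p)%N /\ arrow_from a = (arrow_to a).+1.
  by case: ea => [[_ [_ e]]|[//]]; move: fs; rewrite e; case: ifP => // _ /eqP.
have [|b [ib tb]] := @inl_arrow_into p q (arrow_to a).+1; first lia.
have eb : @src (op Q) b = @tgt (op Q) a by apply: val_inj; rewrite /= val_src // val_tgt // fw.
rewrite (IH b) ?tb ?eb //; last by lia.
have [ly'|ly'] := ltnP y (bd v (arrow_from a)); first by rewrite -(H y).
rewrite !ent_col_out // ?dim_aligned ?val_op_tgt ?val_op_src //.
exact: leq_trans mono ly'.
Qed.

Lemma top_hom_q (v : vertex (op Q)) (g : fam (top_cover K p q n) (oproj K v))
    (a : 'I_p + 'I_q) x y :
  is_hom g -> is_inl a = false -> (x <= n)%N -> (y < bd v s)%N ->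
  ent (g sv) (x + n.+1) y =
  if (bd v s <= y + bd v (arrow_to a))%N
  then ent (g (@src (op Q) a)) x (y + bd v (arrow_to a) - bd v s) else 0.
Proof.
move=> hg + lx ly; have [m] := ubnP (s - arrow_from a).
elim: m a => // m IH a lm ia.
have ea := arrowP hp hq a; rewrite ia in ea.
have mono := oproj_dim_mono hp hq hpq v a.
have H y' := (proj1 (hom_alignedP g) hg a x y').
rewrite !(val_op_src hp hq a) !(val_op_tgt hp hq a) ia in H.
have la := arrow_from_lt hp hq a.
have [pf fpq] : (p <= arrow_from a)%N /\ (arrow_from a <= s)%N.
  by case: ea => [[//]|[_ [? _]]]; lia.
have tn : td (arrow_to a) = n.+1 by rewrite top_dim_lt //; lia.
rewrite tn in H.
have [fs|fs] := eqVneq (arrow_from a) s.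
  have et : @tgt (op Q) a = sv by apply: val_inj; rewrite /= val_src // val_vtx //; lia.
  move: (H y); rewrite fs top_dim_s et => <- //.
  by rewrite leqNgt (_ : (_ < n.+1)%N = false) ?addnA ?addnK //; lia.
have [|b [ib fb]] := @inr_arrow_from p q hp hq (arrow_from a).+1; first lia.
have tb : arrow_to b = arrow_from a.
  by have := arrowP hp hq b; rewrite ib fb => -[[//]|[_ [_ ->]]]; case: eqP; lia.
have eb : @src (op Q) b = @tgt (op Q) a by apply: val_inj; rewrite /= val_src // val_tgt // tb.
rewrite (IH b) ?fb ?tb ?eb //; last by lia.
have mono' : (bd v (arrow_from a) <= bd v s)%N.
  by rewrite /oproj_dim; split_ifs; lia.
have [l1|l1] := leqP (bd v s) (y + bd v (arrow_from a)); last first.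
  by rewrite (_ : (_ <= _)%N = false) //; lia.
move: (H (y + bd v (arrow_from a) - bd v s)%N); rewrite top_dim_lt; last by lia.
rewrite leq_addl addnK => -> //; last by lia.
case: ifP => l2; case: ifP => l3; try lia; try by [].
by congr (ent _ _ _); lia.
Qed.

(** Each end of the string grows by one step.  An end that has climbed all of
    its path passes the source and runs down the other path to a new copy of the
    sink. *)
Definition next_n : nat := (n + (i.+1 == q) + (j.+1 == p))%N.
Definition next_i : nat := if i.+1 == q then 0 else i.+1.
Definition next_j : nat := if j.+1 == p then 0 else j.+1.
Local Notation nd := (string_dim p next_n next_i next_j).
Local Notation next := (string K p q next_n next_i next_j).

(** One where the first coordinate of the image of the first generator of the
    syzygy is forced to vanish, so that the transpose has its first coordinate
    at the second generator. *)
Definition shift (v : nat) : nat := if (v < p)%N then (i.+1 < q)%N else (i < v - p)%N.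

(** A map that factors through the cover changes the entries (z, 0) and (z-1, 1)
    by opposite amounts, so that their sum descends to the transpose. *)
Definition pairing m l (A : 'M[K]_(m, l)) (z : nat) : K :=
  ent A z 0 + (if (0 < z)%N then ent A z.-1 1 else 0).

Lemma pairing_lin m l (k : K) (A B : 'M[K]_(m, l)) z :
  pairing (k *: A + B) z = k * pairing A z + pairing B z.
Proof.
rewrite /pairing !entD !entZ; case: ifP => _; last by rewrite !addr0.
by rewrite mulrDr addrACA.
Qed.

(** The projection from maps into P_v to the space of the transpose at v.  Only
    for v = 0 does P_v have a second coordinate at s. *)
Definition tmap (v : vertex (op Q)) (f : fam E (oproj K v)) :
    'rV[K]_(dim next v) :=
  mkmx 1 (nd v) (fun _ x => pairing (f sv) (x + shift v)).

Lemma ent_tmap v f x :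
  ent (@tmap v f) 0 x = if (x < nd v)%N then pairing (f sv) (x + shift v) else 0.
Proof. by rewrite ent_mk. Qed.

Lemma tmap_lin v (k : K) (f g : fam E (oproj K v)) :
  tmap (fun x => k *: f x + g x) = k *: tmap f + tmap g.
Proof.
apply: ent_ext => z x lz lx; have -> : z = 0%N by lia.
rewrite entD entZ !ent_tmap (lx : x < nd v)%N.
exact: pairing_lin.
Qed.

(** Left multiplication by a in the explicit projectives. *)
Definition lmul_model (a : arrow (op Q)) :
    fam (oproj K (@tgt (op Q) a)) (oproj K (@src (op Q) a)) :=
  fun w => align K (is_inl a) (bd (@tgt (op Q) a) w) (bd (@src (op Q) a) w).

Lemma align0l st st' l r l' : align K st 0 l *m align K st' l r =
   align K st' 0 l' *m align K st l' r.
Proof. by apply/matrixP=> -[]. Qed.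

Lemma hom_lmul_model a : is_hom (lmul_model a).
Proof.
move=> b; rewrite /lmul_model /=.
have lv := vertex_le (@src Q a).
rewrite !(val_src hp hq) !(val_tgt hp hq).
have mono := oproj_dim_mono hp hq hpq (@src Q a) b; rewrite (val_src hp hq) in mono.
have lb' : (arrow_to b <= s)%N.
  by have := vertex_le (@tgt Q b); rewrite (val_tgt hp hq).
have anti := oproj_dim_anti hp hq hpq a lb'.
have lb : (arrow_from b <= s)%N.
  by have := vertex_le (@src Q b); rewrite (val_src hp hq).
have la : (arrow_from a <= s)%N by rewrite -(val_src hp hq).
case Ea: (is_inl a); case Eb: (is_inl b).
- by rewrite !align_mul ?anti ?mono.
- rewrite (@oproj_dim_other _ _ hp hq hpq a b) ?Ea ?Eb //; exact: align0l.
- rewrite (@oproj_dim_other _ _ hp hq hpq a b) ?Ea ?Eb //; exact: align0l.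
- by rewrite !align_mul ?anti ?mono.
Qed.

Lemma lmul_model_gen (a : arrow (op Q)) :
  oproj_gen K (tgt a) *m lmul_model a (tgt a) =
  oproj_gen K (src a) *m act (oproj K (@src (op Q) a)) a.
Proof.
rewrite /lmul_model /=.
have d1 (v : vertex (op Q)) : bd v v = 1%N by apply: oproj_dim1.
have E1 (v : vertex (op Q)) y : ent (oproj_gen K v) 0 y = (y == 0)%N%:R.
  have [->|y0] := posnP y; last by rewrite ent_col_out ?gtn_eqF // dim_aligned d1.
  have lt : (0 < dim (oproj K v) v)%N by rewrite dim_aligned d1.
  rewrite -[X in ent _ X _]/(val (0 : 'I_1)) -[X in ent _ _ X]/(val (Ordinal lt)).
  by rewrite ent_ord mxE.
apply: ent_ext => z y lz ly; have {lz} -> : z = 0%N by lia.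
by rewrite !ent_mul_align ly !E1 !d1.
Qed.

(** For v other than 0 no nonzero map factors through the cover, which is
    generated at 0 where P_v vanishes. *)
Lemma tmap_faithful (v : vertex (op Q)) (f : fam E (oproj K v)) :
  v != 0%N :> nat -> is_hom f -> tmap f = 0 -> forall w, f w = 0.
Proof.
move=> v0 hf z; have lv := vertex_le v.
have b1 : bd v s = 1%N by rewrite (oproj_dim_s hp hq hpq) (negPf v0).
have zx x : (x < nd v)%N -> ent (f sv) (x + shift v) 0 = 0.
  move=> lx; have := congr1 (fun A => ent A 0 x) z.
  rewrite ent_tmap lx ent0 /pairing (ent_col_out _ _ (y := 1)) ?if_same ?addr0 //.
  by rewrite dim_aligned (val_op_sink hp hq hpq) b1.
have zk k : ent (f sv) k 0 = 0.
  have [lk|lk] := ltnP k n.+2; last first.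
    by rewrite ent_row_out // dim_aligned (val_op_sink hp hq hpq) syz_dim_s.
  have [l1|l1] := ltnP k (shift v).
    have [k0 iq] : k = 0%N /\ (i.+1 < q)%N by move: l1; rewrite /shift; split_ifs; lia.
    rewrite k0 (syz_hom_first hf) // b1 add0n ltnS leqn0.
    by move: l1; rewrite /shift /oproj_dim; split_ifs; lia.
  have [l2|l2] := ltnP (k - shift v) (nd v).
    by have := zx _ l2; rewrite subnK.
  have [k0 jp] : k = n.+1 /\ (j.+1 < p)%N.
    move: l1 l2; rewrite /shift /string_dim /next_n /next_i /next_j.
    by split_ifs; lia.
  rewrite k0 (syz_hom_last hf) //.
  move: l1 l2; rewrite k0 /shift /string_dim /next_n /next_i /next_j /oproj_dim.
  by split_ifs; lia.
move=> w; have lw := vertex_le w; apply: ent_ext => x y lx ly; rewrite ent0.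
move: (lx : (x < zd w)%N) (ly : (y < bd v w)%N) => {}lx {}ly.
have [ws|ws] := eqVneq (w : nat) s.
  have -> : w = sv by apply: val_inj; rewrite /= ws (val_op_sink hp hq hpq).
  by move: ly; rewrite ws b1 ltnS leqn0 => /eqP->.
have bw : bd v w = 1%N by move: ly; rewrite /oproj_dim; split_ifs; lia.
have {ly} -> : y = 0%N by lia.
have [wp|wp] := ltnP w p.
  have [x0 jw] : x = 0%N /\ (j < w)%N by move: lx; rewrite syz_dim_p //; lia.
  by rewrite x0 -(@syz_hom_p v w f 0 hf) ?jw ?b1.
have pw : (p <= w < s)%N by lia.
have [x0 iw] : x = 0%N /\ (i <= w - p)%N by move: lx; rewrite syz_dim_q //; lia.
have := @syz_hom_q v w f 0 hf pw iw.
by rewrite b1 bw zk x0 add0n subnn => /(_ isT) /esym.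
Qed.

Lemma tmap_ker0 (v : vertex (op Q)) (f : fam E (oproj K v)) :
    v = 0%N :> nat -> is_hom f -> tmap f = 0 ->
  exists g : fam (top_cover K p q n) (oproj K v),
    is_hom g /\ forall w, f w = syz_map w *m g w.
Proof.
move=> v0 hf z; set A := f sv.
have b2 : bd v s = 2%N by rewrite (oproj_dim_s hp hq hpq) v0.
have bw w : (w < s)%N -> bd v w = 1%N.
  by move=> lw; rewrite /oproj_dim v0 (ltn_eqF lw).
have zx x : (x < nd v)%N -> pairing A (x + shift v) = 0.
  by move=> lx; have := congr1 (fun A => ent A 0 x) z; rewrite ent_tmap lx ent0.
have outA k y : (n.+2 <= k)%N -> ent A k y = 0.
  by move=> lk; rewrite ent_row_out // dim_aligned (val_op_sink hp hq hpq) syz_dim_s.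
have sh : shift v = (i.+1 < q)%N by rewrite /shift v0 hp.
have nv : nd v = next_n.+1 by rewrite /string_dim v0 hp addn1.
have A1 k : (k <= n)%N -> ent A k 1 = - ent A k.+1 0.
  move=> lk; have := zx (k.+1 - shift v)%N.
  rewrite nv subnK; last by rewrite sh; lia.
  rewrite /pairing /= => H; apply/eqP; rewrite -addr_eq0 addrC H //.
  by rewrite sh /next_n; lia.
have A00 : ent A 0 0 = 0.
  have [iq|iq] := ltnP i.+1 q.
    rewrite (syz_hom_first hf) // b2 v0 /oproj_dim /=.
    by case: eqP => //; lia.
  have sh0 : shift v = 0%N by rewrite sh; lia.
  by have := zx 0%N; rewrite nv sh0 /pairing /= addr0 => ->.
have An1 : ent A n.+1 1 = 0.
  have [jp|jp] := ltnP j.+1 p.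
    rewrite (syz_hom_last hf) // v0 /oproj_dim /=.
    by case: eqP => //; lia.
  have := zx (n.+2 - shift v)%N; rewrite subnK; last by rewrite sh; lia.
  rewrite nv /pairing /= outA // add0r => -> //.
  by rewrite sh /next_n; lia.
(* The first column of A prescribes the images of the generators of the cover;
   the second column then agrees because the pairings vanish. *)
pose G (w x y : nat) : K :=
  if w == s then
    (if (x <= n)%N then (if y == 0%N then ent A x.+1 0 else 0)
     else if y == 1%N then ent A (x - n) 0 else 0)
  else ent A x.+1 0.
pose g : fam (top_cover K p q n) (oproj K v) :=
  fun w => mkmx (td w) (bd v w) (G w).
have hg : is_hom g.
  apply/hom_alignedP => a x y.
  rewrite !ent_mk !dim_aligned !(val_op_src hp hq a) !(val_op_tgt hp hq a).
  have pa := arrowP hp hq a; have la := arrow_from_lt hp hq a.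
  have lf : (arrow_from a <= s)%N by rewrite -(val_op_tgt hp hq a); exact: vertex_le.
  rewrite (bw (arrow_to a)) ?(@top_dim_lt (arrow_to a)); try lia.
  have Gs x' y' : G s x' y' = (if (x' <= n)%N then (if y' == 0%N then ent A x'.+1 0 else 0)
     else if y' == 1%N then ent A (x' - n) 0 else 0) by rewrite /G eqxx.
  have Gn w x' y' : (w < s)%N -> G w x' y' = ent A x'.+1 0.
    by move=> lw; rewrite /G (ltn_eqF lw).
  have lt := leq_trans la lf; rewrite !(Gn (arrow_to a)) //.
  have [fs|fs] := eqVneq (arrow_from a) s; last first.
    have lfs : (arrow_from a < s)%N by lia.
    rewrite bw // top_dim_lt // => lx ly; rewrite !Gn // addnK.
    have {ly} -> : y = 0%N by lia.
    by rewrite add0n subnn leq_addl lx; case: (is_inl a).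
  rewrite fs b2 top_dim_s // => lx ly.
  have [l1 l2] : (x < n.+1 + n.+1)%N /\ (x <= n)%N by lia.
  have l3 : (n < x + (n.+1 + n.+1))%N by lia.
  have l4 : (x + (n.+1 + n.+1) - n.+1 = x + n.+1)%N by lia.
  have l5 : (x + n.+1 < n.+1 + n.+1)%N by lia.
  have l6 : (x + n.+1 <= n)%N = false by lia.
  have l7 : (x + n.+1 - n)%N = x.+1 by lia.
  rewrite !Gs l1 l2 l3 l4 l5 l6 l7 ly lx.
  by case: (is_inl a) => /=; case: y ly => [|[|y]].
exists g; split=> // w; have lw := vertex_le w.
apply: ent_ext => x y lx ly; move: (lx : (x < zd w)%N) (ly : (y < bd v w)%N).
have [ws|ws] := eqVneq (w : nat) s.
  have ew : w = sv by apply: val_inj; rewrite /= ws (val_op_sink hp hq hpq).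
  have fA : ent (f w) x y = ent A x y by rewrite ew.
  have zw : zd w = n.+2 by rewrite ws syz_dim_s.
  have tw : td w = (n.+1 + n.+1)%N by rewrite ws top_dim_s.
  have bw' : bd v w = 2%N by rewrite ws.
  rewrite fA (@syz_map_sE w ws) mulmxBl entD entN !ent_diag_mul.
  have dE : dim E w = n.+2 := zw; have dB : dim (oproj K v) w = 2%N := bw'.
  have dT : dim (top_cover K p q n) w = (n.+1 + n.+1)%N := tw.
  rewrite !ent_mk dE dB dT zw bw' ws => {fA} {}lx {}ly.
  have Gs x' y' : G s x' y' = (if (x' <= n)%N then (if y' == 0%N then ent A x'.+1 0 else 0)
     else if y' == 1%N then ent A (x' - n) 0 else 0) by rewrite /G eqxx.
  rewrite !Gs lx ly subn0 leq0n.
  have l2 : (x + n.+1 <= n)%N = false by lia.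
  have l3 : (x + n.+1 - n)%N = x.+1 by lia.
  have l4 : (x + n.+1 < n.+1 + n.+1)%N = (x <= n)%N by lia.
  have l5 : (n.+1 < x + n.+1)%N = (0 < x)%N by lia.
  have l6 : (x + n.+1 - n.+2)%N = x.-1 by lia.
  have l7 : (x.-1 < n.+1 + n.+1)%N by lia.
  have l8 : (x.-1 <= n)%N by lia.
  rewrite l2 l3 l4 l5 l6 l7 l8 /=.
  case: y ly => [|[|//]] _ /=.
    by rewrite if_same subr0; case: x lx {l2 l3 l4 l5 l6 l7 l8} => [|x].
  rewrite if_same sub0r; have [xn|xn] := leqP x n; first by rewrite A1.
  by rewrite oppr0 (_ : x = n.+1) //; lia.
move=> {}lx {}ly; have {}bw : bd v w = 1%N by rewrite bw; lia.
move: ly; rewrite bw; case: y => // _.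
have [wp|wp] := ltnP w p.
  have zw : zd w = (j < w)%N by rewrite syz_dim_p.
  have tw : td w = n.+1 by rewrite top_dim_lt //; lia.
  have [x0 jw] : x = 0%N /\ (j < w)%N by lia.
  have dE : dim E w = 1%N by rewrite -[LHS]/(zd w) zw jw.
  have dB : dim (oproj K v) w = 1%N := bw.
  have dT : dim (top_cover K p q n) w = n.+1 := tw.
  rewrite x0 -(@syz_hom_p v w f 0 hf) ?jw ?b2 //.
  rewrite (@syz_map_pE w wp) ent_diag_mul ent_mk dE dB dT.
  have ws2 : (w < s)%N by lia.
  by rewrite add0n subn0 leq0n !ltnSn /G (ltn_eqF ws2).
have pw : (p <= w < s)%N by lia.
have zw : zd w = (i <= w - p)%N by rewrite syz_dim_q.
have tw : td w = n.+1 by rewrite top_dim_lt //; lia.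
have [x0 iw] : x = 0%N /\ (i <= w - p)%N by lia.
have dE : dim E w = 1%N by rewrite -[LHS]/(zd w) zw iw.
have dB : dim (oproj K v) w = 1%N := bw.
have dT : dim (top_cover K p q n) w = n.+1 := tw.
have := @syz_hom_q v w f 1 hf pw iw.
rewrite b2 bw -/A A1 // subnn => /(_ isT) e.
have {}e : - ent A 1 0 = ent (f w) 0 0 by [].
rewrite x0 -e.
rewrite (@syz_map_qE w pw) mulNmx entN ent_diag_mul ent_mk.
by rewrite dE dB dT /= /G (negPf ws).
Qed.

Lemma tmap_relation (v : vertex (op Q)) (g : fam (top_cover K p q n) (oproj K v)) :
  is_hom g -> tmap (fun x => syz_map x *m g x) = 0.
Proof.
move=> hg; have lv := vertex_le v.
apply: ent_ext => z x lz lx; have {lz} -> : z = 0%N by lia.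
rewrite ent0 ent_tmap; case: ifP => // _; move: (x + _)%N => {lx}x.
have zs : zd s = n.+2 by apply: syz_dim_s.
have ts := top_dim_s.
have vs : sv = s :> nat := val_op_sink hp hq hpq.
have dE : dim E sv = n.+2 by rewrite -[LHS]/(zd sv) vs.
have A k y : ent (syz_map sv *m g sv) k y =
    (if (0 < k < n.+2)%N then ent (g sv) k.-1 y else 0)
    - (if (k < n.+2)%N then ent (g sv) (k + n.+1) y else 0).
  rewrite (@syz_map_sE sv vs) mulmxBl entD entN !ent_diag_mul.
  rewrite ?dE leq0n subn0 andbT.
  congr (_ - _); rewrite andbC (_ : (n.+1 < k + n.+1)%N = (0 < k)%N); last by lia.
  by case: ifP => // _; congr (ent _ _ _); lia.
have bs := oproj_dim_s hp hq hpq v.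
have [|a [ia ta]] := @inl_arrow_into p q 0; first lia.
have [|b [ib fb]] := @inr_arrow_from p q hp hq p; first lia.
have tb : arrow_to b = 0%N.
  by have := arrowP hp hq b; rewrite ib fb eqxx => -[[//]|[_ [_ ->]]].
have eab : @src (op Q) b = @src (op Q) a.
  by apply: val_inj; rewrite /= !val_tgt // ta tb.
have Hp k y : (k <= n)%N -> (y < bd v s)%N ->
    ent (g sv) k y = ent (g (@src (op Q) a)) k y.
  by move=> *; apply: (top_hom_p hg).
have Hq k y : (k <= n)%N -> (y < bd v s)%N -> ent (g sv) (k + n.+1) y =
    if (bd v s <= y + bd v 0)%N
    then ent (g (@src (op Q) a)) k (y + bd v 0 - bd v s) else 0.
  by move=> lk ly; rewrite (top_hom_q hg ib) // tb eab.
have b0 : bd v 0 = (v == 0%N :> nat).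
  by rewrite /oproj_dim; split_ifs; lia.
have bsv y : (bd v s <= y)%N -> forall k, ent (g sv) k y = 0.
  by move=> ly k; rewrite ent_col_out // dim_aligned vs.
have ba y : (bd v 0 <= y)%N -> forall k, ent (g (@src (op Q) a)) k y = 0.
  by move=> ly k; rewrite ent_col_out // dim_aligned val_op_src // ta.
pose c k := ent (g (@src (op Q) a)) k 0.
have P0 k : (k <= n)%N -> ent (g sv) k 0 = c k by move=> lk; rewrite Hp // bs.
have P1 k : (k <= n)%N -> ent (g sv) k 1 = 0.
  move=> lk; have [l|l] := ltnP 1 (bd v s); last by rewrite bsv.
  by rewrite Hp // ba // b0; case: (_ == _).
have Q0 k : (k <= n)%N -> ent (g sv) (k + n.+1) 0 = 0.
  move=> lk; rewrite Hq ?bs // b0; case: (_ == _) => //.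
have Q1 k : (k <= n)%N -> ent (g sv) (k + n.+1) 1 = c k.
  move=> lk; have [l|l] := ltnP 1 (bd v s).
    by rewrite Hq // bs b0; move: l; rewrite bs; case: (_ == _).
  by rewrite bsv // /c ba // b0; move: l; rewrite bs; case: (_ == _).
have out y : ent (g sv) (n.+1 + n.+1) y = 0.
  by rewrite ent_row_out // dim_aligned vs ts.
have [xn|xn] := ltnP n.+2 x.
  have l1 : (x < n.+2)%N = false by lia.
  have l2 : (x.-1 < n.+2)%N = false by lia.
  by rewrite /pairing !A l1 l2 !andbF !subrr if_same addr0.
have Q0' k : (k <= n.+1)%N -> ent (g sv) (k + n.+1) 0 = 0.
  rewrite leq_eqVlt => /predU1P[->|lk]; [exact: out|exact: Q0].
rewrite /pairing !A; case: x xn => [|[|x]] xn.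
- by rewrite (Q0 0%N) // subr0 addr0.
- by rewrite /= P0 // Q0' // (Q1 0%N) // subr0 sub0r subrr.
have [xn'|xn'] := leqP n x.
  have -> : x = n by lia.
  by rewrite /= !ltnn ltnSn P1 // out !subr0 addr0.
have l1 : (x.+2 < n.+2)%N by lia.
have l2 : (x.+1 < n.+2)%N by lia.
rewrite /= l1 l2 P0 // Q0' ?(P1 x) ?(Q1 x.+1) //; try lia.
by rewrite subr0 sub0r subrr.
Qed.

Lemma tmap_surj (v : vertex (op Q)) (y : 'rV[K]_(dim next v)) :
  exists2 f : fam E (oproj K v), is_hom f & tmap f = y.
Proof.
have lv := vertex_le v; have bs := oproj_dim_s hp hq hpq v.
(* The coordinates are placed in the first column.  Only when v = 0 and the end
   on the first path reaches a new sink is there one more coordinate than rows,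
   and it goes to the second column. *)
pose F k z : K := if z == 0%N then (if (shift v <= k)%N then ent y 0 (k - shift v) else 0)
  else if [&& v == 0%N :> nat, k == n.+1 & j.+1 == p]
       then ent y 0 (n.+2 - shift v) else 0.
pose G (w x z : nat) : K := if w == s then F x z
  else if (w < p)%N then F n.+1 z else F 0%N (z + bd v s - bd v w)%N.
pose f : fam E (oproj K v) := fun w => mkmx (zd w) (bd v w) (G w).
have out z : (nd v <= z)%N -> ent y 0 z = 0 by move=> lz; rewrite ent_col_out.
have Z1 t z : (j < t < p)%N -> (bd v t <= z)%N -> F n.+1 z = 0.
  move=> jt bz; rewrite /F; case: eqP => [z0|_]; last first.
    by case: ifP => // /and3P[_ _ /eqP]; lia.
  case: ifP => // ls; apply: out; move: bz ls; rewrite z0.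
  by rewrite /shift /oproj_dim /string_dim /next_n /next_i /next_j; split_ifs; lia.
have Z2 t z : (p <= t < s)%N -> (i <= t - p)%N -> (z + bd v t < bd v s)%N -> F 0%N z = 0.
  move=> jt it bz; rewrite /F; case: eqP => [z0|_]; last by rewrite andbF.
  case: ifP => // ls; move: bz ls; rewrite z0.
  by rewrite /shift /oproj_dim; split_ifs; lia.
exists f.
  apply/hom_alignedP => a x z.
  rewrite !ent_mk !dim_aligned !(val_op_src hp hq a) !(val_op_tgt hp hq a).
  have pa := arrowP hp hq a; have la := arrow_from_lt hp hq a.
  have lf : (arrow_from a <= s)%N by rewrite -(val_op_tgt hp hq a); exact: vertex_le.
  have mono := oproj_dim_mono hp hq hpq v a.
  have monos t : (t <= s)%N -> (bd v t <= bd v s)%N.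
    by move=> lt; rewrite /oproj_dim; split_ifs; lia.
  have mf := monos _ lf.
  have Gp t x' z' : (t < p)%N -> G t x' z' = F n.+1 z'.
    by move=> tp; rewrite /G tp ltn_eqF //; lia.
  have Gq t z' : (p <= t <= s)%N -> (z' < bd v t)%N -> G t 0%N z' = F 0%N (z' + bd v s - bd v t)%N.
    move=> /andP[tp ts] lz'; rewrite /G ltnNge tp /=; case: eqP => // ->.
    by rewrite addnK.
  case: pa => [[-> [lt e]]|[-> [lt e]]]; rewrite /negb => lx lz.
    have [x0 jt] : x = 0%N /\ (j < arrow_to a)%N by move: lx; rewrite syz_dim_p //; lia.
    have zt : zd (arrow_to a) = 1%N by rewrite syz_dim_p // jt.
    rewrite x0 zt lz (@Gp (arrow_to a)) // !add0n andbT.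
    have -> : G (arrow_from a) (zd (arrow_from a) - 1)%N z = F n.+1 z.
      move: e; case: ifP => l1 e; first by rewrite Gp // e.
      by rewrite e /G eqxx syz_dim_s // subn1.
    have lzf : (zd (arrow_from a) - 1 < zd (arrow_from a))%N.
      move: e; case: ifP => l1 e; first by rewrite syz_dim_p ?e //; lia.
      by rewrite e syz_dim_s //; lia.
    have lzf' : (0 < zd (arrow_from a))%N by lia.
    rewrite lzf lzf' /=; case: ifP => // lz'.
    by rewrite (@Z1 (arrow_to a)) ?jt //; lia.
  have tp : (p <= arrow_to a < s)%N.
    move: lx e; case: ifP => [_ lx e|fp _ ->]; last by lia.
    by move: lx; rewrite e syz_dim_p.
  have [x0 it] : x = 0%N /\ (i <= arrow_to a - p)%N by move: lx; rewrite syz_dim_q //; lia.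
  have zt : zd (arrow_to a) = 1%N by rewrite syz_dim_q // it.
  have zf : (0 < zd (arrow_from a))%N.
    have [fs|fs] := eqVneq (arrow_from a) s; first by rewrite fs syz_dim_s.
    by rewrite syz_dim_q //; lia.
  rewrite x0 zt zf lz /= Gq //; last by lia.
  case: ifP => l1; last by rewrite (@Z2 (arrow_to a)) //; lia.
  have l2 : (z + bd v (arrow_to a) - bd v (arrow_from a) < bd v (arrow_to a))%N by lia.
  have mt : (bd v (arrow_to a) <= bd v s)%N by lia.
  by rewrite l2 Gq //; [congr (F _ _)|]; lia.
have vs : sv = s :> nat := val_op_sink hp hq hpq.
apply: ent_ext => x c lx lc; have {lx} -> : x = 0%N by lia.
rewrite ent_tmap (lc : (c < nd v)%N) /pairing !ent_mk !dim_aligned vs syz_dim_s //.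
have Gs x' z' : G s x' z' = F x' z' by rewrite /G eqxx.
rewrite !Gs bs /=.
have [lk|lk] := ltnP (c + shift v) n.+2.
  rewrite /F /= leq_addl addnK -[RHS]addr0; congr (_ + _).
  case: ifP => // _; case: ifP => // _; case: ifP => // /and3P[_ /eqP]; lia.
have [ck [v0 jp]] : (c + shift v = n.+2)%N /\ v = 0%N :> nat /\ j.+1 = p.
  move: lk (lc : (c < nd v)%N).
  by rewrite /shift /string_dim /next_n /next_i /next_j; split_ifs; lia.
have v0b : (v == 0%N :> nat) = true by rewrite v0.
have jpb : (j.+1 == p) = true by rewrite jp eqxx.
rewrite add0r ck /= ltnSn v0b /= /F /= v0b jpb eqxx /=.
by congr (ent _ _ _); lia.
Qed.

Lemma tmap_natural (a : arrow Q) (f : fam E (oproj K (src a))) : is_hom f ->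
  tmap (fun x => f x *m @lmul_model a x) =
  tmap f *m act next a.
Proof.
move=> hf; have vs : sv = s :> nat := val_op_sink hp hq hpq.
apply: ent_ext => z x lz lx; have {lz} -> : z = 0%N by lia.
have lx' : (x < nd (@tgt Q a))%N := lx.
rewrite ent_mul_align lx !ent_tmap lx' /pairing.
have A k y : ent (f sv *m @lmul_model a sv) k y =
  if (y < bd (arrow_to a) s)%N then
    if is_inl a then ent (f sv) k y
    else if (bd (arrow_to a) s <= y + bd (arrow_from a) s)%N
      then ent (f sv) k (y + bd (arrow_from a) s - bd (arrow_to a) s) else 0
  else 0.
  have e1 : bd (@src (op Q) a) sv = bd (arrow_to a) s by rewrite val_op_src // vs.
  have e2 : bd (@tgt (op Q) a) sv = bd (arrow_from a) s by rewrite val_op_tgt // vs.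
  by rewrite -e1 -e2 /lmul_model ent_mul_align.
have lf : (arrow_from a <= s)%N by rewrite -(val_src hp hq a); exact: vertex_le.
have la := arrow_from_lt hp hq a.
have bf : bd (arrow_from a) s = 1%N by rewrite /oproj_dim; split_ifs; lia.
have bt : bd (arrow_to a) s = (arrow_to a == 0%N).+1.
  by rewrite /oproj_dim; split_ifs; lia.
have out k : ent (f sv) k 1 = 0.
  by rewrite ent_col_out // dim_aligned vs (val_src hp hq a) bf.
have pf k : pairing (f sv) k = ent (f sv) k 0.
  by rewrite /pairing out if_same addr0.
have ds : dim next (@src Q a) = nd (arrow_from a).
  by rewrite dim_aligned val_src.
have dt : dim next (@tgt Q a) = nd (arrow_to a).
  by rewrite dim_aligned val_tgt.
rewrite val_tgt // in lx'.
have first0 : (i.+1 < q)%N -> bd (arrow_from a) (p + i) = 0%N -> ent (f sv) 0 0 = 0.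
  move=> iq b0; apply: (syz_hom_first hf iq).
  by rewrite (val_src hp hq a) bf b0.
have last0 : (j.+1 < p)%N -> bd (arrow_from a) j.+1 = 0%N -> ent (f sv) n.+1 0 = 0.
  move=> jp b0; apply: (syz_hom_last hf jp).
  by rewrite (val_src hp hq a) b0.
have outr k y : (n.+2 <= k)%N -> ent (f sv) k y = 0.
  by move=> lk; rewrite ent_row_out // dim_aligned vs syz_dim_s.
rewrite !A bf bt ds dt !(val_src hp hq a) !(val_tgt hp hq a).
rewrite !out !if_same !addr0.
case: (arrowP hp hq a) => [[ia [lt e]]|[ia [lt e]]]; rewrite ia.
  rewrite !if_same addr0.
  have -> : shift (arrow_from a) = shift (arrow_to a).
    by rewrite /shift lt; move: e; case: ifP => l1 ->; [rewrite l1|split_ifs; lia].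
  case: ifP => // lxf.
  have [l1|l1] := ltnP (x + shift (arrow_to a)) n.+2; last exact: outr.
  have [k1 [jp fj]] : (x + shift (arrow_to a) = n.+1)%N /\ (j.+1 < p)%N /\ (j.+1 < arrow_from a)%N.
    move: l1 lxf lx'; rewrite /shift /string_dim /next_n /next_i /next_j lt.
    by split_ifs; lia.
  rewrite k1; apply: last0 => //.
  by rewrite /oproj_dim; split_ifs; lia.
have -> : (0 < (arrow_to a == 0).+1)%N by [].
rewrite add0n addn1; have [t0|t0] := eqVneq (arrow_to a) 0%N.
  have -> : (1 < (true : nat).+1)%N by [].
  have -> : ((true : nat) < 1)%N = false by [].
  rewrite add0r t0.
  have fp : arrow_from a = p by move: e; rewrite t0; case: eqP => //; lia.
  have -> : shift (arrow_from a) = 0%N by rewrite fp /shift ltnn subnn.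
  rewrite fp addn0 subnn.
  have np : nd p = (next_n + (0 < next_i))%N by rewrite /string_dim ltnn subnn.
  have n0 : nd 0 = next_n.+1 by rewrite /string_dim hp addn1.
  have s0 : shift 0 = (i.+1 < q)%N by rewrite /shift hp.
  rewrite t0 n0 in lx'; rewrite np n0 s0.
  have [i0|i0] := posnP next_i.
    have sq : (i.+1 < q)%N = false.
      by move: i0; rewrite /next_i; case: eqP => // <-; rewrite ltnn.
    rewrite sq !addn0; case: ifP => l1; case: ifP => l2; try lia.
      by rewrite ifT; [congr (ent _ _ _)|]; lia.
    by [].
  have sq : (i.+1 < q)%N by move: i0; rewrite /next_i; case: eqP => //; lia.
  rewrite sq !addn1 /= leq_addl addnK lx'.
  by [].
have -> : (1 < (false : nat).+1)%N = false by [].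
have -> : ((false : nat) < 1)%N by [].
rewrite if_same addr0 subnn.
have [pt ft] : (p <= arrow_to a)%N /\ arrow_from a = (arrow_to a).+1.
  by move: e t0; case: eqP => [_ -> /eqP|fp e _]; lia.
case: ifP => l1.
  rewrite ifT; last by lia.
  congr (ent _ _ _); move: l1; rewrite ft /shift /string_dim /next_n /next_i /next_j.
  by split_ifs; lia.
have [ti x0] : (arrow_to a - p = i)%N /\ x = 0%N /\ (i.+1 < q)%N.
  move: l1 lx'; rewrite ft /string_dim /next_n /next_i /next_j.
  by split_ifs; lia.
case: x0 => -> iq.
have -> : (0 + shift (arrow_to a) = 0)%N by rewrite /shift ltnNge pt /= ti ltnn.
apply: first0 => //; rewrite ft /oproj_dim; split_ifs; lia.
Qed.

(** The explicit presentation of the dual, with the explicit projectives, makes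
    the transpose the cokernel computed by [tmap]. *)
Lemma is_tauinv_string :
  is_tauinv (string K p q n i j) next.
Proof.
apply: (is_transpose_isom_l (isom_dual_aligned K _ _)).
apply: (@is_transpose_of_models K Q _ (op_dep hp hq) (@op_dep_bound p q) _ _ _ _
  _ _ (@oproj K p q) (@oproj_gen K p q) lmul_model tmap
  string_presentation).
- by move=> v; apply: oproj_free.
- by move=> a; apply: (hom_lmul_model).
- by move=> a; apply: (lmul_model_gen).
- by move=> *; apply: tmap_lin.
- exact: tmap_surj.
- move=> v f hf z; have [v0|v0] := eqVneq (v : nat) 0%N.
    exact: (tmap_ker0).
  exists (fun=> 0); split; first exact: hom0.
  by move=> x; rewrite (tmap_faithful v0 hf z) mulmx0.
- exact: tmap_relation.
- exact: tmap_natural.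
Qed.

End TransposeOfString.

(** * Postprojective modules as strings *)

Section Postprojectives.
Variables (K : fieldType) (p q : nat).
Hypotheses (hp : (0 < p)%N) (hq : (0 < q)%N) (hpq : (1 < p + q)%N).
Local Notation Q := (Atilde p q).
Local Notation s := (p + q).-1.

(** The projective at v is the string from a single sink that climbs this many
    steps up the path of q arrows and [level_p v] up the path of p arrows; at
    the source the first climb is complete and counts q steps. *)
Definition level_q (v : nat) : nat := if v < p then 0 else (v - p).+1.
Definition level_p (v : nat) : nat := if v < p then v else 0.

(** The string whose ends have grown by k and by l steps from a single sink: each
    completed path contributes a copy of the sink. *)
Definition grown k l : rep K Q := string K p q (k %/ q + l %/ p) (k %% q) (l %% p).

(** The number of paths from v to w. *)
Definition proj_dim (v w : nat) : nat :=
  if v < p then nat_of_bool ((w < p) && (w <= v))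
  else if v < s then nat_of_bool (if w < p then w == 0 else w <= v)
  else 1 + (w == 0).

Lemma string_dim_proj (v w : nat) : v <= s -> w <= s ->
  string_dim p (level_q v %/ q + level_p v %/ p) (level_q v %% q) (level_p v %% p) w
  = proj_dim v w.
Proof.
move=> lv lw; rewrite /level_q /level_p /string_dim /proj_dim.
case: (ltnP v p) => vp.
  by rewrite !div0n mod0n divn_small // modn_small //; split_ifs; lia.
rewrite div0n mod0n addn0; case: (ltnP v s) => vs.
  have lt : (v - p).+1 < q by lia.
  by rewrite divn_small // modn_small //; split_ifs; lia.
have -> : (v - p).+1 = q by lia.
by rewrite divnn hq modnn; split_ifs; lia.
Qed.

Definition proj_model (v : vertex Q) : rep K Q :=
  @aligned K Q (@is_inl p q) (proj_dim v).

Lemma isom_aligned (Q' : quiver) st (d d' : vertex Q' -> nat) :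
  (forall v, d v = d' v) -> isom (@aligned K Q' st d) (@aligned K Q' st d').
Proof.
move=> e; have -> : d = d' by apply: functional_extensionality_dep.
exact: isom_refl.
Qed.

Lemma isom_proj_model (v : vertex Q) :
  isom (proj_model v) (grown (level_q v) (level_p v)).
Proof.
apply: isom_aligned => w; rewrite string_dim_proj //; exact: vertex_le.
Qed.

Definition Q_dep (v : vertex Q) : nat := s - v.

Lemma Q_dep_lt (a : arrow Q) : Q_dep (src a) < Q_dep (tgt a).
Proof.
rewrite /Q_dep !(val_src hp hq) !(val_tgt hp hq); have := arrow_from_lt hp hq a.
by have := vertex_le (@src Q a); rewrite (val_src hp hq); lia.
Qed.

Lemma Q_dep_bound (v : vertex Q) : Q_dep v < #|vertex Q|.
Proof. by rewrite card_ord /Q_dep; lia. Qed.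

Lemma proj_dim_gen (v : vertex Q) : proj_dim v v = 1.
Proof. by have := vertex_le v; rewrite /proj_dim; split_ifs; lia. Qed.

Lemma proj_dim_mono (v : vertex Q) (a : 'I_p + 'I_q) :
  proj_dim v (arrow_from a) <= proj_dim v (arrow_to a).
Proof.
have lv := vertex_le v.
by have := arrowP hp hq a; rewrite /proj_dim; split_ifs; lia.
Qed.

Lemma proj_model_forest (v : vertex Q) :
  forest_basis (proj_model v)
    (@aligned_parent Q (@is_inl p q) (fun w => proj_dim v w)).
Proof.
have lv := vertex_le v.
apply: aligned_forest => [a|a b y].
  by rewrite val_src // val_tgt // proj_dim_mono.
rewrite /covers; move/(congr1 val); rewrite /= !val_src // !val_tgt // => e.
have D (a' b' : 'I_p + 'I_q) : is_inl a' -> is_inl b' = false ->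
    arrow_to a' = arrow_to b' -> y < proj_dim v (arrow_to a') ->
    y < proj_dim v (arrow_from a') ->
    proj_dim v (arrow_to b') <= y + proj_dim v (arrow_from b') -> False.
  move=> ia ib; have := arrowP hp hq a'; have := arrowP hp hq b'.
  rewrite ia ib => pb pa e'.
  have [ta [fa fb]] : arrow_to a' = 0 /\
      (1 <= arrow_from a') && ((arrow_from a' < p) || (arrow_from a' == s)) /\
      (p <= arrow_from b' <= s).
    by move: pa pb; rewrite -e'; split_ifs; lia.
  rewrite -e' ta; move: fa fb; rewrite /proj_dim; split_ifs; lia.
case Ea: (is_inl a); case Eb: (is_inl b) => ly ca cb.
- by apply: arrow_to_inj; rewrite ?Ea ?Eb.
- by case: (D a b); rewrite // ?e.
- by case: (D b a); rewrite // -?e.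
- by apply: arrow_to_inj; rewrite ?Ea ?Eb.
Qed.

Lemma proj_model_free (v : vertex Q) :
  free_at (const_mx 1%R : 'rV[K]_(dim (proj_model v) v)).
Proof.
have lt : 0 < dim (proj_model v) v by rewrite dim_aligned proj_dim_gen.
have -> : const_mx 1%R = delta_mx 0%R (Ordinal lt) :> 'rV[K]_(dim (proj_model v) v).
  apply/rowP=> j; rewrite !mxE eqxx /=; have := ltn_ord j; rewrite [X in _ < X]proj_dim_gen.
  by case: j => [[|j]].
have lv := vertex_le v.
apply: (forest_free_at Q_dep_lt (proj_model_forest v)) => [w y|]; last first.
  apply: aligned_root => // a /(congr1 val); rewrite val_src //= val_tgt // => <-.
  by have := arrowP hp hq a; have := arrow_from_lt hp hq a; rewrite /proj_dim; split_ifs; lia.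
have lw := vertex_le w; have ly : y < proj_dim v w by exact: ltn_ord.
move/aligned_parent_None => H.
suff : v = w :> nat.
  move=> vw; split; first exact/esym/val_inj.
  by move: ly; rewrite -vw proj_dim_gen /=; case: (y : nat).
apply/eqP; apply: contraT => nvw; suff : False by [].
have cov (a : 'I_p + 'I_q) : arrow_to a = w ->
  (if is_inl a then y < proj_dim v (arrow_from a)
   else proj_dim v w <= y + proj_dim v (arrow_from a)) -> False.
  move=> ta; have /H : @tgt Q a = w by apply: val_inj; rewrite /= val_tgt.
  by rewrite /covers val_src // val_tgt // ta => /negP.
have [ws|ws] := eqVneq (w : nat) s.
  by move: ly nvw lv; rewrite ws /proj_dim; split_ifs; lia.
have [wp|wp] := ltnP w p; last first.
  have [|b [ib fb]] := @inr_arrow_from p q hp hq w.+1; first lia.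
  have tb : arrow_to b = w.
    by have := arrowP hp hq b; rewrite ib fb => -[[//]|[_ [_ ->]]]; case: eqP; lia.
  case: (cov b tb); rewrite ib fb; move: ly nvw.
  by rewrite /proj_dim; split_ifs; lia.
have [a [ia ta]] := inl_arrow_into q wp.
have ca := cov a ta; rewrite ia in ca.
have [w0|w0] := posnP w; last first.
  apply: ca; have := arrowP hp hq a; rewrite ia ta => -[[_ [_ e]]|[//]].
  by move: e ly nvw; case: ifP => e1 ->; rewrite /proj_dim; split_ifs; lia.
have [|b [ib fb]] := @inr_arrow_from p q hp hq p; first lia.
have tb : arrow_to b = w.
  by have := arrowP hp hq b; rewrite ib fb eqxx => -[[//]|[_ [_ ->]]].
have cb := cov b tb; rewrite ib fb w0 in cb; rewrite w0 in ly nvw.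
have [l1|l1] := leqP (proj_dim v 0) (y + proj_dim v p); first exact: cb.
apply: ca; have := arrowP hp hq a; rewrite ia ta w0 => -[[_ [_ e]]|[//]].
move: e ly nvw l1; case: ifP => e1 ->; rewrite /proj_dim; split_ifs; lia.
Qed.

Lemma isom_proj_grown (v : vertex Q) :
  isom (@proj K Q v) (grown (level_q v) (level_p v)).
Proof.
have pf := @proj_free_at K Q _ Q_dep_lt Q_dep_bound v.
have [f [g [[hf hg] _ fg gf]]] := free_at_isom pf (@proj_model_free v).
by apply: isom_trans (isom_proj_model v); exists f, g.
Qed.

Lemma is_tauinv_grown k l : is_tauinv (grown k l) (grown k.+1 l.+1).
Proof.
have := is_tauinv_string K hp hq hpq (k %/ q + l %/ p) (ltn_pmod k hq) (ltn_pmod l hp).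
have E (m d : nat) : 0 < d -> ((m %% d).+1 == d) = (d %| m.+1).
  move=> d0; rewrite {2}(divn_eq m d) -addnS dvdn_addr ?dvdn_mull //.
  have lt := ltn_pmod m d0; apply/eqP/idP => [->//|dv].
  by apply/eqP; rewrite eqn_leq lt dvdn_leq.
rewrite /next_n /next_i /next_j !E // /grown !divnS // !modnS.
by rewrite (_ : (_ + _ + _ + _ = (q %| k.+1) + k %/ q + ((p %| l.+1) + l %/ p))%N) //; lia.
Qed.

Lemma is_tauinv_unique (M X X' : rep K Q) :
  is_tauinv M X -> is_tauinv M X' -> isom X X'.
Proof.
apply: is_transpose_unique => a.
exact: (@hom_lmul K (op Q) _ (op_dep hp hq) (@op_dep_bound p q) a).
Qed.

(** The class of an iterated translate depends only on the two growths. *)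
Lemma is_tauinv_iterP t (v : vertex Q) (X : rep K Q) :
  is_tauinv_iter t (@proj K Q v) X <->
  isom X (grown (level_q v + t) (level_p v + t)).
Proof.
elim: t X => [|t IH] X /=.
  rewrite !addn0; split=> iX.
    exact: isom_trans iX (isom_proj_grown v).
  exact: isom_trans iX (isom_sym (isom_proj_grown v)).
rewrite !addnS; split=> [[N [/IH iN NX]]|iX].
  apply: is_tauinv_unique (is_tauinv_grown _ _).
  exact: is_tauinv_isom iN (isom_refl X) NX.
exists (grown (level_q v + t) (level_p v + t)); split.
  by apply/IH; apply: isom_refl.
exact: is_tauinv_isom (isom_refl _) (isom_sym iX) (is_tauinv_grown _ _).
Qed.

End Postprojectives.

(** * Extensions as cocycles and the Euler form *)

Section Extensions.
Variables (K : fieldType) (Q : quiver).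
Local Open Scope ring_scope.
Implicit Types (M N X Y : rep K Q).

Definition cocycle X M := forall a : arrow Q, 'M[K]_(dim X (src a), dim M (tgt a)).

Definition coboundary X M (u : fam X M) : cocycle X M :=
  fun a => u (src a) *m act M a - act X a *m u (tgt a).

(** Path algebras are hereditary: an extension of X by M is an arbitrary choice
    of off-diagonal blocks for the arrows, and it splits when this choice is a
    coboundary. *)
Lemma ext1_vanishesP X M :
  ext1_vanishes X M <->
  forall c : cocycle X M, exists u : fam X M, forall a, c a = coboundary u a.
Proof.
split=> [H c|H E f g hf hg mf eg fg].
  pose E := @Rep K Q (fun v => (dim M v + dim X v)%N)
    (fun a => block_mx (act M a) 0 (c a) (act X a)).
  pose f : fam M E := fun v => row_mx 1%:M 0.
  pose g : fam E X := fun v => col_mx 0 1%:M.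
  have [||v|v|v|t [ht tg]] := H E f g.
  - by move=> a; rewrite mul_mx_row mul_row_block !mul1mx !mulmx1 !mul0mx mulmx0 !addr0.
  - by move=> a; rewrite mul_block_col mul_col_mx !mulmx0 !mulmx1 !mul0mx mul1mx !add0r.
  - by apply/row_freeP; exists (col_mx 1%:M 0); rewrite mul_row_col mul0mx addr0 mulmx1.
  - by apply/row_fullP; exists (row_mx 0 1%:M); rewrite mul_row_col mulmx0 add0r mulmx1.
  - apply/eqmxP/andP; split; first by apply/sub_kermxP; rewrite mul_row_col mulmx0 mul0mx addr0.
    have := mulmx_ker (g v); rewrite -[kermx _]hsubmxK mul_row_col mulmx0 add0r mulmx1 => ->.
    by apply/submxP; exists (lsubmx (kermx (g v))); rewrite mul_mx_row mulmx1 mulmx0.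
  exists (fun v => - lsubmx (t v)) => a.
  have := ht a; rewrite -[t (tgt a)]hsubmxK -[t (src a)]hsubmxK.
  rewrite mul_mx_row mul_row_block => /eq_row_mx[+ _].
  have -> : rsubmx (t (src a)) = 1%:M.
    by have := tg (src a); rewrite -[t _]hsubmxK mul_row_col mulmx0 add0r mulmx1 row_mxKr.
  rewrite mul1mx /coboundary mulmxN mulNmx opprK => ->.
  by rewrite addrA addNr add0r.
have [t tg] : exists t : fam X E, forall v, t v *m g v = 1%:M.
  by exists (fun v => pinvmx (g v)) => v; apply: mulVpmx.
pose d a := t (src a) *m act E a - act X a *m t (tgt a).
have dg a : d a *m g (tgt a) = 0.
  by rewrite /d mulmxBl -(mulmxA (t _)) -(mulmxA (act X a)) tg hg mulmxA tg mul1mx mulmx1 subrr.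
have fg0 v : f v *m g v = 0 by apply/sub_kermxP; rewrite fg.
have [u uE] := H (fun a => d a *m pinvmx (f (tgt a))).
have cf a : d a *m pinvmx (f (tgt a)) *m f (tgt a) = d a.
  by rewrite mulmxKpV // fg; apply/sub_kermxP.
exists (fun v => t v - u v *m f v); split=> [a|v]; last first.
  by rewrite mulmxBl tg -mulmxA fg0 mulmx0 subr0.
have := cf a; rewrite uE /coboundary mulmxBl -mulmxA hf /d.
rewrite mulmxBr mulmxBl !mulmxA.
set A := u (src a) *m f (src a) *m act E a; set U := act X a *m _ *m _ => e.
have -> : U = A - (t (src a) *m act E a - act X a *m t (tgt a)).
  by rewrite -e opprB addrC subrK.
by rewrite opprB addrA [_ + (_ - _)]addrC subrK.
Qed.

Section Euler.
Variables X M : rep K Q.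

Let I1 := {v : vertex Q & 'I_(dim X v) * 'I_(dim M v)}%type.
Let I2 := {a : arrow Q & 'I_(dim X (src a)) * 'I_(dim M (tgt a))}%type.
Let V1 := {ffun I1 -> K^o}.
Let V2 := {ffun I2 -> K^o}.

Definition family_of (F : V1) : fam X M :=
  fun v => \matrix_(i, j) F (Tagged (fun v => ('I_(dim X v) * 'I_(dim M v))%type) (i, j)).

Definition coboundary_ffun (F : V1) : V2 :=
  [ffun t : I2 => coboundary (family_of F) (tag t) (tagged t).1 (tagged t).2].

Lemma coboundary_ffun_linear : linear coboundary_ffun.
Proof.
move=> k F G; apply/ffunP=> t; rewrite !ffunE /coboundary.
have E v : family_of (k *: F + G) v = k *: family_of F v + family_of G v.
  by apply/matrixP=> i j; rewrite !mxE !ffunE.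
rewrite !E mulmxDl mulmxDr -scalemxAl -scalemxAr opprD addrACA -scalerBr.
by rewrite !mxE.
Qed.

HB.instance Definition _ := GRing.isLinear.Build K V1 V2 _ coboundary_ffun
  coboundary_ffun_linear.

Lemma dim_ffun_tagged (I : finType) (m n : I -> nat) :
  \dim {: {ffun {i : I & 'I_(m i) * 'I_(n i)}%type -> K^o}} = (\sum_i m i * n i)%N.
Proof.
rewrite dimvf -[LHS]/(#|{: {i : I & 'I_(m i) * 'I_(n i)}%type}| * 1)%N.
rewrite muln1 card_tagged sumnE big_map big_enum /=.
by apply: eq_bigr => i _; rewrite card_prod !card_ord.
Qed.

(** The Euler form computes dim Hom - dim Ext^1, so an upper bound on Hom that
    agrees with it forces Ext^1 to vanish.  The bound is the line through f0 when
    h holds, and zero otherwise. *)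
Lemma ext1_vanishes_of_euler (h : bool) (f0 : fam X M) :
    (forall f : fam X M, is_hom f -> exists k : K, forall v, f v = k *: (h%:R *: f0 v)) ->
    (\sum_v dim X v * dim M v = \sum_a dim X (src a) * dim M (tgt a) + h)%N ->
  ext1_vanishes X M.
Proof.
move=> hom euler; apply/ext1_vanishesP => c.
pose D : 'Hom(V1, V2) := linfun coboundary_ffun.
pose F0 : V1 := [ffun t : I1 => h%:R * f0 (tag t) (tagged t).1 (tagged t).2].
have kerD : (\dim (lker D) <= h)%N.
  have le : (lker D <= <[F0]>)%VS.
    apply/subvP => F; rewrite memv_ker lfunE /= => /eqP z.
    have hF : is_hom (family_of F).
      move=> a; apply/matrixP=> i j.
      have /ffunP/(_ (Tagged (fun a => ('I_(dim X (src a)) * 'I_(dim M (tgt a)))%type) (i, j))) := z.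
      rewrite !ffunE /coboundary /=.
      set A := _ *m _; set B := _ *m _ => e; apply/esym/eqP.
      by rewrite -subr_eq0 -e !mxE.
    have [k kE] := hom _ hF; apply/vlineP; exists k; apply/ffunP=> -[v [i j]].
    by have /matrixP/(_ i j) := kE v; rewrite !mxE !ffunE.
  apply: leq_trans (dimvS le) _; rewrite dim_vline.
  case Eh: h; first by case: (_ != 0).
  suff -> : F0 = 0 by rewrite eqxx.
  by apply/ffunP=> t; rewrite !ffunE Eh mul0r.
have full : limg D = fullv.
  apply/eqP; rewrite eqEdim subvf /= dim_ffun_tagged.
  have := limg_ker_dim D fullv; rewrite capfv dim_ffun_tagged euler; lia.
pose C : V2 := [ffun t : I2 => c (tag t) (tagged t).1 (tagged t).2].
have /memv_imgP[F _ FE] : C \in limg D by rewrite full; apply: memvf.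
exists (family_of F) => a; apply/matrixP=> i j.
have := congr1 (fun G : V2 => G (Tagged (fun a => ('I_(dim X (src a)) * 'I_(dim M (tgt a)))%type) (i, j))) FE.
by rewrite lfunE /= !ffunE.
Qed.

End Euler.
End Extensions.

(** * Orthogonality to a simple with one arrow in or out *)

Section Simples.
Variables (K : fieldType) (Q : quiver).
Local Open Scope ring_scope.
Implicit Types (M Y : rep K Q) (v w : vertex Q) (a b : arrow Q).
Local Notation S v := (@simple K Q v).

Lemma flat_rows m n (A B : 'M[K]_(m, n)) : m = 0%N -> A = B.
Proof. by move=> m0; apply/matrixP=> i; have := ltn_ord i; rewrite {2}m0. Qed.

Lemma flat_cols m n (A B : 'M[K]_(m, n)) : n = 0%N -> A = B.
Proof. by move=> n0; apply/matrixP=> i j; have := ltn_ord j; rewrite {2}n0. Qed.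

Lemma col_mulmx m n l (A : 'M[K]_(m, n)) (B : 'M[K]_(n, l)) j :
  col j (A *m B) = A *m col j B.
Proof. by rewrite !colE mulmxA. Qed.

Lemma dim_simple_neq v w : w != v -> dim (S v) w = 0%N.
Proof. by move=> /negPf /= ->. Qed.

Lemma simple_pt v : exists x : 'I_(dim (S v) v), True.
Proof.
have lt : (0 < dim (S v) v)%N by rewrite /= eqxx.
by exists (Ordinal lt).
Qed.

Lemma hom_from_simple M a : row_free (act M a) -> hom_vanishes (S (src a)) M.
Proof.
move=> fr f hf w; have [->|ne] := eqVneq w (src a); last first.
  by apply: flat_rows; apply: dim_simple_neq.
by apply: (row_free_inj fr); rewrite -hf /= !mul0mx.
Qed.

(** A vector in the kernel of the only arrow leaving v is the image of a
    homomorphism from S_v. *)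
Lemma row_free_of_hom M a : (forall b, src b = src a -> b = a) ->
  hom_vanishes (S (src a)) M -> row_free (act M a).
Proof.
move=> uq H; rewrite -kermx_eq0; apply/eqP/row_matrixP => i; rewrite row0.
set z := row i _; have za : z *m act M a = 0 by rewrite -row_mul mulmx_ker row0.
pose f : fam (S (src a)) M := fun w => \matrix_(x, y) (z *m transport M (src a) w) 0 y.
have [x _] := simple_pt (src a).
have hf : is_hom f.
  move=> b; have [sb|ne] := eqVneq (src b) (src a); last first.
    by apply: flat_rows; apply: dim_simple_neq.
  rewrite (uq b sb) [LHS]mul0mx; apply/row_matrixP=> y; rewrite row0 row_mul.
  have -> : row y (f (src a)) = z.
    by apply/rowP=> k; rewrite [LHS]mxE [LHS]mxE transport_id mulmx1.
  by rewrite za.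
have /(_ (src a)) /matrixP e := H f hf; apply/rowP=> k.
by have := e x k; rewrite [LHS]mxE transport_id mulmx1 [X in _ = X]mxE => ->; rewrite mxE.
Qed.

Lemma ext_from_simple M a : (forall b, src b = src a -> b = a) ->
  row_full (act M a) -> ext1_vanishes (S (src a)) M.
Proof.
move=> uq fu; apply/ext1_vanishesP => c.
exists (fun w => transport (S (src a)) w (src a) *m c a *m pinvmx (act M a)
                 *m transport M (src a) w) => b.
have [sb|ne] := eqVneq (src b) (src a); last first.
  by apply: flat_rows; apply: dim_simple_neq.
rewrite (uq b sb) /coboundary /= mul0mx subr0 !transport_id mul1mx mulmx1.
by rewrite mulmxKpV // submx_full.
Qed.

(** Ext^1(S_v, M) is the cokernel of the only arrow leaving v, since a cocycle
    is a vector at its target and a coboundary is a vector in its image. *)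
Lemma row_full_of_ext M a : (forall b, src b = src a -> b = a) ->
  ext1_vanishes (S (src a)) M -> row_full (act M a).
Proof.
move=> uq /ext1_vanishesP H; rewrite -sub1mx; apply/row_subP=> i.
set z := row i _; have [x _] := simple_pt (src a).
have [u uE] := H (fun b => \matrix_(x, y) (z *m transport M (tgt a) (tgt b)) 0 y).
have := uE a; rewrite /coboundary /= mul0mx subr0 transport_id mulmx1 => e.
have -> : z = row x (u (src a)) *m act M a.
  by rewrite -row_mul -e; apply/rowP=> k; rewrite !mxE.
exact: submxMl.
Qed.

Lemma hom_to_simple Y a : row_full (act Y a) -> hom_vanishes Y (S (tgt a)).
Proof.
move=> fu f hf w; have [->|ne] := eqVneq w (tgt a); last first.
  by apply: flat_cols; apply: dim_simple_neq.
have := hf a; rewrite /= mulmx0 => e.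
have /row_fullP[B Ba] := fu.
by rewrite -[f _]mul1mx -Ba -mulmxA e mulmx0.
Qed.

(** A linear form that vanishes on the image of the only arrow entering v is a
    homomorphism to S_v. *)
Lemma row_full_of_hom Y a : (forall b, tgt b = tgt a -> b = a) ->
  hom_vanishes Y (S (tgt a)) -> row_full (act Y a).
Proof.
move=> uq H; rewrite -cokermx_eq0; apply/eqP; rewrite -[LHS]trmxK -[RHS]trmxK.
congr trmx; apply/row_matrixP => i; rewrite trmx0 row0; apply: trmx_inj.
rewrite tr_row trmxK trmx0; set z := col i _.
have za : act Y a *m z = 0 by rewrite -col_mulmx mulmx_coker colE mul0mx.
pose f : fam Y (S (tgt a)) := fun w => \matrix_(x, y) (transport Y w (tgt a) *m z) x 0.
have [x _] := simple_pt (tgt a).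
have hf : is_hom f.
  move=> b; have [sb|ne] := eqVneq (tgt b) (tgt a); last first.
    by apply: flat_cols; apply: dim_simple_neq.
  rewrite (uq b sb) [RHS]mulmx0; apply: trmx_inj; apply/row_matrixP=> y; rewrite trmx0 row0.
  rewrite -tr_col; apply: trmx_inj; rewrite trmxK trmx0 col_mulmx.
  have -> : col y (f (tgt a)) = z.
    by apply/colP=> k; rewrite [LHS]mxE [LHS]mxE transport_id mul1mx.
  by rewrite za.
have /(_ (tgt a)) /matrixP e := H f hf; apply/colP=> k.
by have := e k x; rewrite [LHS]mxE transport_id mul1mx [X in _ = X]mxE => ->; rewrite mxE.
Qed.

Lemma ext_to_simple Y a : (forall b, tgt b = tgt a -> b = a) ->
  row_free (act Y a) -> ext1_vanishes Y (S (tgt a)).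
Proof.
move=> uq /row_freeP[B aB]; apply/ext1_vanishesP => c.
exists (fun w => - (transport Y w (tgt a) *m B *m c a
                    *m transport (S (tgt a)) (tgt a) w)) => b.
have [sb|ne] := eqVneq (tgt b) (tgt a); last first.
  by apply: flat_cols; apply: dim_simple_neq.
rewrite (uq b sb) /coboundary /= mulmx0 sub0r !transport_id mul1mx mulmx1.
by rewrite mulmxN opprK mulmxA aB mul1mx.
Qed.

Lemma hom_simples v w : v != w -> hom_vanishes (S v) (S w).
Proof.
move=> ne f _ u; have [->|nu] := eqVneq u v.
  by apply: flat_cols; apply: dim_simple_neq.
by apply: flat_rows; apply: dim_simple_neq.
Qed.

Lemma ext_simples v w : (forall a, src a = v -> tgt a = w -> False) ->
  ext1_vanishes (S v) (S w).
Proof.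
move=> H; apply/ext1_vanishesP => c; exists (fun=> 0) => a.
have [sa|ne] := eqVneq (src a) v; last by apply: flat_rows; apply: dim_simple_neq.
have [ta|ne] := eqVneq (tgt a) w; last by apply: flat_cols; apply: dim_simple_neq.
by case: (H a sa ta).
Qed.

Lemma simple_indecomposable v : indecomposable (S v).
Proof.
apply: indecomposable_of_scalar_end => [z|f hf].
  by have := z v; rewrite /= eqxx.
have [x _] := simple_pt v; exists (f v x x) => w.
have [->|ne] := eqVneq w v; last by apply: flat_rows; apply: dim_simple_neq.
have uq (y : 'I_(dim (S v) v)) : y = x.
  have d1 : dim (S v) v = 1%N by rewrite /= eqxx.
  apply: val_inj; have lx := leq_trans (ltn_ord x) (eq_leq d1).
  have ly := leq_trans (ltn_ord y) (eq_leq d1); move: lx ly => /=.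
  by case: (x : nat) => //; case: (y : nat).
by apply/matrixP=> i j; rewrite (uq i) (uq j) mxE eqxx.
Qed.

End Simples.

(** * Kronecker modules orthogonal to a preprojective one *)

Section Kronecker.
Variable K : fieldType.
Local Open Scope ring_scope.

(** The hypotheses say that Hom and Ext^1 vanish from the preprojective
    Kronecker module with dimension vector (n+1, n+2) to the module (A, B); the
    conclusion exhibits the preprojective with dimension vector (n, n+1) as a
    retract of (A, B).  Passing to the kernel of the pair (B, -A) is the
    reflection functor, which lowers n by one. *)
Lemma kronecker_retract n a b (A B : 'M[K]_(a, b)) :
    (0 < b)%N ->
    (forall x : nat -> 'rV[K]_a, (forall k, (k < n)%N -> x k *m B = x k.+1 *m A) ->
       forall k, (k <= n)%N -> x k = 0) ->
    (forall z : nat -> 'rV[K]_b, exists x : nat -> 'rV[K]_a,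
       forall k, (k < n)%N -> x k *m B - x k.+1 *m A = z k) ->
  exists (X : nat -> 'rV[K]_a) (U : nat -> 'rV[K]_b)
         (X' : nat -> 'cV[K]_a) (U' : nat -> 'cV[K]_b),
  [/\ forall k, (k < n)%N -> X k *m A = U k /\ X k *m B = U k.+1,
      forall k, (k < n)%N -> A *m U' k = X' k /\ B *m U' k.+1 = X' k,
      A *m U' n = 0, B *m U' 0%N = 0
    & forall k l, (k <= n)%N -> (l <= n)%N -> U k *m U' l = (k == l)%:R%:M].
Proof.
elim: n a b A B => [|n IH] a b A B b0 inj surj.
  have a0 (i : 'I_a) : False.
    have /matrixP/(_ 0 i) := inj (fun=> delta_mx 0 i) (fun k e => False_ind _ (notF e)) 0%N (leqnn _).
    by rewrite !mxE !eqxx => /eqP; rewrite oner_eq0.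
  exists (fun=> 0), (fun=> delta_mx 0 (Ordinal b0)), (fun=> 0),
    (fun=> delta_mx (Ordinal b0) 0).
  split=> //; try by apply/matrixP=> i; case: (a0 i).
  move=> [|k] [|l] // _ _; rewrite mul_delta_mx.
  by apply/matrixP=> i j; rewrite !mxE !ord1.
pose G : 'M_(a + a, b) := col_mx B (- A).
pose N := row_base (kermx G); pose A1 := lsubmx N; pose B1 := rsubmx N.
have NE : N = row_mx A1 B1 by rewrite hsubmxK.
have Nfree : row_free N by apply: row_base_free.
have NG : N *m G = 0 by apply/sub_kermxP; rewrite eq_row_base.
have AB : A1 *m B = B1 *m A.
  move: NG; rewrite NE mul_row_col mulmxN => /eqP.
  by rewrite subr_eq0 => /eqP.
have a0 : (0 < a)%N.
  rewrite lt0n; apply/eqP => a0; have [x xE] := surj (fun=> delta_mx 0 (Ordinal b0)).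
  have := xE 0%N isT; rewrite (_ : B = 0) 1?(_ : A = 0) ?mulmx0 ?subr0; last first.
  - by apply/matrixP=> i; have := ltn_ord i; rewrite {2}a0.
  - by apply/matrixP=> i; have := ltn_ord i; rewrite {2}a0.
  by move/matrixP/(_ 0 (Ordinal b0)); rewrite !mxE !eqxx => /esym/eqP; rewrite oner_eq0.
have [z zE k kn|z|X [U [X' [U' [XU XU' A1U B1U UU]]]]] := IH _ _ A1 B1 a0.
- pose x k := if (k <= n)%N then z k *m A1 else z n *m B1.
  have xz := inj x; have {}xz : forall k, (k <= n.+1)%N -> x k = 0.
    apply: xz => m mn; rewrite /x -ltnS mn; case: ltnP => [mn'|mn'].
      by rewrite -zE // -!mulmxA AB.
    have -> : m = n by lia.
    by rewrite -!mulmxA AB.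
  have zA : z k *m A1 = 0 by have := xz k; rewrite /x kn; apply; lia.
  have zB : z k *m B1 = 0.
    have [lt|ge] := ltnP k n.
      by rewrite zE //; have := xz k.+1; rewrite /x lt; apply; lia.
    have -> : k = n by lia.
    by have := xz n.+1; rewrite /x ltnn; apply.
  by apply: (row_free_inj Nfree); rewrite mul0mx NE mul_mx_row zA zB row_mx0.
- have [x xE] := surj (fun k => if (k < n)%N then z k *m A else 0).
  pose y k := x k.+1 + (if (k < n)%N then z k else 0).
  have xy k : (k <= n)%N -> (row_mx (x k) (y k) <= N)%MS.
    move=> kn; rewrite eq_row_base; apply/sub_kermxP.
    rewrite mul_row_col mulmxN /y mulmxDl opprD addrA xE //.
    by case: ifP => _; rewrite ?mul0mx subrr.
  exists (fun k => row_mx (x k) (y k) *m pinvmx N) => k kn.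
  have E m : (m <= n)%N ->
      row_mx (x m) (y m) *m pinvmx N *m A1 = x m /\
      row_mx (x m) (y m) *m pinvmx N *m B1 = y m.
    move=> mn; have := mulmxKpV (xy m mn); rewrite {2}NE mul_mx_row.
    by move/eq_row_mx=> [-> ->].
  have [_ ->] := E k (ltnW kn); have [-> _] := E k.+1 kn.
  by rewrite /y kn addrAC subrr add0r.
pose Y l := if (l <= n)%N then U' l else 0.
pose W l := col_mx (if l is l'.+1 then Y l' else 0) (- Y l).
have NW l : (l <= n.+1)%N -> N *m W l = 0.
  move=> ln; rewrite NE mul_row_col mulmxN /Y; case: l ln => [|l] ln.
    by rewrite B1U mulmx0 subr0.
  rewrite -ltnS ln; case: ltnP => [lt|ge]; last first.
    have -> : l = n by lia.
    by rewrite A1U mulmx0 subr0.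
  by have [-> ->] := XU' l lt; rewrite subrr.
have GW l : (l <= n.+1)%N -> G *m (pinvmx G *m W l) = W l.
  move=> ln; apply/eqP; rewrite -subr_eq0 mulmxA -{2}[W l]mul1mx -mulmxBl.
  have /submxP[D ->] : (G *m pinvmx G - 1%:M <= N)%MS.
    rewrite eq_row_base; apply/sub_kermxP.
    by rewrite mulmxBl mulmxKpV // mul1mx subrr.
  by rewrite -mulmxA NW // mulmx0.
pose V l := pinvmx G *m W l.
have VE l : (l <= n.+1)%N ->
    B *m V l = (if l is l'.+1 then Y l' else 0) /\ A *m V l = Y l.
  move=> ln; have := GW l ln; rewrite mul_col_mx => /eq_col_mx[-> ].
  by rewrite mulNmx => /oppr_inj.
exists U, (fun k => if (k <= n)%N then U k *m A else U n *m B), Y, V; split.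
- move=> k kn; rewrite -ltnS kn; split=> //.
  case: ltnP => [lt|ge]; last by have -> : k = n by lia.
  have [<- <-] := XU k lt; by rewrite -!mulmxA AB.
- move=> k kn; have [_ ->] := VE k (ltnW kn); have [-> _] := VE k.+1 kn.
  by split.
- by have [_ ->] := VE n.+1 (leqnn _); rewrite /Y ltnn.
- by have [-> _] := VE 0%N (leq0n _).
move=> k l kn ln; have [BV AV] := VE l ln.
case: leqP => [le|gt].
  rewrite -mulmxA AV /Y; case: leqP => [le'|gt']; first exact: UU.
  by rewrite mulmx0 ltn_eqF ?raddf0 //; lia.
have -> : k = n.+1 by lia.
rewrite -mulmxA BV; case: l ln {AV BV} => [|l] ln; first by rewrite mulmx0 raddf0.
by rewrite /Y -ltnS ln UU.
Qed.

End Kronecker.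

(** * Restriction to the Kronecker algebra *)

Section Arms.
Variables (K : fieldType) (p q : nat).
Hypotheses (hp : (0 < p)%N) (hq : (0 < q)%N) (hpq : (1 < p + q)%N).
Local Notation Q := (Atilde p q).
Local Notation s := (p + q).-1%N.
Local Open Scope ring_scope.
Implicit Types (X Y M : rep K Q) (v : vertex Q) (a : arrow Q) (st : bool).

Definition sink : vertex Q := vtx p q 0.
Definition source : vertex Q := vtx p q s.

Definition on_arm st v : bool :=
  if st then (v < p)%N || (v == s :> nat) else (v == 0%N :> nat) || (p <= v)%N.

Lemma val_sink : sink = 0%N :> nat.
Proof. by rewrite val_vtx //; lia. Qed.

Lemma val_source : source = s :> nat.
Proof. by rewrite val_vtx //; lia. Qed.

Lemma source_neq_sink : source != sink.
Proof. by apply/eqP=> /(congr1 val) /=; rewrite val_source val_sink; lia. Qed.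

Lemma on_arm_sink st : on_arm st sink.
Proof. by rewrite /on_arm val_sink hp; case: st. Qed.

Lemma on_arm_source st : on_arm st source.
Proof. by rewrite /on_arm val_source eqxx orbT; case: st => //; lia. Qed.

Lemma on_arm_tgt a : on_arm (is_inl a) (tgt a).
Proof.
rewrite /on_arm val_tgt //; case: (arrowP hp hq a) => [[-> [-> _]]|[-> [l ->]]] //.
by move: l; move: (arrow_from _) => x l; case: (x =P p) => // ne; apply/orP; right; lia.
Qed.

Lemma on_arm_src a : on_arm (is_inl a) (src a).
Proof.
rewrite /on_arm val_src //; case: (arrowP hp hq a) => [[-> [_ ->]]|[-> [l _]]] /=.
  by case: ifP => h; rewrite ?h ?eqxx ?orbT.
by case/andP: l => -> _; rewrite orbT.
Qed.

Lemma src_neq_sink a : src a != sink.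
Proof.
apply/eqP=> /(congr1 val) /=; rewrite val_sink val_src //.
by have := arrow_from_lt hp hq a; case: arrow_from.
Qed.

Lemma tgt_neq_source a : tgt a != source.
Proof.
apply/eqP=> /(congr1 val) /=; rewrite val_source val_tgt //.
have := arrow_from_lt hp hq a; have := vertex_le (src a); rewrite val_src //.
by move=> le lt e; move: (leq_trans lt le); rewrite e ltnn.
Qed.

Lemma on_arm_arrow st v : on_arm st v -> v != sink ->
  exists2 a : arrow Q, is_inl a = st & src a = v.
Proof.
move=> av ne; have v0 : (0 < v)%N.
  by rewrite lt0n; apply: contra ne => /eqP e; apply/eqP/val_inj; rewrite /= val_sink.
have lv := vertex_le v; move: av; rewrite /on_arm; case: st => av; last first.
  have [|a [ia fa]] := @inr_arrow_from p q hp hq v; first by lia.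
  by exists a => //; apply: val_inj; rewrite /= val_src.
have [|a [ia ta]] := @inl_arrow_into p q (if (v < p)%N then v.-1 else p.-1); first by case: ifP; lia.
exists a => //; apply: val_inj; rewrite /= val_src //.
case: (arrowP hp hq a) => [[_ [_ ->]]|[]]; last by rewrite ia.
rewrite ta; case/orP: av => [lt|/eqP e]; first by rewrite lt prednK // lt.
have -> : (v < p)%N = false by lia.
by rewrite prednK // ltnn e.
Qed.

Lemma arrow_from_inj (a b : arrow Q) : is_inl a = is_inl b -> src a = src b -> a = b.
Proof.
by move=> i /(congr1 val) /=; rewrite !val_src //; apply: arrow_inj.
Qed.

Lemma arm_ind st (P : vertex Q -> Prop) :
    P sink -> (forall a : arrow Q, is_inl a = st -> P (tgt a) -> P (src a)) ->
  forall v, on_arm st v -> P v.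
Proof.
move=> P0 IH v; have [n le] := ubnP (v : nat); elim: n v le => // n IHn v le av.
have [->//|ne] := eqVneq v sink; have [a ia sa] := on_arm_arrow av ne.
rewrite -sa; apply: IH => //; apply: IHn; last by rewrite -ia on_arm_tgt.
move: le; rewrite -sa val_src // val_tgt //.
by have := arrow_from_lt hp hq a; lia.
Qed.

(** The composite of the arrows from v to the sink along one of the two parallel
    paths; n bounds the number of steps. *)
Fixpoint down_rec X st n v : 'M[K]_(dim X v, dim X sink) :=
  if n is n'.+1 then
    if v == sink then transport X v sink
    else if [pick a : arrow Q | (is_inl a == st) && (src a == v)] is Some a
    then transport X v (src a) *m act X a *m down_rec X st n' (tgt a) else 0
  else 0.

Definition down X st v := down_rec X st v.+1 v.

Lemma down_rec_fuel X st n v : (v < n)%N -> down_rec X st n v = down X st v.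
Proof.
suff H m m' (w : vertex Q) : (w < m)%N -> (w < m')%N -> down_rec X st m w = down_rec X st m' w.
  by move=> lt; apply: H.
elim: m m' w => // m IHm [|m'] w // lt lt' /=.
case: ifP => // _; case: pickP => // a /andP[_ /eqP sa]; congr (_ *m _).
have l : (@tgt Q a < w)%N by rewrite -[w]sa (val_src hp hq) val_tgt // arrow_from_lt.
by apply: IHm; apply: leq_trans l _.
Qed.

Lemma down_sink X st : down X st sink = 1%:M.
Proof. by rewrite /down /= eqxx transport_id. Qed.

Lemma down_src X st a :
  is_inl a = st -> down X st (src a) = act X a *m down X st (tgt a).
Proof.
move=> ia; rewrite {1}/down /= (negPf (src_neq_sink a)).
case: pickP => [b /andP[/eqP ib /eqP sb]|/(_ a)]; last by rewrite ia !eqxx.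
have -> : b = a by apply: arrow_from_inj => //; rewrite ib ia.
rewrite transport_id mul1mx down_rec_fuel //.
by rewrite val_src // val_tgt // arrow_from_lt.
Qed.

Lemma down_natural X Y st (f : fam X Y) :
    (forall a : arrow Q, is_inl a = st -> act X a *m f (tgt a) = f (src a) *m act Y a) ->
  forall v, on_arm st v -> down X st v *m f sink = f v *m down Y st v.
Proof.
move=> hf; apply: arm_ind => [|a ia IH].
  by rewrite !down_sink mul1mx mulmx1.
by rewrite !down_src // -mulmxA IH !mulmxA hf.
Qed.

Lemma down_hom X Y (f : fam X Y) st v : is_hom f -> on_arm st v ->
  down X st v *m f sink = f v *m down Y st v.
Proof. by move=> hf; apply: down_natural => a _. Qed.

(** A path through v; source and sink lie on both, and their value is an
    arbitrary choice. *)
Definition arm_of v : bool := (v < p)%N.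

Lemma on_arm_of v : on_arm (arm_of v) v.
Proof. by rewrite /on_arm /arm_of; case: ltnP => // _; rewrite orbT. Qed.

Lemma arm_of_uniq st v : on_arm st v -> v != source -> v != sink -> st = arm_of v.
Proof.
rewrite -!(inj_eq val_inj) /= val_source val_sink /on_arm /arm_of.
by case: st; case: ltnP => //; move: (v : nat) => n; lia.
Qed.

Lemma hom_eq_of_sink X Y (f g : fam X Y) :
    (forall v, row_free (down Y (arm_of v) v)) ->
    is_hom f -> is_hom g -> f sink = g sink ->
  forall v, f v = g v.
Proof.
move=> fr hf hg e v; apply: (row_free_inj (fr v)).
by rewrite -!down_hom ?on_arm_of // e.
Qed.

Definition interior_invertible M :=
  forall a, src a != source -> row_free (act M a) && row_full (act M a).

Lemma down_invertible M st v : interior_invertible M ->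
  on_arm st v -> v != source -> row_free (down M st v) && row_full (down M st v).
Proof.
move=> iM; move: v; apply: arm_ind => [_|a ia /(_ (tgt_neq_source a)) /andP[fr fu] ns].
  by rewrite down_sink row_free_unit row_full_unit unitmx1.
have /andP[fra fua] := iM a ns; rewrite down_src //.
by rewrite /row_full (eqmxMfull _ fua) /row_free mxrankMfree //; apply/andP.
Qed.

(** When the arrows leaving the interior vertices of M are invertible, M amounts
    to a Kronecker module, and a map to it given at source and sink extends:
    follow Y down to the sink and return along M. *)
Lemma hom_of_ends Y M (fs : 'M[K]_(dim Y source, dim M source))
    (f0 : 'M[K]_(dim Y sink, dim M sink)) :
    interior_invertible M ->
    (forall st, down Y st source *m f0 = fs *m down M st source) ->
  exists f : fam Y M, [/\ is_hom f, f source = fs & f sink = f0].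
Proof.
move=> iM ends.
pose f : fam Y M := fun v =>
  if v == source then transport Y v source *m fs *m transport M source v
  else down Y (arm_of v) v *m f0 *m pinvmx (down M (arm_of v) v).
have fE st v : on_arm st v -> f v *m down M st v = down Y st v *m f0.
  move=> av; rewrite /f; have [->|ns] := eqVneq v source.
    by rewrite !transport_id mul1mx mulmx1 ends.
  have [e|n0] := eqVneq v sink.
    rewrite e !down_sink mulmx1 mul1mx; have := @mulmxKpV _ _ _ _ f0 1%:M.
    by rewrite mulmx1 => -> //; rewrite submx1.
  rewrite -(arm_of_uniq av ns n0) mulmxKpV // submx_full //.
  by case/andP: (down_invertible iM av ns).
exists f; split=> [a||].
- have := on_arm_src a; have := on_arm_tgt a => at' as'.
  have /andP[fr _] := down_invertible iM at' (tgt_neq_source a).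
  apply: (row_free_inj fr); rewrite -mulmxA fE // mulmxA -down_src //.
  by rewrite -mulmxA -down_src // fE.
- by rewrite /f eqxx !transport_id mul1mx mulmx1.
by have := fE true sink (on_arm_sink true); rewrite !down_sink mulmx1 mul1mx.
Qed.

End Arms.

(** * Homomorphisms and extensions between strings *)

Section StringArms.
Variables (K : fieldType) (p q : nat).
Hypotheses (hp : (0 < p)%N) (hq : (0 < q)%N) (hpq : (1 < p + q)%N).
Local Notation Q := (Atilde p q).
Local Notation s := (p + q).-1.
Local Notation source := (source p q).
Local Notation sink := (sink p q).
Local Open Scope ring_scope.
Implicit Types (v : vertex Q) (a : arrow Q) (st : bool).

Section OneString.
Variables (n i j : nat).
Hypotheses (hi : (i < q)%N) (hj : (j < p)%N).
Local Notation X := (string K p q n i j).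

Lemma string_dim_arrow a : (dim X (src a) <= dim X (tgt a))%N.
Proof.
rewrite !dim_aligned val_src // val_tgt // /string_dim leq_add2l.
have := arrowP hp hq a; move: (arrow_from a) (arrow_to a) => x y.
by case=> [[_ [l]]|[_ [l]]]; case: ifP => e ->; split_ifs; lia.
Qed.

Lemma dim_string_source : dim X source = n.
Proof. by rewrite dim_aligned val_source // string_dim_s. Qed.

Lemma dim_string_sink : dim X sink = n.+1.
Proof. by rewrite dim_aligned val_sink // string_dim_p ?addn1. Qed.

Lemma down_string st v : on_arm st v ->
  (dim X v <= dim X sink)%N /\
  down X st v = align K st (dim X v) (dim X sink).
Proof.
move: v; apply: arm_ind => // [|a ia [le IH]].
  rewrite down_sink; split=> //; apply: ent_ext => x y lx ly.
  by rewrite ent1 lx /align; case: st; rewrite ent_mk lx ly ?addn0 ?eqn_add2r.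
have le' := string_dim_arrow a; split; first exact: leq_trans le' le.
by rewrite down_src // IH -[LHS]/(align K (is_inl a) (dim X (src a)) (dim X (tgt a)) *m _) ia align_mul ?le'.
Qed.

Lemma row_free_down_string st v : on_arm st v -> row_free (down X st v).
Proof. by move=> /down_string[le ->]; apply: row_free_align. Qed.

Lemma ent_down_string_mul st m (A : 'M[K]_(_, m)) x y : (x < n)%N ->
  ent (down X st source *m A) x y = ent A (if st then x else x.+1) y.
Proof.
move=> lx; have [_ ->] := down_string (on_arm_source hp hq hpq st).
have ds := dim_string_source; have d0 := dim_string_sink.
have -> : ent A (if st then x else x.+1) y =
          if st then ent A x y else ent A (x + dim X sink - dim X source) y.
  by case: st => //; congr (ent _ _ _); rewrite ds d0; lia.
rewrite ent_align_mul {1}ds lx; case: st => //.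
by have -> : (dim X source <= x + dim X sink)%N by rewrite ds d0; lia.
Qed.

Lemma ent_mul_down_string st m (A : 'M[K]_(m, _)) x y : (y <= n)%N ->
  ent (A *m down X st source) x y =
  if st then ent A x y else if y is y'.+1 then ent A x y' else 0.
Proof.
move=> ly; have [_ ->] := down_string (on_arm_source hp hq hpq st).
have ds := dim_string_source; have d0 := dim_string_sink.
rewrite ent_mul_align {1}d0 ltnS ly; case: st => //.
case: y ly => [|y] ly; first by have -> : (dim X sink <= 0 + dim X source)%N = false by rewrite ds d0; lia.
have -> : (dim X sink <= y.+1 + dim X source)%N by rewrite ds d0; lia.
by congr (ent _ _ _); rewrite ds d0; lia.
Qed.

End OneString.

Section Homs.
Variables (n i j n' i' j' : nat).
Hypotheses (hi : (i < q)%N) (hj : (j < p)%N) (hi' : (i' < q)%N) (hj' : (j' < p)%N).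
Local Notation X := (string K p q n i j).
Local Notation Y := (string K p q n' i' j').

(** Commuting with the composite along the first path compares f at the source
    and at the sink, and along the second path does so shifted by one row and
    one column.  So the matrix at the sink is constant along diagonals, and zero
    on those that leave through a side; with fewer columns than rows all do. *)
Lemma ent_hom_strings (f : fam X Y) x y : (n' <= n)%N -> is_hom f ->
    (x <= n)%N -> (y <= n')%N ->
  ent (f sink) x y = if (x == y) && (n' == n) then ent (f sink) 0 0 else 0.
Proof.
move=> le hf lx ly; set F := ent (f sink).
have T st := down_hom hp hq hpq hf (on_arm_source hp hq hpq st).
have E st u w : (u < n)%N -> (w <= n')%N -> F (if st then u else u.+1) w =
    if st then ent (f source) u w else if w is w'.+1 then ent (f source) u w' else 0.
  move=> lu lw; have := congr1 (fun A => ent A u w) (T st).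
  by rewrite ent_down_string_mul // ent_mul_down_string.
have Z u : (u < n)%N -> F u.+1 0%N = 0 by move=> lu; rewrite (E false).
have L u : (u < n)%N -> F u n' = 0.
  by move=> lu; rewrite (E true) // ent_col_out // dim_string_source.
have D u w : (u < n)%N -> (w < n')%N -> F u.+1 w.+1 = F u w.
  by move=> lu lw; rewrite (E false) // (E true) // ltnW.
have D' k u w : (u + k <= n)%N -> (w + k <= n')%N -> F (u + k)%N (w + k)%N = F u w.
  elim: k => [|k IH] lu lw; first by rewrite !addn0.
  by rewrite !addnS D ?IH //; lia.
have LT u w : (u <= w)%N -> (w <= n')%N -> (u + n' < w + n)%N -> F u w = 0.
  move=> uw lw lt; rewrite -(D' (n' - w)%N); [|lia|lia].
  by rewrite subnKC // L //; lia.
have [lt|gt|->] := ltngtP x y; first by rewrite LT //; lia.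
  rewrite -[x](subnK (ltnW gt)) -[y]add0n D' ?subnK //; [|lia].
  have -> : (x - y = (x - y).-1.+1)%N by lia.
  by rewrite Z //; lia.
case: eqP => [e|ne] /=; last by rewrite LT //; lia.
by rewrite -[y]add0n D' //; lia.
Qed.

Lemma hom_vanishes_strings : (n' < n)%N -> hom_vanishes X Y.
Proof.
move=> lt f hf; apply: (hom_eq_of_sink hp hq hpq) => //.
- by move=> v; apply: row_free_down_string => //; apply: on_arm_of.
- by move=> a; rewrite mulmx0 mul0mx.
apply: ent_ext => x y lx ly; rewrite ent0.
rewrite dim_string_sink // in lx; rewrite dim_string_sink // in ly.
by rewrite ent_hom_strings // ?(ltn_eqF lt) ?andbF // ltnW.
Qed.

End Homs.

Lemma string_end_scalar n i j (f : fam (string K p q n i j) (string K p q n i j)) :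
    (i < q)%N -> (j < p)%N -> is_hom f ->
  exists k : K, forall v, f v = k%:M.
Proof.
move=> hi hj hf; exists (ent (f sink) 0 0).
apply: (hom_eq_of_sink hp hq hpq) => //.
- by move=> v; apply: row_free_down_string => //; apply: on_arm_of.
- by move=> a; rewrite scalar_mxC.
apply: ent_ext => x y lx ly.
have -> (k : K) m : k%:M = k *: (1%:M : 'M_m) by rewrite scalemx1.
rewrite entZ ent1 lx /=; rewrite dim_string_sink // in lx; rewrite dim_string_sink // in ly.
by rewrite ent_hom_strings // eqxx andbT; case: eqP; rewrite ?mulr1 ?mulr0.
Qed.

Lemma string_indecomposable n i j : (i < q)%N -> (j < p)%N ->
  indecomposable (string K p q n i j).
Proof.
move=> hi hj; apply: indecomposable_of_scalar_end => [/(_ sink)|f hf].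
  by rewrite dim_string_sink.
exact: string_end_scalar.
Qed.

End StringArms.

Section StringExt.
Variables (K : fieldType) (p q : nat).
Hypotheses (hp : (0 < p)%N) (hq : (0 < q)%N) (hpq : (1 < p + q)%N).
Local Notation Q := (Atilde p q).
Local Notation s := (p + q).-1.
Local Notation source := (source p q).
Local Notation sink := (sink p q).
Implicit Types (v : vertex Q) (a : arrow Q).

Lemma sum_ord_eq n k : k < n -> \sum_(i < n) (i == k :> nat) = 1.
Proof.
move=> lt; rewrite (bigD1 (Ordinal lt)) //= eqxx big1 // => i ne.
by apply/eqP; rewrite eqb0; apply: contra ne => /eqP e; apply/eqP/val_inj.
Qed.

Lemma card_arrows : #|arrow Q| = p + q.
Proof. by rewrite card_sum !card_ord. Qed.

Lemma card_vertices : #|vertex Q| = p + q.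
Proof. by rewrite card_ord prednK // ltnW. Qed.

Lemma sum_tgt_sink : \sum_(a : arrow Q) (tgt a == sink) = 2.
Proof.
have E (a : arrow Q) : (tgt a == sink) = (arrow_to a == 0).
  by rewrite -(inj_eq val_inj) /= val_sink // val_tgt.
under eq_bigr => a _ do rewrite E.
rewrite big_sumType /= -[2]/(1 + 1) sum_ord_eq // -(sum_ord_eq hq).
congr (_ + _); apply: eq_bigr => j _; congr (nat_of_bool _).
by move: (j : nat) => m /=; case: (m =P 0) => // j0; apply/negbTE; lia.
Qed.

Lemma sum_src_source : \sum_(a : arrow Q) (src a == source) = 2.
Proof.
have E (a : arrow Q) : (src a == source) = (arrow_from a == s).
  by rewrite -(inj_eq val_inj) /= val_source // val_src.
under eq_bigr => a _ do rewrite E.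
have lp : p.-1 < p by rewrite prednK.
have lq : q.-1 < q by rewrite prednK.
rewrite big_sumType -[2]/(1 + 1) -{1}(sum_ord_eq lp) -(sum_ord_eq lq).
congr (_ + _); apply: eq_bigr => j _; congr (nat_of_bool _) => /=.
  by have lj := ltn_ord j; case: ifP => e; apply/eqP/eqP; lia.
by apply/eqP/eqP; lia.
Qed.

Lemma sum_vertex v : \sum_(w : vertex Q) (w == v) = 1.
Proof.
by rewrite -(sum_ord_eq (ltn_ord v)); apply: eq_bigr => w _; rewrite -(inj_eq val_inj).
Qed.

Section Ext.
Variable n : nat.
Local Notation Y := (string K p q n 0 0).
Local Notation M := (string K p q n q.-1 p.-1).

Lemma dim_string00 v : dim Y v = n + (v == sink).
Proof.
rewrite dim_aligned /string_dim -(inj_eq val_inj) /= val_sink // leqn0 ltn0.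
by case: ltnP => // le; congr (n + _); case: eqP => // e; rewrite e in le; lia.
Qed.

Lemma dim_string_full v : dim M v = n + (v != source).
Proof.
rewrite dim_aligned /string_dim -(inj_eq val_inj) /= val_source //.
congr (n + nat_of_bool _); have lv := vertex_le v.
by case: ltnP => le; apply/idP/idP; lia.
Qed.

Lemma dim_string00_src a : dim Y (src a) = n.
Proof. by rewrite dim_string00 (negPf (src_neq_sink hp hq hpq a)) addn0. Qed.

Lemma dim_string_full_tgt a : dim M (tgt a) = n.+1.
Proof. by rewrite dim_string_full (tgt_neq_source hp hq hpq a) addn1. Qed.

Lemma string00_rigid : ext1_vanishes Y Y.
Proof.
apply: (@ext1_vanishes_of_euler _ _ _ _ true (fun=> 1%:M)%R).
  move=> f hf; have [k kE] := string_end_scalar hp hq hpq hq hp hf.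
  by exists k => v; rewrite kE scale1r scalemx1.
under eq_bigr => v _ do rewrite dim_string00.
have -> : \sum_(a : arrow Q) dim Y (src a) * dim Y (tgt a) = n * ((p + q) * n + 2).
  under eq_bigr => a _ do rewrite dim_string00_src dim_string00.
  by rewrite -big_distrr big_split /= sum_nat_const card_arrows sum_tgt_sink.
have -> : \sum_v (n + (v == sink)) * (n + (v == sink)) =
          \sum_v (n * n + (2 * n + 1) * (v == sink)).
  by apply: eq_bigr => v _; case: eqP; lia.
rewrite big_split /= sum_nat_const -big_distrr /= sum_vertex card_vertices.
by move: (p + q) => c; lia.
Qed.

Lemma string_full_rigid : ext1_vanishes M M.
Proof.
have lp : p.-1 < p by rewrite prednK.
have lq : q.-1 < q by rewrite prednK.
apply: (@ext1_vanishes_of_euler _ _ _ _ true (fun=> 1%:M)%R).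
  move=> f hf; have [k kE] := string_end_scalar hp hq hpq lq lp hf.
  by exists k => v; rewrite kE scale1r scalemx1.
have eV : \sum_v dim M v * dim M v + (2 * n + 1) = (p + q) * (n.+1 * n.+1).
  have -> : 2 * n + 1 = \sum_(v : vertex Q) (2 * n + 1) * (v == source).
    by rewrite -big_distrr /= sum_vertex muln1.
  rewrite -big_split -card_vertices -sum_nat_const.
  by apply: eq_bigr => v _; rewrite dim_string_full /=; case: eqP; lia.
have eA : \sum_(a : arrow Q) dim M (src a) * dim M (tgt a) + n.+1 * 2 =
          (p + q) * (n.+1 * n.+1).
  have -> : n.+1 * 2 = \sum_(a : arrow Q) n.+1 * (src a == source).
    by rewrite -big_distrr /= sum_src_source.
  rewrite -big_split -card_arrows -sum_nat_const.
  by apply: eq_bigr => a _; rewrite dim_string_full_tgt dim_string_full /=; case: eqP; lia.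
by move: eV eA; move: ((p + q) * _) => c; lia.
Qed.

End Ext.

Lemma ext_string00_full n : ext1_vanishes (string K p q n.+1 0 0) (string K p q n q.-1 p.-1).
Proof.
have lp : p.-1 < p by rewrite prednK.
have lq : q.-1 < q by rewrite prednK.
apply: (@ext1_vanishes_of_euler _ _ _ _ false (fun=> 0)%R).
  move=> f hf; exists 0%R => v; rewrite scale0r.
  exact: (hom_vanishes_strings hp hq hpq hq hp lq lp (ltnSn n)).
have eV : \sum_v dim (string K p q n.+1 0 0) v * dim (string K p q n q.-1 p.-1) v =
          (p + q) * (n.+1 * n.+1).
  have E v : n.+1 = \sum_(w : vertex Q) n.+1 * (w == v).
    by rewrite -big_distrr /= sum_vertex muln1.
  apply: (@addIn n.+1); rewrite [X in _ + X](E source) [X in _ = _ + X](E sink).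
  rewrite -card_vertices -sum_nat_const -!big_split.
  apply: eq_bigr => v _; rewrite dim_string_full dim_string00 /=.
  case: eqP => [->|_]; last by case: eqP; lia.
  by rewrite eq_sym (negPf (source_neq_sink hp hq hpq)) /=; lia.
rewrite eV addn0 -card_arrows -sum_nat_const.
by apply: eq_bigr => a _; rewrite dim_string00_src dim_string_full_tgt.
Qed.
End StringExt.

(** * The module completing a stratifying system *)

Section Partner.
Variables (K : fieldType) (p q : nat).
Hypotheses (hp : (0 < p)%N) (hq : (0 < q)%N) (hpq : (1 < p + q)%N).
Local Notation Q := (Atilde p q).
Local Notation s := (p + q).-1.
Local Notation source := (source p q).
Local Notation sink := (sink p q).
Local Open Scope ring_scope.
Implicit Types (M Y : rep K Q) (v : vertex Q) (a : arrow Q).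
Local Notation S v := (@simple K Q v).

Definition interior v : bool := (v != sink) && (v != source).

Lemma interior_out v : interior v ->
  exists2 a : arrow Q, src a = v & forall b : arrow Q, src b = src a -> b = a.
Proof.
case/andP=> n0 ns.
have [a ia sa] := on_arm_arrow hp hq hpq (on_arm_of v) n0; exists a => // b sb.
apply: (arrow_from_inj hp hq) => //; rewrite ia; apply: (arm_of_uniq hp hq hpq) => //.
by rewrite -sa -sb on_arm_src.
Qed.

Lemma interior_in v : interior v ->
  exists2 a : arrow Q, tgt a = v & forall b : arrow Q, tgt b = tgt a -> b = a.
Proof.
case/andP=> n0 ns; have lv := vertex_le v.
have [v0 vs] : (0 < v)%N /\ (v < s)%N.
  split.
    by rewrite lt0n; apply: contra n0 => /eqP e; apply/eqP/val_inj; rewrite /= val_sink.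
  rewrite ltn_neqAle lv andbT; apply: contra ns => /eqP e.
  by apply/eqP/val_inj; rewrite /= val_source.
have [a ia ta] : exists2 a : arrow Q, is_inl a = arm_of v & tgt a = v.
  rewrite /arm_of; case: ltnP => le.
    have [a [ia ta]] := @inl_arrow_into p q v le.
    by exists a => //; apply: val_inj; rewrite /= val_tgt.
  have [|a [ia fa]] := @inr_arrow_from p q hp hq v.+1; first by lia.
  exists a => //; apply: val_inj; rewrite /= val_tgt //.
  case: (arrowP hp hq a) => [[]|[_ [_ ->]]]; first by rewrite ia.
  by rewrite fa; case: eqP; lia.
exists a => // b tb; have ib : is_inl b = arm_of v.
  by apply: (arm_of_uniq hp hq hpq) => //; rewrite -ta -tb on_arm_tgt.
apply: (@arrow_to_inj p q hp hq); first by rewrite ia.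
by rewrite -!(val_tgt hp hq) tb.
Qed.

Lemma interior_src a : src a != source -> interior (src a).
Proof. by move=> ns; rewrite /interior src_neq_sink. Qed.

(** The part of the stratifying conditions that relates M to F and G. *)
Definition left_perp M := forall v, interior v ->
  hom_vanishes (S v) M /\ ext1_vanishes (S v) M.

Lemma left_perp_invertible M : left_perp M <-> interior_invertible M.
Proof.
split=> [H a /interior_src /[dup] /interior_out[b sb ub] /H[h e]|H v /[dup] iv].
  have uq c : src c = src a -> c = a.
    by move=> sc; rewrite (ub c) 1?(ub a) // ?sc sb.
  by rewrite (row_free_of_hom uq h) (row_full_of_ext uq e).
case/interior_out=> a sa ua.
have ns : src a != source by rewrite sa; case/andP: iv.
have /andP[fr fu] := H a ns.
by rewrite -sa; split; [apply: hom_from_simple|apply: ext_from_simple].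
Qed.

Lemma string_right_perp n v : interior v ->
  hom_vanishes (string K p q n 0 0) (S v) /\ ext1_vanishes (string K p q n 0 0) (S v).
Proof.
move=> iv; have [a ta ua] := interior_in iv.
have e : dim (string K p q n 0 0) (src a) = dim (string K p q n 0 0) (tgt a).
  by rewrite !dim_string00 // ta (negPf (src_neq_sink hp hq hpq a)); case/andP: iv => /negPf ->.
rewrite -ta; split; [apply: hom_to_simple|apply: ext_to_simple => //].
  by apply: row_full_align; move: e; rewrite !dim_aligned => ->.
by apply: row_free_align; move: e; rewrite !dim_aligned => ->.
Qed.

(** If an end stops inside a path, the simple where it stops is a quotient. *)
Lemma string_right_perp_inv n i j : (i < q)%N -> (j < p)%N ->
    (forall v, interior v -> hom_vanishes (string K p q n i j) (S v)) ->
  i = 0%N /\ j = 0%N.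
Proof.
move=> hi hj H.
have D (v : nat) : (0 < v < s)%N -> (string_dim p n i j v <=
    string_dim p n i j (if (v < p)%N then if (v.+1 < p)%N then v.+1 else s else v.+1))%N.
  move=> lv; have iv : interior (vtx p q v).
    by rewrite /interior -!(inj_eq val_inj) /= val_sink // val_source // val_vtx; lia.
  have [a ta ua] := interior_in iv.
  have /eqP r : row_full (act (string K p q n i j) a).
    by apply: row_full_of_hom => //; rewrite ta; apply: H.
  have := rank_leq_row (act (string K p q n i j) a); rewrite r.
  rewrite !dim_aligned val_src // ta val_vtx //; last by lia.
  suff -> : arrow_from a = if (v < p)%N then if (v.+1 < p)%N then v.+1 else s else v.+1 by [].
  have : arrow_to a = v by rewrite -val_tgt // ta val_vtx //; lia.
  move: (arrowP hp hq a); move: (arrow_from a) (arrow_to a) => x y A e; rewrite e in A.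
  case: A => [[_ [l ->]]|[_ [l]]]; first by rewrite l.
  by case: (x =P p) => ne; split_ifs; lia.
split; apply/eqP; rewrite eqn0Ngt; apply/negP => gt.
  have := D (p + i).-1; have -> : (0 < (p + i).-1 < s)%N by lia.
  move/(_ isT); rewrite (_ : ((p + i).-1 < p)%N = false); last by lia.
  by rewrite /string_dim leq_add2l; split_ifs; lia.
have := D j; have -> : (0 < j < s)%N by lia.
move/(_ isT); rewrite hj /string_dim leq_add2l hj leqnn.
by case: (ltnP j.+1 p) => e; rewrite ?e; split_ifs; lia.
Qed.

(** At source and sink this is the Kronecker module that completes [string n 0 0]
    to an exceptional pair on the left: the preprojective with dimension vector
    (n-1, n), or the simple injective when [string 0 0 0] is simple projective. *)
Definition partner n : rep K Q :=
  if n is n'.+1 then string K p q n' q.-1 p.-1 else S source.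

Lemma string_interior_invertible n :
  interior_invertible (string K p q n q.-1 p.-1).
Proof.
move=> a ns.
have e : dim (string K p q n q.-1 p.-1) (src a) = dim (string K p q n q.-1 p.-1) (tgt a).
  by rewrite !dim_string_full // ns (tgt_neq_source hp hq hpq a).
by apply/andP; split; [apply: row_free_align|apply: row_full_align];
  move: e; rewrite !dim_aligned => ->.
Qed.

Lemma partner_indecomposable n : indecomposable (partner n).
Proof.
case: n => [|n]; first exact: simple_indecomposable.
by apply: string_indecomposable => //; rewrite ltn_predL.
Qed.

Lemma no_arrow_into_source a : tgt a = source -> False.
Proof. by move=> e; have := tgt_neq_source hp hq hpq a; rewrite e eqxx. Qed.

Lemma partner_rigid n : ext1_vanishes (partner n) (partner n).
Proof.
case: n => [|n]; last exact: string_full_rigid.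
by apply: ext_simples => a _ /no_arrow_into_source.
Qed.

Lemma partner_left_perp n : left_perp (partner n).
Proof.
case: n => [|n]; last first.
  by apply/left_perp_invertible; apply: string_interior_invertible.
move=> v /andP[_ ns]; split; first exact: hom_simples.
by apply: ext_simples => a _ /no_arrow_into_source.
Qed.

Lemma dim_string000 v : v != sink -> dim (string K p q 0 0 0) v = 0%N.
Proof. by move=> /negPf n0; rewrite dim_string00 // n0. Qed.

Lemma string_partner_hom n : hom_vanishes (string K p q n 0 0) (partner n).
Proof.
case: n => [|n]; last first.
  by apply: hom_vanishes_strings => //; rewrite ltn_predL.
move=> f _ v; have [->|n0] := eqVneq v sink; last first.
  by apply: flat_rows; apply: dim_string000.
by apply: flat_cols; apply: dim_simple_neq; rewrite eq_sym (source_neq_sink hp hq hpq).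
Qed.

Lemma string_partner_ext n : ext1_vanishes (string K p q n 0 0) (partner n).
Proof.
case: n => [|n]; last exact: ext_string00_full.
apply/ext1_vanishesP => c; exists (fun=> 0) => a.
by apply: flat_rows; apply: dim_string000; apply: src_neq_sink.
Qed.

End Partner.

Section PartnerUnique.
Variables (K : fieldType) (p q : nat).
Hypotheses (hp : (0 < p)%N) (hq : (0 < q)%N) (hpq : (1 < p + q)%N).
Local Notation Q := (Atilde p q).
Local Notation s := (p + q).-1.
Local Notation source := (source p q).
Local Notation sink := (sink p q).
Local Open Scope ring_scope.
Implicit Types (v : vertex Q) (a : arrow Q).

Variable M : rep K Q.
Hypothesis iM : interior_invertible M.

Definition rows m b (x : nat -> 'rV[K]_b) : 'M[K]_(m, b) :=
  \matrix_(k < m, y < b) x k 0 y.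

Definition cols m b (x : nat -> 'cV[K]_b) : 'M[K]_(b, m) :=
  \matrix_(y < b, k < m) x k y 0.

Lemma ent_rows m b (x : nat -> 'rV[K]_b) k y : (k < m)%N ->
  ent (rows m x) k y = ent (x k) 0 y.
Proof.
move=> lk; have [ly|ly] := ltnP y b; last by rewrite !ent_col_out.
rewrite -[k]/(val (Ordinal lk)) -[y]/(val (Ordinal ly)) ent_ord mxE.
by rewrite -[0%N]/(val (0 : 'I_1)) ent_ord.
Qed.

Lemma ent_cols m b (x : nat -> 'cV[K]_b) k y : (k < m)%N ->
  ent (cols m x) y k = ent (x k) y 0.
Proof.
move=> lk; have [ly|ly] := ltnP y b; last by rewrite !ent_row_out.
rewrite -[k]/(val (Ordinal lk)) -[y]/(val (Ordinal ly)) ent_ord mxE.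
by rewrite -[0%N]/(val (0 : 'I_1)) ent_ord.
Qed.

Lemma rows_mulmx m b c (x : nat -> 'rV[K]_b) (A : 'M[K]_(b, c)) :
  rows m x *m A = rows m (fun k => x k *m A).
Proof.
apply/row_matrixP=> k; rewrite row_mul.
have E l (z : nat -> 'rV[K]_l) : row k (rows m z) = z k by apply/rowP=> y; rewrite !mxE.
by rewrite !E.
Qed.

Lemma mulmx_cols m b c (x : nat -> 'cV[K]_b) (A : 'M[K]_(c, b)) :
  A *m cols m x = cols m (fun k => A *m x k).
Proof.
apply/matrixP=> i k; rewrite !mxE; apply: eq_bigr => j _; by rewrite mxE.
Qed.

Lemma interior_zero v : dim M sink = 0%N -> v != source -> dim M v = 0%N.
Proof.
move=> M0 ns; have /andP[fr _] := down_invertible hp hq hpq iM (on_arm_of v) ns.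
by apply/eqP; rewrite -leqn0 -[X in (_ <= X)%N]M0; apply: dim_le_of_row_free fr.
Qed.

(** The string is the simple projective at the sink, so homomorphisms from it
    are vectors of M at the sink. *)
Lemma sink_zero : hom_vanishes (string K p q 0 0 0) M -> forall v, v != source -> dim M v = 0%N.
Proof.
move=> H; have M0 : dim M sink = 0%N.
  apply/eqP; rewrite -leqn0 leqNgt; apply/negP => gt.
  have [|f [hf _ f0]] := hom_of_ends hp hq hpq (Y := string K p q 0 0 0) (fs := 0) (f0 := const_mx 1) iM.
    by move=> st; apply: flat_rows; apply: dim_string_source.
  have lt : (0 < dim (string K p q 0 0 0) sink)%N by rewrite dim_string_sink.
  have /matrixP/(_ (Ordinal lt) (Ordinal gt)) := H f hf sink.
  by rewrite f0 !mxE => /eqP; rewrite oner_eq0.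
by move=> v ns; apply: interior_zero.
Qed.

Lemma retract_simple : ~ is_zero M -> (forall v, v != source -> dim M v = 0%N) ->
  exists (i : fam (@simple K Q source) M) (r : fam M (@simple K Q source)),
    [/\ is_hom i, is_hom r & forall v, i v *m r v = 1%:M].
Proof.
move=> nz Z; have gt : (0 < dim M source)%N.
  rewrite lt0n; apply/eqP => e; apply: nz => v.
  by have [->|/Z] := eqVneq v source.
exists (fun v => \matrix_(x, y) (y == 0 :> nat)%:R), (fun v => \matrix_(x, y) (x == 0 :> nat)%:R).
have tz a := Z _ (tgt_neq_source hp hq hpq a).
split=> [a|a|v].
- by apply: flat_cols; apply: tz.
- by apply: flat_cols; apply: dim_simple_neq; apply: tgt_neq_source.
have [->|ne] := eqVneq v source; last by apply: flat_rows; apply: dim_simple_neq.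
apply/matrixP=> x y; rewrite !mxE (bigD1 (Ordinal gt)) //= big1 => [|z nz0].
  rewrite !mxE addr0 mulr1; have lx := ltn_ord x; have ly := ltn_ord y.
  have d1 : dim (@simple K Q source) source = 1%N by rewrite /= eqxx.
  have -> // : x == y; rewrite -(inj_eq val_inj) /=.
  by move: lx ly; rewrite [X in (_ < X)%N -> _]d1 [X in _ -> (_ < X)%N -> _]d1; case: (x : nat) => //; case: (y : nat).
rewrite !mxE; have -> : (z == 0%N :> nat) = false; last by rewrite mulr0.
by apply: contraNF nz0 => /eqP e; apply/eqP/val_inj.
Qed.

Section Retract.
Variable n : nat.
Local Notation Y := (string K p q n.+1 0 0).
Local Notation N := (string K p q n q.-1 p.-1).
Local Notation A := (down M true source).
Local Notation B := (down M false source).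

(** Such a sequence is a homomorphism from Y: the terms are the images of the
    copies of the source, and the relation is that neighbouring ones agree at
    the copy of the sink between them. *)
Lemma kronecker_inj : hom_vanishes Y M ->
  forall x : nat -> 'rV[K]_(dim M source),
    (forall k, (k < n)%N -> x k *m B = x k.+1 *m A) -> forall k, (k <= n)%N -> x k = 0.
Proof.
move=> H x xE.
pose r k := if (k <= n)%N then x k *m A else x n *m B.
have [st|f [hf fs _]] := hom_of_ends hp hq hpq (Y := Y)
    (fs := rows _ x) (f0 := rows _ r) iM.
  apply: ent_ext => k y; rewrite {1}dim_string_source // => lk ly.
  rewrite ent_down_string_mul // rows_mulmx !ent_rows ?dim_string_source ?dim_string_sink //; last first.
    by case: st; rewrite // ltnW.
  rewrite /r; case: st; first by rewrite -ltnS lk.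
  case: leqP => lk'; last by rewrite -xE.
  by have -> : n = k by lia.
move=> k lk; have lk' : (k < dim Y source)%N by rewrite dim_string_source.
have := H f hf source; rewrite fs => e; apply: ent_ext => i y l1 ly.
have -> : i = 0%N by lia.
by rewrite -(ent_rows x y lk') e !ent0.
Qed.

(** A family z is turned into a cocycle, and a family bounding it differs from a
    homomorphism by exactly z at the inner copies of the sink. *)
Lemma kronecker_surj : ext1_vanishes Y M ->
  forall z : nat -> 'rV[K]_(dim M sink), exists x : nat -> 'rV[K]_(dim M source),
    forall k, (k < n)%N -> x k *m B - x k.+1 *m A = z k.
Proof.
move=> /ext1_vanishesP H z.
(* The cocycle is the coboundary of t along the second path and zero along the
   first, so u is natural along the first path and u - t along the second.  The
   first copy of the sink is not reached from the source along the second path,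
   hence the index shift and the zero row. *)
pose T : 'M_(dim Y sink, dim M sink) := rows _ (fun k => if k is k'.+1 then - z k' else 0).
pose t : fam Y M := fun v => transport Y v sink *m T *m transport M sink v.
have [u uE] := H (fun a => if is_inl a then 0 else coboundary t a).
have eT : down Y true source *m u sink = u source *m A.
  apply: (down_natural hp hq hpq); last exact: on_arm_source.
  move=> a ia; have := uE a; rewrite ia /coboundary => /esym/eqP.
  by rewrite subr_eq0 => /eqP.
have eF : down Y false source *m (u sink - T) = u source *m B.
  have t0 : t sink = T by rewrite /t !transport_id mul1mx mulmx1.
  have ts : t source = 0 by rewrite /t transport_neq ?source_neq_sink // !mul0mx.
  have := @down_natural K p q hp hq hpq Y M false (fun v => u v - t v) _ source (on_arm_source hp hq hpq false).
  rewrite t0 ts subr0; apply=> a ia; have := uE a; rewrite ia /coboundary.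
  rewrite mulmxBr mulmxBl => e.
  by rewrite -[act Y a *m u _](subKr (u (src a) *m act M a)) -e opprB addrA addrAC addrK.
exists (fun k => \row_y ent (u source) k y) => k lk.
have xE m (C : 'M_(_, m)) l : (l <= n)%N -> (\row_y ent (u source) l y) *m C = \row_y ent (u source *m C) l y.
  move=> ll; have ll' : (l < dim Y source)%N by rewrite dim_string_source.
  apply/rowP=> y; rewrite !mxE -[l]/(val (Ordinal ll')) ent_ord mxE.
  by apply: eq_bigr => w _; rewrite mxE ent_ord.
rewrite !xE ?(ltnW lk) // -eT -eF; apply/rowP=> y; rewrite !mxE.
rewrite !ent_down_string_mul //; last by lia.
rewrite entD entN ent_rows ?dim_string_sink //; last by lia.
rewrite addrAC subrr add0r entN opprK -[RHS]ent_ord.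
by rewrite -[0%N]/(val (0 : 'I_1)) ent_ord.
Qed.

Lemma retract_string : (0 < dim M sink)%N -> hom_vanishes Y M -> ext1_vanishes Y M ->
  exists (i : fam N M) (r : fam M N),
    [/\ is_hom i, is_hom r & forall v, i v *m r v = 1%:M].
Proof.
move=> gt H E.
have [X [U [X' [U' [XU XU' AU BU UU]]]]] :=
  kronecker_retract gt (kronecker_inj H) (kronecker_surj E).
have lp : (p.-1 < p)%N by rewrite ltn_predL.
have lq : (q.-1 < q)%N by rewrite ltn_predL.
have [st|f [hf _ f0]] := hom_of_ends hp hq hpq (Y := N) (fs := rows _ X) (f0 := rows _ U) iM.
  apply: ent_ext => k y; rewrite {1}dim_string_source // => lk ly.
  rewrite ent_down_string_mul // rows_mulmx !ent_rows ?dim_string_source ?dim_string_sink //; last first.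
    by case: st; rewrite // ltnW.
  by have [XA XB] := XU k lk; case: st; rewrite ?XA ?XB.
have [st|g [hg _ g0]] := hom_of_ends hp hq hpq (Y := M) (M := N) (fs := cols _ X') (f0 := cols _ U')
    (@string_interior_invertible K p q hp hq hpq n).
  apply: ent_ext => y k ly lk; rewrite dim_string_sink // in lk.
  rewrite ent_mul_down_string // mulmx_cols ent_cols ?dim_string_sink //.
  case: st.
    have [lt|ge] := ltnP k n.
      by rewrite ent_cols ?dim_string_source //; have [-> _] := XU' k lt.
    have -> : k = n by lia.
    by rewrite AU ent0 ent_col_out ?dim_string_source.
  case: k lk => [|k] lk; first by rewrite BU ent0.
  by rewrite ent_cols ?dim_string_source //; have [_ ->] := XU' k lk.
exists f, g; split=> //; apply: (@hom_eq_of_sink K p q hp hq hpq N N (fun v => f v *m g v) (fun=> 1%:M)).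
- by move=> v; apply: row_free_down_string => //; apply: on_arm_of.
- by move=> a; rewrite mulmxA hf -mulmxA hg mulmxA.
- by move=> a; rewrite mulmx1 mul1mx.
rewrite f0 g0 rows_mulmx; apply/matrixP=> k l; rewrite !mxE.
have lk := ltn_ord k; have ll := ltn_ord l.
rewrite [X in (_ < X)%N]dim_string_sink // in lk; rewrite [X in (_ < X)%N]dim_string_sink // in ll.
have := UU k l lk ll; move/matrixP/(_ 0 0); rewrite !mxE eqxx mulr1n (inj_eq val_inj) => <-.
by apply: eq_bigr => y _; rewrite mxE.
Qed.

End Retract.

(** [kronecker_retract] makes the partner a direct summand of M.  Its hypothesis
    that M is nonzero at the sink holds because otherwise every vector at the
    source would be a homomorphism from Y. *)
Lemma partner_unique n : indecomposable M ->
  hom_vanishes (string K p q n 0 0) M -> ext1_vanishes (string K p q n 0 0) M ->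
  isom M (partner K p q n).
Proof.
move=> dM H E.
have [i [r [hi hr ir]]] : exists (i : fam (partner K p q n) M) (r : fam M (partner K p q n)),
    [/\ is_hom i, is_hom r & forall v, i v *m r v = 1%:M].
  case: n H E => [|n] H E; first by apply: retract_simple (sink_zero H); case: dM.
  apply: retract_string => //; rewrite lt0n; apply/eqP => M0.
  have Ms : dim M source = 0%N.
    apply/eqP; rewrite -leqn0 leqNgt; apply/negP => gt.
    have /(_ n (leqnn n))/matrixP/(_ 0 (Ordinal gt)) :=
      kronecker_inj H (x := fun=> delta_mx 0 (Ordinal gt)) (fun k _ => flat_cols _ _ M0).
    by rewrite !mxE !eqxx => /eqP; rewrite oner_eq0.
  case: dM => nz _; apply: nz => v.
  by have [->//|ns] := eqVneq v source; apply: interior_zero.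
apply: isom_of_retract hi hr ir => //; case: (partner_indecomposable K hp hq hpq n) => //.
Qed.

End PartnerUnique.

(** * The list of stratifying systems *)

Section StratifyingConditions.
Variables (K : fieldType) (p q : nat).
Hypotheses (hp : (0 < p)%N) (hq : (0 < q)%N) (hpq : (1 < p + q)%N).
Local Notation Q := (Atilde p q).
Local Notation s := (p + q).-1.
Local Notation source := (source p q).
Local Notation sink := (sink p q).
Implicit Types (M Y : rep K Q) (v : vertex Q) (a : arrow Q).
Local Notation S v := (@simple K Q v).

Lemma stratifying_nth (R : quiver) (x0 : rep K R) (xs : seq (rep K R)) :
  stratifying_system (in_tuple xs) <->
  [/\ forall i, i < size xs -> indecomposable (nth x0 xs i),
      forall i j, i < j < size xs -> hom_vanishes (nth x0 xs j) (nth x0 xs i) &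
      forall i j, i <= j < size xs -> ext1_vanishes (nth x0 xs j) (nth x0 xs i)].
Proof.
have T (i : 'I_(size xs)) : tnth (in_tuple xs) i = nth x0 xs i by rewrite (tnth_nth x0).
split=> [[D H E]|[D H E]]; split=> [i|i j|i j].
- by move=> li; rewrite -(T (Ordinal li)).
- move=> /andP[ij lj]; rewrite -(T (Ordinal lj)) -(T (Ordinal (ltn_trans ij lj))).
  exact: H.
- move=> /andP[ij lj]; rewrite -(T (Ordinal lj)) -(T (Ordinal (leq_ltn_trans ij lj))).
  exact: E.
- by rewrite T; apply: D.
- by move=> ij; rewrite !T; apply: H; rewrite ij /=.
- by move=> ij; rewrite !T; apply: E; rewrite ij /=.
Qed.

(** The vertices whose simples form F followed by G.  Within each path they
    decrease, as arrows do, so that no arrow leads from a later to an earlier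
    entry. *)
Definition interior_seq : seq nat := rev (iota 1 (p - 1)) ++ rev (iota p (q - 1)).

Lemma size_interior_seq : size interior_seq = (p - 1) + (q - 1).
Proof. by rewrite size_cat !size_rev !size_iota. Qed.

Lemma nth_interior_seq k : k < (p - 1) + (q - 1) ->
  nth 0 interior_seq k = if k < p - 1 then p - 1 - k else p + q - 2 - (k - (p - 1)).
Proof.
move=> lk; rewrite nth_cat size_rev size_iota; case: ltnP => le;
  rewrite nth_rev ?size_iota ?nth_iota; lia.
Qed.

Lemma interior_nth k : k < size interior_seq -> interior (vtx p q (nth 0 interior_seq k)).
Proof.
rewrite size_interior_seq => lk; rewrite /interior -!(inj_eq val_inj) /=.
rewrite val_sink // val_source // val_vtx ?nth_interior_seq //; split_ifs; lia.
Qed.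

Lemma nth_interior v : interior v ->
  exists2 k, k < size interior_seq & vtx p q (nth 0 interior_seq k) = v.
Proof.
rewrite /interior -!(inj_eq val_inj) /= val_sink // val_source // => iv.
have lv := vertex_le v.
exists (if v < p then p - 1 - v else p - 1 + (p + q - 2 - v)).
  by rewrite size_interior_seq; case: (ltnP v p) => le; lia.
apply: val_inj => /=; have -> : nth 0 interior_seq
    (if v < p then p - 1 - v else p - 1 + (p + q - 2 - v)) = v.
  by rewrite nth_interior_seq; case: (ltnP v p) => le; split_ifs; lia.
by rewrite val_vtx //; lia.
Qed.

Lemma hom_interior i k : i < k < size interior_seq ->
  hom_vanishes (S (vtx p q (nth 0 interior_seq k))) (S (vtx p q (nth 0 interior_seq i))).
Proof.
rewrite size_interior_seq => lt; apply: hom_simples.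
rewrite -(inj_eq val_inj) /= !val_vtx ?nth_interior_seq //; try (split_ifs; lia).
all: lia.
Qed.

Lemma ext_interior i k : i <= k < size interior_seq ->
  ext1_vanishes (S (vtx p q (nth 0 interior_seq k))) (S (vtx p q (nth 0 interior_seq i))).
Proof.
rewrite size_interior_seq => lt; apply: ext_simples => a.
move=> /(congr1 val) /= sa /(congr1 val) /= ta.
have {sa} : arrow_from a = nth 0 interior_seq k.
  rewrite -(val_src hp hq) [LHS]sa val_vtx // nth_interior_seq; split_ifs; lia.
have {ta} : arrow_to a = nth 0 interior_seq i.
  rewrite -(val_tgt hp hq) [LHS]ta val_vtx // nth_interior_seq; split_ifs; lia.
rewrite !nth_interior_seq; [|lia|lia].
have := arrowP hp hq a; move: (arrow_from a) (arrow_to a) => x y A.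
by case: A => [[_ [l]]|[_ [l]]]; split_ifs; lia.
Qed.

Definition right_perp Y := forall v, interior v ->
  hom_vanishes Y (S v) /\ ext1_vanishes Y (S v).

Lemma seqFG M Y : M :: seqF K p q ++ seqG K p q ++ [:: Y] =
  M :: [seq S_ K p q k | k <- interior_seq] ++ [:: Y].
Proof. by rewrite /seqF /seqG /interior_seq map_cat catA. Qed.

Lemma stratifyingP M Y :
  stratifying_system (in_tuple (M :: seqF K p q ++ seqG K p q ++ [:: Y])) <->
  [/\ indecomposable M /\ ext1_vanishes M M,
      indecomposable Y /\ ext1_vanishes Y Y,
      hom_vanishes Y M /\ ext1_vanishes Y M,
      left_perp M & right_perp Y].
Proof.
rewrite seqFG (stratifying_nth M); set xs := _ :: _; pose m := size interior_seq.
have sz : size xs = m.+2 by rewrite /= size_cat size_map addn1.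
have x0 : nth M xs 0 = M by [].
have x1 k : k < m -> nth M xs k.+1 = S (vtx p q (nth 0 interior_seq k)).
  by move=> lk; rewrite /= nth_cat size_map lk (nth_map 0).
have x2 : nth M xs m.+1 = Y by rewrite /= nth_cat size_map ltnn subnn.
rewrite sz; split=> [[D H E]|[[dM eM] [dY eY] [hYM eYM] LM RY]].
- split.
  + by have := D 0 isT; have := E 0 0 isT; rewrite x0.
  + by have := D m.+1 (leqnn _); have := E m.+1 m.+1; rewrite x2 !leqnn => /(_ isT).
  + have := H 0 m.+1 (leqnn _); have := E 0 m.+1 (leqnn _).
    by rewrite x0 x2.
  + move=> v /nth_interior[k lk <-]; have lk' : 0 < k.+1 < m.+2 by rewrite -/m in lk; lia.
    by have := H 0 k.+1 lk'; have := E 0 k.+1 lk'; rewrite x0 x1.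
  + move=> v /nth_interior[k lk <-]; have lk' : k.+1 < m.+1 < m.+2 by rewrite -/m in lk; lia.
    have lk2 : k.+1 <= m.+1 < m.+2 by lia.
    by have := H _ _ lk'; have := E _ _ lk2; rewrite x2 x1.
have C i : i < m.+2 -> [\/ i = 0, exists2 k, k < m & i = k.+1 | i = m.+1].
  case: i => [|i] li; first by constructor 1.
  have [lt|ge] := ltnP i m; first by constructor 2; exists i.
  by constructor 3; lia.
split=> [i /C[->|[k lk ->]|->]|i j|i j].
- by rewrite x0.
- by rewrite x1 //; apply: simple_indecomposable.
- by rewrite x2.
- case/andP=> ij lj; have /C[iE|[k lk iE]|iE] := ltn_trans ij lj;
    have /C[jE|[l ll jE]|jE] := lj; subst i j; rewrite ?x0 ?x2 ?x1 //; try lia.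
  + by case: (LM _ (interior_nth ll)).
  + by apply: hom_interior; rewrite -/m; lia.
  + by case: (RY _ (interior_nth lk)).
case/andP=> ij lj; have /C[iE|[k lk iE]|iE] := leq_ltn_trans ij lj;
  have /C[jE|[l ll jE]|jE] := lj; subst i j; rewrite ?x0 ?x2 ?x1 //; try lia.
+ by case: (LM _ (interior_nth ll)).
+ by apply: ext_interior; rewrite -/m; lia.
+ by case: (RY _ (interior_nth lk)).
Qed.

Lemma left_perp_isom M M' : isom M M' -> left_perp M -> left_perp M'.
Proof.
move=> MM L v /L[h e]; split; first exact: hom_vanishes_isom (isom_refl _) MM h.
exact: ext1_vanishes_isom (isom_refl _) MM e.
Qed.

Lemma right_perp_isom Y Y' : isom Y Y' -> right_perp Y -> right_perp Y'.
Proof.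
move=> YY L v /L[h e]; split; first exact: hom_vanishes_isom YY (isom_refl _) h.
exact: ext1_vanishes_isom YY (isom_refl _) e.
Qed.

(** Y is tau^-t P_v with both growths divisible, so that neither end stops inside
    a path; the two quotients count the copies of the sink beyond the first. *)
Lemma stratifying_postprojectiveP M Y :
  (stratifying_system (in_tuple (M :: seqF K p q ++ seqG K p q ++ [:: Y])) /\
   postprojective Y) <->
  exists t v (a b : nat), [/\ level_q p v + t = a * q, level_p p v + t = b * p,
     is_tauinv_iter t (@proj K Q v) Y & isom M (partner K p q (a + b))].
Proof.
rewrite stratifyingP; split.
  move=> [[[dM _] _ [hYM eYM] LM RY] [_ [t [v tY]]]].
  have /(is_tauinv_iterP hp hq hpq) iY := tY.
  set k := level_q _ _ + t in iY *; set l := level_p _ _ + t in iY *.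
  have [i0 j0] : k %% q = 0 /\ l %% p = 0.
    apply: (@string_right_perp_inv K p q hp hq hpq (k %/ q + l %/ p)); rewrite ?ltn_mod //.
    by move=> w /(right_perp_isom iY RY)[].
  exists t, v, (k %/ q), (l %/ p).
  have Ek : k = k %/ q * q by rewrite {1}(divn_eq k q) i0 addn0.
  have El : l = l %/ p * p by rewrite {1}(divn_eq l p) j0 addn0.
  split; [exact: Ek|exact: El|by []|].
  have {}iY : isom Y (string K p q (k %/ q + l %/ p) 0 0) by move: iY; rewrite /grown i0 j0.
  apply: partner_unique => //; first exact/left_perp_invertible.
    exact: hom_vanishes_isom iY (isom_refl _) hYM.
  exact: ext1_vanishes_isom iY (isom_refl _) eYM.
move=> [t [v [a [b [kE lE tY iM]]]]].
have iY : isom Y (string K p q (a + b) 0 0).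
  have /(is_tauinv_iterP hp hq hpq) := tY.
  by rewrite kE lE /grown !mulnK // !modnMl.
have {}iM := isom_sym iM; have {}iY := isom_sym iY.
have dY : indecomposable Y.
  by apply: (indecomposable_isom iY); apply: string_indecomposable.
split; last by split=> //; exists t, v.
split.
- split; first exact: indecomposable_isom iM (partner_indecomposable _ _ _ _ _).
  by apply: (ext1_vanishes_isom iM iM); apply: partner_rigid.
- by split=> //; apply: (ext1_vanishes_isom iY iY); apply: string00_rigid.
- split; first by apply: (hom_vanishes_isom iY iM); apply: string_partner_hom.
  by apply: (ext1_vanishes_isom iY iM); apply: string_partner_ext.
- by apply: (left_perp_isom iM); apply: partner_left_perp.
by apply: (right_perp_isom iY) => w iw; apply: string_right_perp.
Qed.

(** The ends of the partner are one step short of completing their paths, so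
    one more step makes both growths divisible. *)
Lemma is_tauinv_iter_partnerP t v (a b : nat) M :
    level_q p v + t + 1 = a.+1 * q -> level_p p v + t + 1 = b.+1 * p ->
  is_tauinv_iter t (@proj K Q v) M <-> isom M (partner K p q (a + b).+1).
Proof.
move=> kE lE; rewrite is_tauinv_iterP // /grown.
have -> : level_q p v + t = a * q + q.-1 by rewrite mulSn in kE; lia.
have -> : level_p p v + t = b * p + p.-1 by rewrite mulSn in lE; lia.
have lp : p.-1 < p by rewrite prednK.
have lq : q.-1 < q by rewrite prednK.
by rewrite !divnMDl // !divn_small // !modnMDl !modn_small // !addn0.
Qed.

End StratifyingConditions.

Section Listed.
Variables (K : fieldType) (p q : nat).
Hypotheses (hp : 0 < p) (hq : 0 < q) (hpq : 1 < p + q).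
Implicit Types M Y : rep K (Atilde p q).

(** The case a = 0 or b = 0 cannot occur: the growth increased by one is
    positive. *)
Lemma P_iter_partnerP t j a b n M : j < p + q ->
    level_q p j + t + 1 = a * q -> level_p p j + t + 1 = b * p -> n.+1 = a + b ->
  is_tauinv_iter t (P_ K p q j) M <-> isom M (partner K p q n).
Proof.
case: a => [|a] lj; first by rewrite mul0n addn1.
case: b => [|b] kE; first by rewrite mul0n addn1.
move=> lE; rewrite addSn addnS => -[->].
by apply: is_tauinv_iter_partnerP; rewrite ?val_vtx.
Qed.

Lemma listed_pair t j a b M Y : j < p + q ->
    level_q p j + t = a * q -> level_p p j + t = b * p ->
    is_tauinv_iter t (P_ K p q j) Y -> isom M (partner K p q (a + b)) ->
  stratifying_system (in_tuple (M :: seqF K p q ++ seqG K p q ++ [:: Y])) /\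
  postprojective Y.
Proof.
move=> lj kE lE tY iM; apply/stratifying_postprojectiveP => //.
by exists t, (vtx p q j), a, b; split=> //; rewrite val_vtx.
Qed.

End Listed.

Theorem proposition14 (K : closedFieldType) (p q : nat)
    (hp : (1 <= p)%N) (hpq : (p <= q)%N) (hq : (1 < q)%N)
    (M Y : rep K (Atilde p q)) :
  (stratifying_system
     (in_tuple (M :: seqF K p q ++ seqG K p q ++ [:: Y])) /\
   postprojective Y)
  <->
  ( (* (1) *)
    (isom M (S_ K p q (p + q - 1)) /\ isom Y (P_ K p q 0))
  \/ (* (2) *)
    (isom Y (P_ K p q (p + q - 1)) /\
     (if p == q then is_tauinv_iter (p - 1) (P_ K p q 0) M
      else is_tauinv_iter (p - 1) (P_ K p q (q - 1)) M))
  \/ (* (3) *)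
    (exists t : nat,
      [/\ (1 <= t)%N, (p %| t)%N, (q %| t)%N,
          is_tauinv_iter t (P_ K p q (p + q - 1)) Y &
          if p == q then is_tauinv_iter (t + p - 1) (P_ K p q 0) M
          else is_tauinv_iter (t + p - 1) (P_ K p q (q - 1)) M])
  \/ (* (4) *)
    (exists t : nat,
      [/\ (1 <= t)%N, (p %| t)%N, (q %| t)%N,
          is_tauinv_iter (t - 1) (P_ K p q (p + q - 1)) M &
          is_tauinv_iter t (P_ K p q 0) Y])
  \/ (* (5) *)
    (exists t r : nat,
      [/\ (1 <= t)%N /\ (1 <= r <= p - 1)%N,
          (q %| t)%N, (t = r %[mod p])%N,
          is_tauinv_iter (t + (p - r - 1)) (P_ K p q (q + r - 1)) M &
          is_tauinv_iter t (P_ K p q (p - r)) Y])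
  \/ (* (6) *)
    (exists t r : nat,
      [/\ (1 <= t)%N /\ (1 <= r <= q - 1)%N,
          (p %| t)%N, (t = r %[mod q])%N,
          is_tauinv_iter t (P_ K p q (p + q - r - 1)) Y &
          if (q - r <= p)%N
          then is_tauinv_iter (t + q - r - 1) (P_ K p q (p - (q - r))) M
          else is_tauinv_iter (t + p - 1) (P_ K p q (q - r - 1)) M]) ).
Proof.
have q0 : 0 < q by apply: ltnW.
have pq1 : 1 < p + q by apply: leq_trans hq (leq_addl _ _).
(* M for Y = tau^-t P_v with v the source, the sink, a vertex inside the path of
   p arrows and one inside the path of q arrows; a and b are the quotients by p
   and by q. *)
have partner_s t a b (M' : rep K (Atilde p q)) : t = a * p -> t = b * q ->
    (if p == q then is_tauinv_iter (t + p - 1) (P_ K p q 0) M'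
     else is_tauinv_iter (t + p - 1) (P_ K p q (q - 1)) M') <->
    isom M' (partner K p q (a + b).+1).
  move=> tp tq; have e1 : (a + b).+2 = b.+1 + a.+1 by rewrite addSn addnS addnC.
  case: eqP => pq.
    apply: P_iter_partnerP e1 => //; rewrite /level_q /level_p ?hp ?mulSn; lia.
  have lt : (q - 1 < p) = false by lia.
  apply: P_iter_partnerP e1 => //; rewrite /level_q /level_p ?lt ?mulSn; lia.
have lqs : level_q p (p + q - 1) = q.
  rewrite /level_q ifF; lia.
have lps : level_p p (p + q - 1) = 0.
  rewrite /level_p ifF; lia.
have ls : p + q - 1 < p + q by lia.
have l0 : 0 < p + q by lia.
have partner_0 t a b (M' : rep K (Atilde p q)) : 0 < t -> t = a * p -> t = b * q ->
    is_tauinv_iter (t - 1) (P_ K p q (p + q - 1)) M' <->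
    isom M' (partner K p q (a + b)).
  move=> t0 tp tq; have e1 : (a + b).+1 = b.+1 + a by rewrite addSn addnC.
  apply: P_iter_partnerP e1 => //; rewrite ?lqs ?lps ?mulSn; lia.
have partner_p t r a b (M' : rep K (Atilde p q)) : 0 < r < p -> t + (p - r) = a * p -> t = b * q ->
    is_tauinv_iter (t + (p - r - 1)) (P_ K p q (q + r - 1)) M' <->
    isom M' (partner K p q (a + b)).
  move=> rp tp tq; have e1 : (a + b).+1 = b.+1 + a by rewrite addSn addnC.
  have lt : (q + r - 1 < p) = false by lia.
  apply: P_iter_partnerP e1 => //; rewrite /level_q /level_p ?lt ?mulSn; lia.
have partner_q t r a b (M' : rep K (Atilde p q)) : 0 < r < q -> t = a * p -> t + (q - r) = b * q ->
    (if (q - r <= p)%N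
     then is_tauinv_iter (t + q - r - 1) (P_ K p q (p - (q - r))) M'
     else is_tauinv_iter (t + p - 1) (P_ K p q (q - r - 1)) M') <->
    isom M' (partner K p q (a + b)).
  move=> rp tp tq; have e1 : (a + b).+1 = b + a.+1 by rewrite addnS addnC.
  case: ifP => le.
    have lt : p - (q - r) < p by lia.
    apply: P_iter_partnerP e1 => //; rewrite /level_q /level_p ?lt ?mulSn; lia.
  have lt : (q - r - 1 < p) = false by lia.
  apply: P_iter_partnerP e1 => //; rewrite /level_q /level_p ?lt ?mulSn; lia.
split.
  move/stratifying_postprojectiveP => /(_ hp q0 pq1) [t [v [a [b]]]].
  have lv : v < p + q by have := vertex_le v; lia.
  have -> : proj K v = P_ K p q v.
    by congr (proj K _); apply: val_inj; rewrite /= val_vtx.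
  move: (v : nat) lv => {v} j lj [kE lE tY iM].
  have [j0|jpos] := posnP j.
    rewrite j0 /level_q /level_p hp !add0n in kE lE tY.
    have [t0|t0] := posnP t.
      have a0 : a = 0 by move: kE; rewrite t0; case: (a) => // *; lia.
      have b0 : b = 0 by move: lE; rewrite t0; case: (b) => // *; lia.
      left; split; last by move: tY; rewrite t0.
      by move: iM; rewrite a0 b0 /= /S_ subn1.
    right; right; right; left; exists t; split=> //.
    - by rewrite lE dvdn_mull.
    - by rewrite kE dvdn_mull.
    by apply/(partner_0 t b a) => //; rewrite addnC.
  have [js|js] := eqVneq j (p + q - 1).
    rewrite js lqs lps add0n in kE lE tY.
    have [a' aE] : exists a', a = a'.+1.
      by case: (a) kE => [|a'] kE; [lia|exists a'].
    have {}kE : t = a' * q by move: kE; rewrite aE mulSn; lia.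
    have iM0 := iM; have {}iM := (partner_s t b a' M lE kE).2; rewrite aE addSn addnC in iM0.
    have {}iM := iM iM0.
    right; have [t0|t0] := posnP t.
      by left; rewrite t0 in tY iM.
    right; left; exists t; split=> //; first by rewrite lE dvdn_mull.
    by rewrite kE dvdn_mull.
  have [lt|ge] := ltnP j p.
    rewrite /level_q /level_p lt add0n in kE lE tY.
    right; right; right; right; left; exists t, (p - j).
    have rj : p - (p - j) = j by lia.
    have t0 : 0 < t.
      rewrite lt0n; apply/eqP=> t0; move: lE; rewrite t0 addn0.
      by case: (b) => [|b'] e; [lia|move: lt; rewrite e mulSn; lia].
    split; last by rewrite rj.
    - by split=> //; lia.
    - by rewrite kE dvdn_mull.
    - by apply/eqP; rewrite -(eqn_modDr j) subnK ?(ltnW lt) // modnn addnC lE modnMl.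
    apply/(partner_p t (p - j) b a); rewrite ?rj //; [lia|by rewrite addnC|by rewrite addnC].
  have lt : (j < p) = false by lia.
  rewrite /level_q /level_p lt add0n in kE lE tY.
  right; right; right; right; right; exists t, (p + q - 1 - j).
  have rj : p + q - (p + q - 1 - j) - 1 = j by lia.
  have rq : q - (p + q - 1 - j) = (j - p).+1 by lia.
  have t0 : 0 < t.
    rewrite lt0n; apply/eqP=> t0; move: kE; rewrite t0 addn0.
    by case: (a) => [|a'] e; [lia|move: e; rewrite mulSn; lia].
  split; first by split=> //; lia.
  - by rewrite lE dvdn_mull.
  - apply/eqP; rewrite -(eqn_modDr (j - p).+1) addnC kE modnMl.
    have -> : p + q - 1 - j + (j - p).+1 = q by lia.
    by rewrite modnn.
  - by rewrite rj.
  apply/(partner_q t _ b a); rewrite ?rq //; [lia|by rewrite addnC|by rewrite addnC].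
case=> [[iM iY]|[[iY tM]|[[t [t0 /dvdnP[b tp] /dvdnP[a tq] tY tM]]|[[t [t0 /dvdnP[b tp] /dvdnP[a tq] tM tY]]|
  [[t [r [[t0 rp] /dvdnP[a tq] tr tM tY]]]|[t [r [[t0 rq] /dvdnP[b tp] tr tY tM]]]]]]]].
- apply: (@listed_pair K p q hp q0 pq1 0 0 0 0) => //; rewrite ?/level_q ?/level_p ?hp //.
  by move: iM; rewrite /S_ subn1.
- apply: (@listed_pair K p q hp q0 pq1 0 (p + q - 1) 1 0) => //; rewrite ?lqs ?lps ?addn0 ?mul1n //.
  exact: (partner_s 0 0 0 M erefl erefl).1 tM.
- apply: (@listed_pair K p q hp q0 pq1 t (p + q - 1) a.+1 b) => //; rewrite ?lqs ?lps ?mulSn -?tq //.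
  by rewrite addSn addnC; apply: (partner_s t b a M tp tq).1 tM.
- apply: (@listed_pair K p q hp q0 pq1 t 0 a b) => //; rewrite ?/level_q ?/level_p ?hp //.
  by rewrite addnC; apply: (partner_0 t b a M t0 tp tq).1 tM.
- have [b bE] : exists b, t + (p - r) = b * p.
    apply/dvdnP; rewrite /dvdn -modnDml tr modnDml subnKC ?modnn //; lia.
  have lt : p - r < p by lia.
  apply: (@listed_pair K p q hp q0 pq1 t (p - r) a b); rewrite ?/level_q ?/level_p ?lt //; try lia.
  by rewrite addnC; apply: (partner_p t r b a M _ bE tq).1 tM; lia.
have [a aE] : exists a, t + (q - r) = a * q.
  apply/dvdnP; rewrite /dvdn -modnDml tr modnDml subnKC ?modnn //; lia.
have lt : (p + q - r - 1 < p) = false by lia.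
apply: (@listed_pair K p q hp q0 pq1 t (p + q - r - 1) a b); rewrite ?/level_q ?/level_p ?lt //; try lia.
by rewrite addnC; apply: (partner_q t r b a M _ tp aE).1 tM; lia.
Qed.
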